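(* Let $\beta>0$ and let $\{B_\omega(t)\}_{t\ge 0}$ be a standard Brownian motion defined on a probability space $(\Omega,\mathcal{F},\mathbf{P})$, with $B_\omega(0)=0$ and $t\mapsto B_\omega(t)$ continuous for every $\omega\in\Omega$. For each $\omega$, consider the formal expression $$H=-\frac{d^2}{dt^2}+t+\frac{2}{\sqrt{\beta}}B_\omega'(t),\qquad t\ge 0,$$ with Dirichlet boundary condition at $t=0$, and let $H_0^S(\omega)$ be its realization $H_0^S(p,Q)$ with $p(t)=t$ and $Q(t)=\frac{2}{\sqrt{\beta}}B_\omega(t)$, as defined in the context. Then for each $\omega\in\Omega$, $H_0^S(\omega)$ is a (densely defined) closed symmetric operator in $L^2(\mathbf{R}_+)$, and with probability one $H_0^S(\omega)$ is self-adjoint and has purely discrete spectrum.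
   Context: $\mathbf{R}_+=[0,\infty)$; $L^2(\mathbf{R}_+)$ is the complex Hilbert space of square integrable functions. ''Absolutely continuous on $[0,\infty)$'' means absolutely continuous on every compact subinterval. ''Purely discrete spectrum'' means that the spectrum consists only of isolated eigenvalues of finite multiplicity. Realization of $-\frac{d^2}{dt^2}+p(t)+Q'(t)$ ($Q'$ the formal derivative). Let $p,Q$ be real valued continuous functions on $[0,\infty)$ with $Q(0)=0$. A complex valued function $u$ belongs to the space $\mathcal{C}=\mathcal{C}(p,Q)$ if and only if $u$ is absolutely continuous on $[0,\infty)$ and there are $\alpha\in\mathbf{C}$ and $v\in L^1_{loc}(\mathbf{R}_+)$ such that $$u'(t)=\alpha+Q(t)u(t)+\int_0^t\{p(y)u(y)-Q(y)u'(y)-v(y)\}\,dy .$$ The function $v$ is uniquely determined by $u$ as an element of $L^1_{loc}(\mathbf{R}_+)$, and one sets $Hu=H(p,Q)u:=v$. Equivalently, with the quasi-derivative $u^{[1]}:=u'-Qu$, $u\in\mathcal{C}$ iff $u$ and $u^{[1]}$ are absolutely continuous on $[0,\infty)$, and then $Hu=-(u^{[1]})'+(p-Q^2)u-Qu^{[1]}$. For $u\in\mathcal C$, $u'$ denotes the continuous version $u^{[1]}+Qu$. For $u_1,u_2\in\mathcal{C}$ put $[u_1,u_2](t):=u_1(t)u_2'(t)-u_1'(t)u_2(t)$. Define $$\mathcal{D}_0:=\{u\in\mathcal{C}\cap L^2(\mathbf{R}_+):\ u(0)=0,\ Hu\in L^2(\mathbf{R}_+)\},$$ $$\mathcal{D}_0^S:=\{u\in\mathcal{D}_0:\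 \lim_{t\to\infty}[u,v](t)=0\ \text{for any } v\in\mathcal{D}_0\},$$ and $H_0^S=H_0^S(p,Q):=H|_{\mathcal{D}_0^S}$. *)

(* Defs.v *)
From HB Require Import structures.
From mathcomp Require Import all_boot all_order all_algebra.
From mathcomp Require Import ring_quotient.
From mathcomp Require Import all_classical all_reals all_analysis.
From mathcomp Require Import measurable_realfun.
From mathcomp.real_closed Require Import complex.
From mathcomp Require Import lra.

Set Implicit Arguments.
Unset Strict Implicit.
Unset Printing Implicit Defensive.

Import Order.TTheory GRing.Theory Num.Theory.
Import numFieldNormedType.Exports.
Import Normc.

Local Notation Re := complex.Re.
Local Notation Im := complex.Im.

Local Open Scope classical_set_scope.
Local Open Scope complex_scope.
Local Open Scope ring_scope.
Local Open Scope quotient_scope.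

(* A complex valued function on [0,oo) is represented by a function R -> R[i]
   whose values at negative arguments are irrelevant: everything below depends
   only on its restriction to [half_line].  Integrals, derivatives and
   continuity of complex valued functions are taken componentwise. *)
Section square_integrable.
Context {R : realType}.
Implicit Types f g u v : R -> R[i].

Local Notation mu := (@lebesgue_measure R).

Definition half_line : set R := `[0, +oo[.

Definition cmeasurable (D : set R) f : Prop :=
  measurable_fun D (fun t => Re (f t)) /\ measurable_fun D (fun t => Im (f t)).

Definition cintegrable (D : set R) f : Prop :=
  mu.-integrable D (fun t => (Re (f t))%:E) /\
  mu.-integrable D (fun t => (Im (f t))%:E).

Definition cintegral (D : set R) f : R[i] :=
  (\int[mu]_(t in D) Re (f t)) +i* (\int[mu]_(t in D) Im (f t)).

Definition square_integrable : {pred R -> R[i]} := fun f =>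
  `[< cmeasurable half_line f /\
      (\int[mu]_(t in half_line) (normc (f t) ^+ 2)%:E < +oo)%E >].

Lemma measurable_half_line : measurable half_line.
Proof. exact: measurable_itv. Qed.

Lemma normc2E (z : R[i]) : normc z ^+ 2 = Re z ^+ 2 + Im z ^+ 2.
Proof. by case: z => a b; rewrite /normc sqr_sqrtr // addr_ge0 ?sqr_ge0. Qed.

Lemma measurable_normc2 f : cmeasurable half_line f ->
  measurable_fun half_line (fun t => (normc (f t) ^+ 2)%:E).
Proof.
move=> [mr mi]; apply/measurable_EFinP.
under eq_fun do rewrite normc2E.
by apply: measurable_funD; apply: measurable_funX.
Qed.

Lemma square_integrable_submod : submod_closed square_integrable.
Proof.
split.
  apply/asboolP; split; first by split => /=; exact: measurable_cst.
  by under eq_integral do rewrite normc2E /= expr0n addr0; rewrite integral0.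
move=> a f g /asboolP [mf lf] /asboolP [mg lg]; apply/asboolP.
have [mf1 mf2] := mf; have [mg1 mg2] := mg.
have E t : (a *: f + g) t = a * f t + g t by [].
have mfg : cmeasurable half_line (a *: f + g).
  split.
    under eq_fun do rewrite E.
    rewrite (_ : (fun t => _) = (fun t =>
      (Re a * Re (f t) - Im a * Im (f t)) + Re (g t))); last first.
      by apply/funext => t; case: a {E} => ? ?; case: (f t) => ? ?; case: (g t).
    by apply: measurable_funD => //; apply: measurable_funB;
      apply: measurable_funM => //; exact: measurable_cst.
  under eq_fun do rewrite E.
  rewrite (_ : (fun t => _) = (fun t =>
    (Re a * Im (f t) + Im a * Re (f t)) + Im (g t))); last first.
    by apply/funext => t; case: a {E} => ? ?; case: (f t) => ? ?; case: (g t).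
  by apply: measurable_funD => //; apply: measurable_funD;
    apply: measurable_funM => //; exact: measurable_cst.
split => //.
have normc2_ge0 h t : (0 <= (normc (h t) ^+ 2)%:E :> \bar R)%E.
  by rewrite lee_fin; exact: sqr_ge0.
pose F t := ((2 * normc a ^+ 2)%:E * (normc (f t) ^+ 2)%:E
             + 2%:E * (normc (g t) ^+ 2)%:E)%E.
have a2 : 0 <= 2 * normc a ^+ 2 :> R by apply: mulr_ge0 => //; exact: sqr_ge0.
have F1 t : (0 <= (2 * normc a ^+ 2)%:E * (normc (f t) ^+ 2)%:E)%E.
  by apply: mule_ge0.
have F2 t : (0 <= 2%:E * (normc (g t) ^+ 2)%:E)%E by apply: mule_ge0.
have m1 : measurable_fun half_line
    (fun t => ((2 * normc a ^+ 2)%:E * (normc (f t) ^+ 2)%:E)%E).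
  by apply: measurable_funeM; exact: measurable_normc2.
have m2 : measurable_fun half_line (fun t => (2%:E * (normc (g t) ^+ 2)%:E)%E).
  by apply: measurable_funeM; exact: measurable_normc2.
have mh := measurable_half_line.
apply: (@le_lt_trans _ _ (\int[mu]_(t in half_line) F t)%E).
  apply: ge0_le_integral => //.
  - exact: measurable_normc2.
  - exact: emeasurable_funD.
  - move=> t _; rewrite /F -!EFinM -EFinD lee_fin E.
    have H : normc (a * f t + g t) <= normc a * normc (f t) + normc (g t).
      by rewrite -normcM; exact: le_normcD.
    have n0 z : 0 <= normc z :> R by case: z => ? ?; rewrite sqrtr_ge0.
    have := n0 (a * f t + g t); have := sqr_ge0 (normc a * normc (f t) - normc (g t)).
    move: H; move: (normc _) (normc a) (normc _) (normc _) => n x y z.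
    by nra.
rewrite ge0_integralD // !ge0_integralZl_EFin //; last 2 first.
- exact: measurable_normc2.
- exact: measurable_normc2.
by apply: lte_add_pinfty; apply: lte_mul_pinfty.
Qed.

HB.instance Definition _ :=
  GRing.isSubmodClosed.Build _ _ square_integrable square_integrable_submod.

End square_integrable.

Record L2fun (R : realType) := L2Fun {
  L2fun_val :> R -> R[i];
  L2fun_valP : L2fun_val \in square_integrable }.

HB.instance Definition _ (R : realType) := [isSub for @L2fun_val R].
HB.instance Definition _ (R : realType) := [Choice of L2fun R by <:].
HB.instance Definition _ (R : realType) := [SubChoice_isSubLmodule of L2fun R by <:].

Section L2.
Context {R : realType}.

Local Notation mu := (@lebesgue_measure R).

Definition L2null : {pred L2fun R} := fun f =>
  `[< ae_eq mu half_line (f : R -> R[i]) (fun=> 0) >].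

Lemma L2null_zmod_closed : zmod_closed L2null.
Proof.
split; first by apply/asboolP; apply: aeW.
move=> f g /asboolP f0 /asboolP g0; apply/asboolP.
apply: filterS2 f0 g0 => t ft gt Dt.
by rewrite -[LHS]/(f t - g t) ft // gt // subrr.
Qed.

HB.instance Definition _ := GRing.isZmodClosed.Build _ L2null L2null_zmod_closed.

End L2.

Definition L2 (R : realType) := Quotient.quot (@L2null R).
HB.instance Definition _ (R : realType) := GRing.Zmodule.on (L2 R).
HB.instance Definition _ (R : realType) := EqQuotient.on (L2 R).

Section L2_lmodule.
Context {R : realType}.
Implicit Types (f g : L2fun R) (a b : R[i]) (x y : L2 R).

Definition L2class f : L2 R := \pi f.

Lemma L2classP f g :
  L2class f = L2class g <-> ae_eq (@lebesgue_measure R) half_line f g.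
Proof.
rewrite /L2class; split => [/eqP|fg].
  rewrite -Quotient.idealrBE => /asboolP.
  by apply: filterS => t h Dt; apply/eqP; rewrite -subr_eq0; apply/eqP/h.
apply/eqP; rewrite -Quotient.idealrBE; apply/asboolP.
apply: filterS fg => t h Dt.
by rewrite -[LHS]/(f t - g t) h // subrr.
Qed.

Lemma L2classD f g : L2class (f + g) = L2class f + L2class g.
Proof. by rewrite /L2class !piE. Qed.

Definition L2scale a x : L2 R := L2class (a *: repr x).

Lemma L2classZ a f : L2class (a *: f) = L2scale a (L2class f).
Proof.
apply/L2classP.
have /L2classP : L2class f = L2class (repr (L2class f)) by rewrite /L2class reprK.
by apply: filterS => t h Dt; rewrite -[LHS]/(a * f t) h.
Qed.

Lemma L2class_surj x : exists f, x = L2class f.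
Proof. by exists (repr x); rewrite /L2class reprK. Qed.

Lemma L2scaleA a b x : L2scale a (L2scale b x) = L2scale (a * b) x.
Proof. by have [f ->] := L2class_surj x; rewrite -!L2classZ scalerA. Qed.

Lemma L2scale1 : left_id 1 L2scale.
Proof. by move=> x; have [f ->] := L2class_surj x; rewrite -L2classZ scale1r. Qed.

Lemma L2scaleDr : right_distributive L2scale +%R.
Proof.
move=> a x y; have [f ->] := L2class_surj x; have [g ->] := L2class_surj y.
by rewrite -L2classD -!L2classZ -L2classD scalerDr.
Qed.

Lemma L2scaleDl x : {morph L2scale^~ x : a b / a + b}.
Proof.
move=> a b; have [f ->] := L2class_surj x.
by rewrite -!L2classZ -L2classD scalerDl.
Qed.

HB.instance Definition _ :=
  GRing.Zmodule_isLmodule.Build R[i] (L2 R) L2scaleA L2scale1 L2scaleDr L2scaleDl.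

Definition L2dot x y : R[i] :=
  cintegral half_line (fun t => (repr x : L2fun R) t * conjc ((repr y : L2fun R) t)).

Lemma cmeasurable_dot f g :
  cmeasurable half_line (fun t => f t * conjc (g t)).
Proof.
have /asboolP[[mf1 mf2] _] := L2fun_valP f.
have /asboolP[[mg1 mg2] _] := L2fun_valP g.
split.
  rewrite (_ : (fun t => _) =
      (fun t => Re (f t) * Re (g t) + Im (f t) * Im (g t))); last first.
    apply/funext => t; case: (f t) => p q; case: (g t) => r s /=.
    by rewrite mulrN opprK.
  by apply: measurable_funD; apply: measurable_funM.
rewrite (_ : (fun t => _) =
    (fun t => Im (f t) * Re (g t) - Re (f t) * Im (g t))); last first.
  apply/funext => t; case: (f t) => p q; case: (g t) => r s /=.
  by rewrite mulrN addrC.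
by apply: measurable_funB; apply: measurable_funM.
Qed.

Lemma L2dotE f g :
  L2dot (L2class f) (L2class g) = cintegral half_line (fun t => f t * conjc (g t)).
Proof.
have E h : ae_eq (@lebesgue_measure R) half_line (repr (L2class h) : L2fun R) h.
  by apply/L2classP; rewrite /L2class reprK.
have [m1 m2] := cmeasurable_dot (repr (L2class f)) (repr (L2class g)).
have [m3 m4] := cmeasurable_dot f g.
congr Complex; congr fine; apply: ae_eq_integral.
- exact: measurable_half_line.
- exact/measurable_EFinP.
- exact/measurable_EFinP.
- by apply: filterS2 (E f) (E g) => t hf hg Dt; rewrite hf // hg.
- exact: measurable_half_line.
- exact/measurable_EFinP.
- exact/measurable_EFinP.
- by apply: filterS2 (E f) (E g) => t hf hg Dt; rewrite hf // hg.
Qed.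

End L2_lmodule.

(* Unbounded linear operators in an inner product space are represented by
   their graphs: [G (x, y)] means that [x] is in the domain and is mapped to
   [y].  The inner product [dot] is linear in its first argument. *)
Section unbounded_operators.
Context {R : realType} {E : lmodType R[i]} (dot : E -> E -> R[i]).
Implicit Types (G : set (E * E)) (x y : E) (z : R[i]).

Definition dot_norm x : R := Num.sqrt (Re (dot x x)).

Definition op_domain G : set E := [set x | exists y, G (x, y)].

Definition linear_operator G : Prop :=
  [/\ G (0, 0),
      forall z x1 y1 x2 y2, G (x1, y1) -> G (x2, y2) ->
        G (z *: x1 + x2, z *: y1 + y2) &
      forall x y1 y2, G (x, y1) -> G (x, y2) -> y1 = y2].

Definition densely_defined G : Prop :=
  forall x (e : R), 0 < e -> exists2 a, op_domain G a & dot_norm (x - a) < e.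

Definition closed_operator G : Prop :=
  forall x y,
    (forall e : R, 0 < e -> exists a b,
      [/\ G (a, b), dot_norm (x - a) < e & dot_norm (y - b) < e]) ->
    G (x, y).

Definition symmetric_operator G : Prop :=
  forall x1 y1 x2 y2, G (x1, y1) -> G (x2, y2) -> dot y1 x2 = dot x1 y2.

Definition adjoint G : set (E * E) :=
  [set p | forall a b, G (a, b) -> dot b p.1 = dot a p.2].

Definition self_adjoint G : Prop :=
  [/\ linear_operator G, densely_defined G & adjoint G = G].

(* [G (x, y + z *: x)] says that (G - z) x = y. *)
Definition resolvent_set G : set R[i] := [set z |
  (forall y, exists! x, G (x, y + z *: x)) /\
  (exists M : R, forall x y, G (x, y + z *: x) -> dot_norm x <= M * dot_norm y)].

Definition spectrum G : set R[i] := ~` resolvent_set G.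

Definition isolated_in (S : set R[i]) z : Prop :=
  exists2 e : R, 0 < e & forall w, S w -> normc (w - z) < e -> w = z.

Definition eigenvalue_of G z : Prop := exists2 x, x != 0 & G (x, z *: x).

Definition finite_multiplicity G z : Prop :=
  exists n (b : 'I_n -> E), forall x, G (x, z *: x) ->
    exists c : 'I_n -> R[i], x = \sum_(i < n) c i *: b i.

Definition purely_discrete_spectrum G : Prop :=
  forall z, spectrum G z ->
    [/\ isolated_in (spectrum G) z, eigenvalue_of G z & finite_multiplicity G z].

End unbounded_operators.

Section sturm_liouville.
Context {R : realType}.
Implicit Types (p Q : R -> R) (u v w : R -> R[i]).

Local Notation mu := (@lebesgue_measure R).

Definition abs_cont_on (a b : R) u : Prop :=
  forall e : R, 0 < e -> exists2 d : R, 0 < d &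
    forall (n : nat) (s t : 'I_n -> R),
      (forall i, a <= s i /\ s i <= t i /\ t i <= b) ->
      trivIset setT (fun i => `]s i, t i[%classic) ->
      \sum_(i < n) (t i - s i) < d ->
      \sum_(i < n) normc (u (t i) - u (s i)) < e.

Definition loc_abs_cont u : Prop :=
  forall a b, 0 <= a -> a <= b -> abs_cont_on a b u.

Definition loc_integrable v : Prop :=
  forall T, 0 <= T -> cintegrable `[0, T] v.

Definition has_cderiv u (t : R) (l : R[i]) : Prop :=
  is_derive t 1 (fun s => Re (u s)) (Re l) /\
  is_derive t 1 (fun s => Im (u s)) (Im l).

Definition cderiv u (t : R) : R[i] :=
  derive1 (fun s => Re (u s)) t +i* derive1 (fun s => Im (u s)) t.

(* [is_Hop p Q u v] states that [u] is in C(p,Q) and that [v] is a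
   representative of H(p,Q)u; such a [v] is determined by [u] up to null sets.
   The equation for u' is understood almost everywhere, as [u] is only assumed
   to be absolutely continuous. *)
Definition is_Hop p Q u v : Prop :=
  [/\ loc_abs_cont u, loc_integrable v &
   exists alpha : R[i],
     {ae mu, forall t, 0 <= t -> has_cderiv u t
       (alpha + (Q t)%:C * u t +
        cintegral `[0, t]
          (fun y => (p y)%:C * u y - (Q y)%:C * cderiv u y - v y))}].

Definition C_space p Q : set (R -> R[i]) := [set u | exists v, is_Hop p Q u v].

Definition is_cont_deriv u w : Prop :=
  [/\ {within half_line, continuous (fun t => Re (w t))},
      {within half_line, continuous (fun t => Im (w t))} &
      {ae mu, forall t, 0 <= t -> has_cderiv u t (w t)}].

(* For [u] in C(p,Q), the continuous version of u', which is unique on the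
   half-line and equal to the quasi-derivative plus Q u. *)
Definition cont_deriv u : R -> R[i] := xget (fun=> 0) (is_cont_deriv u).

Definition wronskian u1 u2 (t : R) : R[i] :=
  u1 t * cont_deriv u2 t - cont_deriv u1 t * u2 t.

Definition D0 p Q : set (R -> R[i]) := [set u |
  [/\ C_space p Q u, u \in square_integrable, u 0 = 0 &
      exists v, is_Hop p Q u v /\ v \in square_integrable]].

Definition D0S p Q : set (R -> R[i]) := [set u |
  D0 p Q u /\
  forall v, D0 p Q v -> (fun t => normc (wronskian u v t)) @ +oo --> (0 : R)].

(* The graph in L^2 x L^2: [f] is a representative of an element of the domain
   and [g] a square integrable representative of its image. *)
Definition H0S p Q : set (L2 R * L2 R) := [set xy |
  exists f g : L2fun R,
    [/\ xy = (L2class f, L2class g), D0S p Q f & is_Hop p Q f g]].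

End sturm_liouville.

Section brownian_motion.
Context d (Omega : measurableType d) {R : realType} (P : probability Omega R).

(* Only times in [0,oo) matter; the second parameter of [normal_prob] is the
   standard deviation.  A finite sequence of times is extended to a
   nondecreasing sequence indexed by nat. *)
Definition standard_brownian_motion (B : R -> Omega -> R) : Prop :=
  [/\ forall t, 0 <= t -> measurable_fun setT (B t),
      forall omega, B 0 omega = 0,
      forall omega, {within half_line, continuous (fun t => B t omega)},
      forall s t, 0 <= s -> s < t -> forall A : set R, measurable A ->
        P ((fun omega => B t omega - B s omega) @^-1` A) =
        normal_prob 0 (Num.sqrt (t - s)) A &
      forall (n : nat) (t : nat -> R) (A : nat -> set R),
        0 <= t 0 -> (forall i, t i <= t i.+1) -> (forall i, measurable (A i)) ->
        let X i omega := B (t i.+1) omega - B (t i) omega in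
        P (\bigcap_(i in `I_n) (X i @^-1` A i)) =
        (\prod_(i < n) P (X i @^-1` A i))%E].

End brownian_motion.

(* Main.v *)
Require Import Defs.
From HB Require Import structures.
From mathcomp Require Import all_boot all_order all_algebra.
From mathcomp Require Import all_classical all_reals all_analysis.
From mathcomp Require Import measurable_realfun.
From mathcomp.real_closed Require Import complex.
From mathcomp Require Import lra ring.

(** The deterministic part rests on one condition on the coefficients: there are
    an absolutely continuous [Qt] with derivative [q], and a constant [C], with
      [t / 2 - C <= p t + q t - 2 * (Q t - Qt t) ^ 2]  for all [t >= 0].
    Writing [Q' = q + (Q - Qt)'] and integrating the rough remainder by parts in
    the quadratic form, [|2 int (Q - Qt) u u'| <= 1/2 int u'^2 + 2 int (Q - Qt)^2 u^2],
    one sees that the form of [H] dominates [1/2 int u'^2 + int (t/2 - C) u^2].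

    Everything is proved by hand from this energy inequality, without compact
    embeddings or spectral theory.  Equations [H u = z u + g] are treated as real
    first-order systems in [u] and the quasi-derivative [w = u' - Q u], in
    integral form.  Let [phi] be the solution of [H phi = z phi] with
    [phi 0 = 0] and [w 0 = 1].

    - Limit point case ([Gmax_symmetric]).  If [u] and [H u] are square
      integrable, then so is [u'] ([qsol_apriori]); hence Wronskians of elements
      of the maximal domain are integrable, and they have limits at infinity by
      Green's formula, so these limits are 0.  Thus [H0S] is the whole maximal
      operator [Gmax], and it is symmetric.
    - Coercivity ([coercive_nonL2], [coercive_orthogonal]).  The energy bounds
      [int t u^2], so a solution of [H u = z u + g] has uniformly small tails; on
      a bounded interval it is a multiple of [phi] up to an error controlled by
      [g].  If [phi] is not square integrable, the multiple must be small; if it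
      is, orthogonality to [phi] makes it small.
    - If [phi] is not square integrable, [H - z] is onto ([solvable_nonL2]: limits
      of solutions vanishing at [b -> oo]) with bounded inverse, so [z] is in the
      resolvent set.  Otherwise [z] is a simple eigenvalue, with eigenvector
      [phi], and coercivity on its orthogonal complement excludes other
      eigenvalues near [z], hence other points of the spectrum.  So the spectrum
      is discrete, and some real point is in the resolvent set, whence
      self-adjointness ([symmetric_onto_self_adjoint]).

    Without any assumption on the continuous functions [p], [Q], the operator
    [H0S] is the part of [Gmax] on which Green's formula has no boundary term
    ([H0S_symmetric_part]); hence it is symmetric and, as [Gmax] is closed,
    closed.  It is densely defined because it contains the compactly supported
    functions [exp (int_0^t Q) * y] with [y] twice continuously differentiable
    and [y 0 = 0] ([H0S_dense]).

    Finally, for [Q = 2 / sqrt beta * B] and [Qt t = int_t^(t+1) Q], the condition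
    holds as soon as the oscillation of [Q] on [[n, n + 1]] is eventually at most
    [sqrt (n + 1) / 10] ([confining_of_oscillation]), which is true almost surely:
    chaining along dyadic points with a fourth-power Gaussian tail bound, then
    Borel-Cantelli ([brownian_oscillation]). *)

Set Implicit Arguments.
Unset Strict Implicit.
Unset Printing Implicit Defensive.

Import Order.TTheory GRing.Theory Num.Theory.
Import numFieldNormedType.Exports.
Import Normc.

Local Notation Re := complex.Re.
Local Notation Im := complex.Im.

Local Open Scope classical_set_scope.
Local Open Scope complex_scope.
Local Open Scope ring_scope.

(** * Primitives on the half-line *)

Section primitives.
Context {R : realType}.
Local Notation mu := (@lebesgue_measure R).
Implicit Types (f g h a b : R -> R) (t T M : R).

(** Functions on [[0, oo)] are functions on the line whose values at negative
    arguments are ignored. *)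
Definition locint h : Prop :=
  forall T, mu.-integrable `[0, T] (EFin \o h).

Definition prim h t : R := \int[mu]_(s in `[0, t]) h s.

(** Locally bounded and measurable: the multipliers of locally integrable functions. *)
Definition lbm f : Prop := forall T,
  measurable_fun `[0, T] f /\ exists M, forall t, 0 <= t <= T -> `|f t| <= M.

(** [f] is absolutely continuous with derivative [h], stated through the integral. *)
Definition isprim f h : Prop :=
  locint h /\ forall t, 0 <= t -> f t = f 0 + prim h t.

Lemma locint_meas h T : locint h -> measurable_fun `[0, T] h.
Proof. by move=> /(_ T)/integrableP[/measurable_EFinP]. Qed.

Lemma locint_sub h (A : set R) T : locint h -> measurable A -> A `<=` `[0, T] ->
  mu.-integrable A (EFin \o h).
Proof. move=> lh mA AT; exact: (@integrableS _ _ _ mu `[0%R, T]%classic A (EFin \o h) (measurable_itv _) mA AT (lh T)). Qed.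

Lemma locint_cst (c : R) : locint (fun=> c).
Proof.
move=> T; apply: measurable_bounded_integrable => //.
  rewrite /= lebesgue_measure_itv/=; case: ifPn => // _.
  by rewrite -EFinD ltry.
exists `|c|; split => // x cx y _ /=; exact: ltW.
Qed.

Lemma lbm_cst (c : R) : lbm (fun=> c).
Proof. by move=> T; split => //; exists `|c|. Qed.

Lemma lbmD f g : lbm f -> lbm g -> lbm (fun t => f t + g t).
Proof.
move=> lf lg T; have [mf [M Mf]] := lf T; have [mg [N Ng]] := lg T.
split; first exact: measurable_funD.
by exists (M + N) => t tT; rewrite (le_trans (ler_normD _ _))// lerD ?Mf ?Ng.
Qed.

Lemma lbmM f g : lbm f -> lbm g -> lbm (fun t => f t * g t).
Proof.
move=> lf lg T; have [mf [M Mf]] := lf T; have [mg [N Ng]] := lg T.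
split; first exact: measurable_funM.
by exists (M * N) => t tT; rewrite normrM ler_pM ?Mf ?Ng.
Qed.

Lemma lbmN f : lbm f -> lbm (fun t => - f t).
Proof.
move=> lf T; have [mf [M Mf]] := lf T; split; first exact: measurableT_comp.
by exists M => t tT; rewrite normrN Mf.
Qed.

Lemma lbmB f g : lbm f -> lbm g -> lbm (fun t => f t - g t).
Proof. by move=> lf lg; apply: (lbmD lf); exact: lbmN. Qed.

Lemma lbm_norm f : lbm f -> lbm (fun t => `|f t|).
Proof.
move=> lf T; have [mf [M Mf]] := lf T; split; first exact: measurableT_comp.
by exists M => t tT; rewrite normr_id Mf.
Qed.

Lemma lbm_continuous f : continuous f -> lbm f.
Proof.
move=> cf T; split.
  by apply: measurable_funTS; exact: continuous_measurable_fun.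
have [T0|T0] := ltP T 0.
  by exists 0 => t /andP[t0 tT]; have := le_lt_trans (le_trans t0 tT) T0; rewrite ltxx.
have cn : {within `[0, T], continuous (fun t => `|f t|)}.
  apply: continuous_subspaceT => x; apply: continuous_comp; first exact: cf.
  exact: norm_continuous.
have [c _ cM] := EVT_max T0 cn.
by exists `|f c| => t tT; apply: cM; rewrite in_itv.
Qed.

Lemma locint_mul f h : lbm f -> locint h -> locint (fun t => f t * h t).
Proof.
move=> lf lh T; have [mf [M Mf]] := lf T.
apply: (@integrableMr _ _ _ mu `[0%R, T] (measurable_itv _) f (EFin \o h) mf _ (lh T)).
exists M; split; first exact: num_real.
move=> x Mx t /=; rewrite in_itv/= => tT; exact: le_trans (Mf _ tT) (ltW Mx).
Qed.

Lemma lbm_locint f : lbm f -> locint f.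
Proof.
move=> lf; rewrite (_ : f = fun t => f t * 1).
  by apply: locint_mul => //; exact: locint_cst.
by apply/funext => t; rewrite mulr1.
Qed.

Lemma locintD f g : locint f -> locint g -> locint (fun t => f t + g t).
Proof. by move=> lf lg T; have := @integrableD _ _ _ mu _ (measurable_itv _) _ _ (lf T) (lg T); exact. Qed.

Lemma locintB f g : locint f -> locint g -> locint (fun t => f t - g t).
Proof. by move=> lf lg T; have := @integrableB _ _ _ mu _ (measurable_itv _) _ _ (lf T) (lg T); exact. Qed.

Lemma locintZ (c : R) f : locint f -> locint (fun t => c * f t).
Proof. by apply: locint_mul; exact: lbm_cst. Qed.

Lemma locint_norm f : locint f -> locint (fun t => `|f t|).
Proof. by move=> lf T; apply: integrable_norm; exact: lf. Qed.

Lemma primD f g t : locint f -> locint g ->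
  prim (fun s => f s + g s) t = prim f t + prim g t.
Proof. by move=> lf lg; rewrite /prim RintegralD. Qed.

Lemma primB f g t : locint f -> locint g ->
  prim (fun s => f s - g s) t = prim f t - prim g t.
Proof. by move=> lf lg; rewrite /prim RintegralB. Qed.

Lemma primZ (c : R) f t : locint f -> prim (fun s => c * f s) t = c * prim f t.
Proof. by move=> lf; rewrite /prim RintegralZl. Qed.

Lemma eq_prim f g t : (forall s, 0 <= s <= t -> f s = g s) -> prim f t = prim g t.
Proof. by move=> fg; apply: eq_Rintegral => s; rewrite inE/= in_itv/= => /fg. Qed.

Lemma prim_cst (c t : R) : 0 <= t -> prim (fun=> c) t = c * t.
Proof.
move=> t0; rewrite /prim Rintegral_cst//= lebesgue_measure_itv/= lte_fin.
move: t0; rewrite le_eqVlt => /predU1P[<-|t0]; first by rewrite ltxx.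
by rewrite t0 -EFinD subr0.
Qed.

Lemma prim0 h : prim h 0 = 0.
Proof. by rewrite /prim set_itv1 Rintegral_set1. Qed.

Lemma prim_lt0 h t : t < 0 -> prim h t = 0.
Proof.
move=> t0; rewrite /prim set_itv_ge ?Rintegral_set0// bnd_simp -ltNge//.
Qed.

Lemma le_prim f g t : locint f -> locint g ->
  (forall s, 0 <= s <= t -> f s <= g s) -> prim f t <= prim g t.
Proof.
move=> lf lg fg; by apply: le_Rintegral.
Qed.

Lemma prim_ge0 f t : (forall s, 0 <= s <= t -> 0 <= f s) -> 0 <= prim f t.
Proof.
by move=> f0; apply: Rintegral_ge0 => s /=; rewrite in_itv/=; exact: f0.
Qed.

Lemma prim_norm f t : locint f -> `|prim f t| <= prim (fun s => `|f s|) t.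
Proof. by move=> lf; apply: le_normr_Rintegral. Qed.

Lemma prim_itv h s t : locint h -> 0 <= s -> s <= t ->
  prim h t - prim h s = \int[mu]_(x in `]s, t]) h x.
Proof.
by move=> lh s0 st; rewrite /prim Rintegral_itvB// bnd_simp.
Qed.

Lemma prim_nd h s t : locint h -> (forall x, 0 <= x <= t -> 0 <= h x) ->
  0 <= s -> s <= t -> prim h s <= prim h t.
Proof.
move=> lh h0 s0 st; rewrite -subr_ge0 prim_itv//; apply: Rintegral_ge0 => x /=.
by rewrite in_itv/= => /andP[sx xt]; apply: h0; rewrite xt (le_trans s0 (ltW sx)).
Qed.

Lemma prim_bound h T t : locint h -> 0 <= t <= T ->
  `|prim h t| <= prim (fun s => `|h s|) T.
Proof.
move=> lh /andP[t0 tT]; apply: (le_trans (prim_norm _ lh)).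
by apply: prim_nd => //; exact: locint_norm.
Qed.

Lemma prim_cont_within h T : locint h -> 0 <= T ->
  {within `[0, T], continuous (prim h)}.
Proof. by move=> lh T0; apply: parameterized_integral_continuous. Qed.

Lemma lbm_prim h : locint h -> lbm (prim h).
Proof.
move=> lh T; split; last first.
  by exists (prim (fun s => `|h s|) T) => t; exact: prim_bound.
have [T0|T0] := ltP T 0.
  rewrite set_itv_ge; first exact: measurable_fun_set0.
  by rewrite bnd_simp -ltNge.
apply: subspace_continuous_measurable_fun => //; exact: prim_cont_within.
Qed.

Lemma isprim_lbm f h : isprim f h -> lbm f.
Proof.
move=> [lh fE] T; have [mp [M pM]] := lbmD (lbm_cst (f 0)) (lbm_prim lh) T.
split.
  apply: eq_measurable_fun mp => t; rewrite inE/= in_itv/= => /andP[t0 _].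
  by rewrite -fE.
by exists M => t /[dup] tT /pM; move: tT => /andP[t0 _]; rewrite -fE.
Qed.

Lemma isprim_cst (c : R) : isprim (fun=> c) (fun=> 0).
Proof.
by split=> [|t t0]; [exact: locint_cst|rewrite prim_cst// mul0r addr0].
Qed.

Lemma isprim_id : isprim id (fun=> 1).
Proof.
by split=> [|t t0]; [exact: locint_cst|rewrite prim_cst// mul1r add0r].
Qed.

Lemma isprim_prim h : locint h -> isprim (prim h) h.
Proof. by move=> lh; split => // t t0; rewrite prim0 add0r. Qed.

Lemma isprimD f g a b : isprim f a -> isprim g b ->
  isprim (fun t => f t + g t) (fun t => a t + b t).
Proof.
move=> [la fE] [lb gE]; split=> [|t t0]; first exact: locintD.
by rewrite primD// fE// gE// addrACA.
Qed.

Lemma isprimB f g a b : isprim f a -> isprim g b ->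
  isprim (fun t => f t - g t) (fun t => a t - b t).
Proof.
move=> [la fE] [lb gE]; split=> [|t t0]; first exact: locintB.
by rewrite primB// fE// gE// opprD addrACA.
Qed.

Lemma isprimZ (c : R) f a : isprim f a ->
  isprim (fun t => c * f t) (fun t => c * a t).
Proof.
move=> [la fE]; split=> [|t t0]; first exact: locintZ.
by rewrite primZ// fE// mulrDr.
Qed.

Lemma eq_isprim f g a b : isprim f a -> (forall t, 0 <= t -> f t = g t) ->
  (forall t, 0 <= t -> a t = b t) -> isprim g b.
Proof.
move=> [la fE] fg ab; have lb : locint b.
  move=> T; apply: eq_integrable (la T) => // t; rewrite inE/= in_itv/= => /andP[t0 _].
  by rewrite /= ab.
split => // t t0; rewrite -!fg// fE//; congr (_ + _); apply: eq_prim => s /andP[s0 _].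
by rewrite ab.
Qed.

End primitives.

(** * Integration by parts *)

Section product_rule.
Context {R : realType}.
Local Notation mu := (@lebesgue_measure R).
Implicit Types (f g h a b : R -> R) (t T M : R).

(** Fubini: the square [[0, T]^2] is split along its diagonal. *)
Lemma prim_mul a b T : 0 <= T -> locint a -> locint b ->
  prim a T * prim b T =
  prim (fun t => a t * prim b t) T + prim (fun t => prim a t * b t) T.
Proof.
move=> T0 la lb.
pose A : R -> R := a \_ `[0, T]; pose B : R -> R := b \_ `[0, T].
have iA : mu.-integrable setT (EFin \o A).
  by move: (la T); rewrite integrable_mkcond//= (restrict_EFin a).
have iB : mu.-integrable setT (EFin \o B).
  by move: (lb T); rewrite integrable_mkcond//= (restrict_EFin b).
have mA : measurable_fun setT A by move/integrableP : iA => [/measurable_EFinP].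
have mB : measurable_fun setT B by move/integrableP : iB => [/measurable_EFinP].
pose k (z : measurableTypeR R * measurableTypeR R) : \bar R :=
  (A z.1 * B z.2 * ((z.1 : R) < (z.2 : R))%R%:R)%:E.
have mk : measurable_fun setT k.
  apply/measurable_EFinP; apply: measurable_funM.
    by apply: measurable_funM; [apply: (measurableT_comp mA)|apply: (measurableT_comp mB)].
  apply: (@measurableT_comp _ _ _ _ _ _ (fun b : bool => b%:R : R)) => //.
  exact: measurable_fun_ltr.
have ik : (mu \x mu)%E.-integrable setT k.
  apply/integrable12ltyP => //.
  apply: (@le_lt_trans _ _ (\int[mu]_x (`|(A x)%:E| * \int[mu]_y `|(B y)%:E|))%E).
    apply: ge0_le_integral => //.
    - by move=> x _; exact: integral_ge0.
    - apply: (measurable_fun_fubini_tonelli_F (abse \o k)) => //=.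
      exact: measurableT_comp.
    - apply: emeasurable_funM => //; apply/measurableT_comp => //; exact/measurable_EFinP.
    - move=> x _; rewrite -ge0_integralZl//.
        apply: ge0_le_integral => //.
        + apply: measurableT_comp => //; exact: (measurableT_comp mk (measurable_pair1 x)).
        + apply: emeasurable_funM => //; apply: measurableT_comp => //; exact/measurable_EFinP.
        + move=> y _; rewrite /k /= -EFinM lee_fin -normrM.
          by case: (x < y); rewrite ?mulr1// mulr0 normr0.
      apply: measurableT_comp => //; exact/measurable_EFinP.
  under eq_integral do rewrite muleC.
  rewrite ge0_integralZl//; last 2 first.
  - apply: measurableT_comp => //; exact/measurable_EFinP.
  - exact: integral_ge0.
  have /integrableP[_ iAoo] := iA; have /integrableP[_ iBoo] := iB.
  by apply: lte_mul_pinfty => //; [exact: integral_ge0|rewrite ge0_fin_numE//; exact: integral_ge0].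
have := Fubini ik.
have eF g : locint g -> (\int[mu]_x ((g \_ `[0%R, T]) x)%:E = (prim g T)%:E)%E.
  move=> lg; rewrite (_ : (fun x => _) = (EFin \o g) \_ `[0%R, T]); last first.
    by rewrite restrict_EFin.
  by rewrite -integral_mkcond /prim /Rintegral fineK//; apply: integrable_fin_num.
under eq_integral => x _.
  rewrite (_ : (\int[mu]_y k (x, y))%E =
    (((fun x => a x * (prim b T - prim b x)) \_ `[0, T]) x)%:E); last first.
    rewrite patchE; case: ifPn => xT; last first.
      rewrite integral0_eq// => y _; rewrite /k /= /A patchE (negbTE xT).
      by rewrite !mul0r.
    move: (xT); rewrite inE/= in_itv/= => /andP[x0 xT'].
    rewrite prim_itv//.
    rewrite -RintegralZl//; last by apply: integrableS (lb T) => //; apply: subset_itvr; rewrite bnd_simp.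
    rewrite /Rintegral fineK; last first.
      apply: integrable_fin_num => //.
      apply: (locint_sub (T := T) (locintZ (a x) lb)) => //.
      by apply: subset_itvr; rewrite bnd_simp.
    rewrite [RHS]integral_mkcond; apply: eq_integral => y _.
    rewrite /k /= /A /B !patchE xT.
    rewrite !mem_setE !in_itv/=.
    case: (ltP x y) => xy /=; last by rewrite mulr0.
    by rewrite (ltW (le_lt_trans x0 xy))/=; case: ifPn => _; rewrite ?mulr0 ?mul0r// mulr1.
  over.
rewrite eF; last first.
  apply: (@eq_ind _ _ locint (@locint_mul _ (fun x => prim b T - prim b x) a _ la) _ _).
    by apply: lbmB; [exact: lbm_cst|exact: lbm_prim].
  by apply/funext => x; rewrite mulrC.
under eq_integral => y _.
  rewrite (_ : (\int[mu]_x k (x, y))%E =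
    (((fun y => prim a y * b y) \_ `[0, T]) y)%:E); last first.
    rewrite patchE; case: ifPn => yT; last first.
      rewrite integral0_eq// => x _; rewrite /k /= /B patchE (negbTE yT).
      by rewrite mulr0 mul0r.
    move: (yT); rewrite inE/= in_itv/= => /andP[y0 yT'].
    rewrite mulrC /prim -RintegralZl//.
    rewrite -Rintegral_itv_bndo_bndc; last first.
      apply: (locint_sub (T := T) (locintZ (b y) la)) => //.
      by apply: subset_itvl; rewrite bnd_simp.
    rewrite /Rintegral fineK; last first.
      apply: integrable_fin_num => //.
      apply: (locint_sub (T := T) (locintZ (b y) la)) => //.
      by apply: subset_itvl; rewrite bnd_simp.
    rewrite [RHS]integral_mkcond; apply: eq_integral => x _.
    rewrite /k /= /A /B !patchE yT.
    rewrite !mem_setE !in_itv/=.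
    case: (ltP x y) => xy /=; last by rewrite mulr0 andbF.
    rewrite (le_trans (ltW xy) yT') !andbT.
    by case: ifPn => _; rewrite ?mul0r// mulr1 mulrC.
  over.
rewrite eF; last first.
  by apply: locint_mul => //; exact: lbm_prim.
move=> [] <-.
rewrite (_ : (fun x => a x * (prim b T - prim b x)) =
  (fun x => prim b T * a x - prim b x * a x)); last first.
  by apply/funext => x; ring.
rewrite primB; [|exact: locintZ|by apply: locint_mul => //; exact: lbm_prim].
rewrite primZ// addrC (@eq_prim _ (fun t => a t * prim b t) (fun t => prim b t * a t)).
  by rewrite subrK mulrC.
by move=> s _; rewrite mulrC.
Qed.

Lemma isprimM f g a b : isprim f a -> isprim g b ->
  isprim (fun t => f t * g t) (fun t => a t * g t + f t * b t).
Proof.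
move=> /[dup] /isprim_lbm lf [la fE] /[dup] /isprim_lbm lg [lb gE].
have lag : locint (fun t => a t * g t).
  by have := locint_mul lg la; congr locint; apply/funext => t; rewrite mulrC.
have lfb : locint (fun t => f t * b t) by exact: locint_mul.
split=> [|t t0]; first exact: locintD.
rewrite primD// fE// gE//.
rewrite (@eq_prim _ (fun t => a t * g t) (fun t => g 0 * a t + a t * prim b t)); last first.
  by move=> s /andP[s0 _]; rewrite gE//; ring.
rewrite (@eq_prim _ (fun t => f t * b t) (fun t => f 0 * b t + prim a t * b t)); last first.
  by move=> s /andP[s0 _]; rewrite fE//; ring.
have lpa := lbm_prim la; have lpb := lbm_prim lb.
rewrite !primD ?primZ//; [|exact: locintZ|exact: locint_mul|exact: locintZ|].
  rewrite mulrDl !mulrDr (prim_mul t0 la lb); ring.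
by have := locint_mul lpb la; congr locint; apply/funext => s; rewrite mulrC.
Qed.

End product_rule.

(** * Differentiation and Gronwall's inequality *)

Section calculus.
Context {R : realType}.
Local Notation mu := (@lebesgue_measure R).
Implicit Types (f g h a b : R -> R) (t T M : R).

Lemma isprim_derive (F f : R -> R) : continuous f -> continuous F ->
  (forall t, 0 < t -> is_derive t 1 F (f t)) -> isprim F f.
Proof.
move=> cf cF dF; split; first exact/lbm_locint/lbm_continuous.
move=> t; rewrite le_eqVlt => /predU1P[<-|t0]; first by rewrite prim0 addr0.
have dF0 : derivable_oo_LRcontinuous F 0 t.
  split.
  - by move=> x; rewrite in_itv/= => /andP[x0 _]; have [] := dF _ x0.
  - exact/cvg_at_right_filter/cF.
  - exact/cvg_at_left_filter/cF.
have F'f : {in `]0, t[, derive1 F =1 f}.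
  by move=> x; rewrite in_itv/= => /andP[x0 _]; rewrite derive1E; have [] := dF _ x0.
have FE := continuous_FTC2 t0 (continuous_subspaceT cf) dF0 F'f.
by rewrite /prim /Rintegral FE/= subrKC.
Qed.

Lemma prim_is_derive h t : locint h -> 0 < t -> {for t, continuous h} ->
  is_derive t 1 (prim h) (h t).
Proof.
move=> lh t0 ch.
have [|d e] := @continuous_FTC1_closed R h 0 t (t + 1) _ (lh _) t0 ch.
  by rewrite ltrDl.
by apply: DeriveDef; [exact: d|rewrite -derive1E; exact: e].
Qed.

Lemma isprim_expR (k : R) : isprim (fun t => expR (k * t)) (fun t => k * expR (k * t)).
Proof.
have ck : continuous (fun t : R => k * t).
  by move=> x; apply: cvgM; [exact: cvg_cst|exact: cvg_id].
have cE : continuous (fun t => expR (k * t)).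
  by move=> x; apply: (continuous_comp (ck x)); exact: continuous_expR.
apply: isprim_derive => //.
  by move=> x; apply: cvgM; [exact: cvg_cst|exact: cE].
move=> t _; have dk : is_derive t 1 (fun t : R => k * t) k.
  by have := @is_deriveZ R R R id k t 1 1 (is_derive_id t 1); rewrite [k *: 1]mulr1.
by have := is_derive1_comp (is_derive_expR (k * t)) dk; rewrite mulrC.
Qed.

(** The product [exp (- K t) * (c + K * int_0^t y)] is nonincreasing; [y] is only
    locally integrable, so this is read off from its absolutely continuous
    primitive. *)
Lemma gronwall y (c K T : R) : locint y -> 0 <= K ->
  (forall t, 0 <= t <= T -> y t <= c + K * prim y t) ->
  forall t, 0 <= t <= T -> y t <= c * expR (K * t).
Proof.
move=> ly K0 yc t tT; have /andP[t0 tT'] := tT; apply: (le_trans (yc _ tT)).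
have pY := isprimD (isprim_cst c) (isprimZ K (isprim_prim ly)).
have [lEY EY] := isprimM (isprim_expR (- K)) pY.
have := EY _ t0; rewrite prim0 !mulr0 expR0 addr0 mul1r => EYt.
have : expR (- K * t) * (c + K * prim y t) <= c.
  rewrite EYt gerDl.
  rewrite -oppr_ge0; have /(primZ (-1) t) := lEY.
  rewrite mulN1r => <-; apply: prim_ge0 => s /andP[s0 st].
  rewrite (_ : -1 * _ = K * expR (- K * s) * (c + K * prim y s - y s)); last by ring.
  apply: mulr_ge0; first by rewrite mulr_ge0 ?expR_ge0.
  by rewrite subr_ge0 yc// s0 (le_trans st).
by rewrite mulNr expRN mulrC ler_pdivrMr ?expR_gt0.
Qed.

Lemma derive0_lip f t (e : R) : is_derive t 1 f 0 -> 0 < e ->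
  exists2 d, 0 < d & forall y, `|y - t| < d -> `|f y - f t| <= e * `|y - t|.
Proof.
move=> df e0.
have [cd d0] := df.
have /cvgrPdist_lt/(_ _ e0) : (fun h : R => h^-1 *: (f (h *: 1 + t) - f t)) @ 0^' --> (0 : R).
  by rewrite -{2}d0; exact: cd.
clear d0.
move=> [d /= d0 dP]; exists d => // y yd.
have [->|yt] := eqVneq y t; first by rewrite !subrr normr0 mulr0.
have yt0 : y - t != 0 by rewrite subr_eq0.
have := dP (y - t); rewrite /= sub0r normrN => /(_ yd yt0).
rewrite [_ *: 1]mulr1 subrK sub0r normrN normrZ normfV mulrC ltr_pdivrMr ?normr_gt0//.
exact: ltW.
Qed.

(** Absolute continuity in the epsilon-delta sense, with finitely many intervals
    listed from left to right. *)
Definition rac (a b : R) f : Prop :=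
  forall e : R, 0 < e -> exists2 d : R, 0 < d &
    forall (n : nat) (s t : nat -> R),
      (forall i, (i < n)%N -> a <= s i /\ s i <= t i /\ t i <= b) ->
      (forall i j, (i < j < n)%N -> t i <= s j) ->
      \sum_(i < n) (t i - s i) < d ->
      \sum_(i < n) `|f (t i) - f (s i)| < e.

(** Cover the exceptional null set by an open set of small measure and move from
    [a] to the right: near a good point the increment of [f] is at most
    [e1] times the length, and near a bad point the interval lies in the open set,
    where absolute continuity bounds the sum of the increments.  The points that
    can be reached form a set whose supremum is [b] (a connectedness argument in
    place of a covering theorem). *)
Lemma rac_derive0 f (a b : R) : a < b -> rac a b f ->
  {ae mu, forall t, a <= t <= b -> is_derive t 1 f 0} -> f b = f a.
Proof.
move=> ab acf [N [mN N0 subN]].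
apply/eqP; rewrite -subr_eq0 -normr_le0; apply/ler_addgt0Pr => e e0; rewrite add0r.
pose e1 := e / (b - a + 1).
have ba0 : 0 < b - a + 1 by rewrite ltr_wpDl// subr_ge0 ltW.
have e10 : 0 < e1 by rewrite divr_gt0.
have [d d0 dP] := acf _ e10.
have [U [oO NU mO]] : exists U, [/\ open U, N `<=` U & (mu U < d%:E)%E].
  have muN : (mu N < +oo)%E by rewrite N0.
  have [U [oO NU mO]] := lebesgue_regularity_outer mN muN d0.
  exists U; split => //; apply: le_lt_trans mO.
  have mOm : measurable U by exact: open_measurable.
  rewrite -[X in (mu X <= _)%E](@setDUK _ N)// measureU//; last 2 first.
  - exact: measurableD.
  - by rewrite setDIK.
  by rewrite [X in (X + _)%E](_ : _ = 0%E) ?add0e//; exact: N0.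
have mOm : measurable U by exact: open_measurable.
have mOI x y : measurable (U `&` `]x, y]) by exact: measurableI.
have le_mu (A B : set R) : measurable A -> measurable B -> A `<=` B -> (mu A <= mu B)%E.
  by move=> mA mB AB; apply: le_measure; rewrite ?inE.
(* [P x]: from [a] to [x] the increment of [f] is bounded, up to [e1 * (x - a)],
   by its increments over disjoint intervals covered by [U]. *)
pose P x := exists n (s t : nat -> R),
  [/\ forall i, (i < n)%N -> a <= s i /\ s i <= t i /\ t i <= x,
      forall i j, (i < j < n)%N -> t i <= s j,
      ((\sum_(i < n) (t i - s i))%:E <= mu (U `&` `]a, x]))%E &
      `|f x - f a| <= e1 * (x - a) + \sum_(i < n) `|f (t i) - f (s i)|].
have Pgood x y : a <= x -> x <= y -> P x -> `|f y - f x| <= e1 * (y - x) -> P y.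
  move=> ax xy [n [s [t [st tt mst fx]]]] fxy; exists n, s, t; split => //.
  - by move=> i /st[? [? ?]]; split => //; split => //; exact: le_trans xy.
  - apply: (le_trans mst); apply: le_mu => //; apply: setIS; apply: subset_itvl; rewrite bnd_simp//.
  - have -> : f y - f a = (f y - f x) + (f x - f a) by ring.
    by rewrite (le_trans (ler_normD _ _))//; lra.
have Pbad x y : a <= x -> x <= y -> P x -> `]x, y] `<=` U -> P y.
  move=> ax xy [n [s [t [st tt mst fx]]]] xyU.
  exists n.+1, (fun i => if i == n then x else s i), (fun i => if i == n then y else t i).
  have E (F : R -> R -> R) : \sum_(i < n.+1) F (if i == n :> nat then y else t i)
     (if i == n :> nat then x else s i) = \sum_(i < n) F (t i) (s i) + F y x.
    rewrite big_ord_recr/= eqxx; congr (_ + _); apply: eq_bigr => i _.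
    by rewrite ltn_eqF//.
  split.
  - move=> i; rewrite ltnS leq_eqVlt; case: eqP => [_ _|_ /= /st[? [? ?]]] //.
    by split => //; split => //; exact: le_trans xy.
  - move=> i j /andP[ij]; rewrite ltnS leq_eqVlt; case: eqP => [jn _|_ /= jn].
      rewrite -jn (ltn_eqF ij); have /st[_ [_ ->]]// : (i < n)%N by rewrite -jn.
    by rewrite (ltn_eqF (ltn_trans ij jn)) tt// ij.
  - rewrite (E (fun u v => u - v))/=.
    have -> : U `&` `]a, y] = (U `&` `]a, x]) `|` `]x, y].
      rewrite -[in RHS](setIidr xyU) -setIUr; congr (_ `&` _).
      by rewrite -itv_bndbnd_setU// bnd_simp.
    rewrite measureU; [|exact: mOI|exact: measurable_itv|].
    2: {
      rewrite -setIA (_ : `]a, x] `&` `]x, y] = set0) ?setI0//.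
      apply/seteqP; split => // z [/=]; rewrite !in_itv/= => /andP[_ zx] /andP[xz _].
      by have := lt_le_trans xz zx; rewrite ltxx. }
    rewrite EFinD leeD//= lebesgue_measure_itv/= lte_fin.
    move: xy; rewrite le_eqVlt => /predU1P[->|->]; last by rewrite EFinB.
    by rewrite subrr ltxx.
  - rewrite (E (fun u v => `|f u - f v|))/=.
    have -> : f y - f a = (f y - f x) + (f x - f a) by ring.
    rewrite (le_trans (ler_normD _ _))//.
    have : e1 * (x - a) <= e1 * (y - a) by rewrite ler_pM2l// lerB.
    by lra.
have Pa : P a.
  exists 0%N, (fun=> 0), (fun=> 0); split => //.
  - by rewrite big_ord0.
  - by rewrite big_ord0 !subrr normr0 mulr0 addr0.
pose S := [set x | a <= x <= b /\ P x].
have Sa : S a by rewrite /S /= lexx (ltW ab).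
have hS : has_sup S by split; [exists a|exists b => x [/andP[]]].
pose c := sup S.
have ac : a <= c by exact: (ub_le_sup hS.2).
have cb : c <= b by apply: ge_sup; [exists a|move=> x [/andP[]]].
have [eta eta0 etaP] : exists2 eta, 0 < eta & forall x y, c - eta < x -> x <= c ->
    c <= y -> y < c + eta -> a <= x -> P x -> P y.
  have [Nc|Nc] := pselect (N c).
    have [r /= r0 rO] := oO _ (NU _ Nc); exists r => // x y cx xc cy yc ax Px.
    apply: Pbad Px _ => //; first exact: le_trans cy.
    move=> z /=; rewrite in_itv/= => /andP[xz zy]; apply: rO => /=.
    by rewrite ltr_norml; apply/andP; split; lra.
  have dc : is_derive c 1 f 0.
    by apply: contrapT => h; apply: Nc; apply: subN => /= /(_ _); rewrite ac cb => /(_ isT).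
  have [r r0 rP] := derive0_lip dc e10; exists r => // x y cx xc cy yc ax Px.
  apply: (Pgood c) => //.
    apply: (Pgood x) => //.
    have /rP : `|x - c| < r by rewrite ltr_norml; apply/andP; split; lra.
    by rewrite distrC (distrC x) (ger0_norm (x := c - x)) ?subr_ge0.
  have /rP : `|y - c| < r by rewrite ltr_norml; apply/andP; split; lra.
  by rewrite (ger0_norm (x := y - c)) ?subr_ge0.
have [x [/andP[ax xb] Px] cx] : exists2 x, S x & c - eta < x.
  exact: sup_adherent.
have xc : x <= c by apply: (ub_le_sup hS.2); split => //; rewrite ax.
have Pb : P b.
  have [bc|cltb] := leP b c.
    by apply: (etaP x) => //; rewrite (le_lt_trans bc)// ltrDl.
  pose y := Num.min b (c + eta / 2).
  have cy : c < y by rewrite lt_min cltb ltrDl divr_gt0.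
  have Sy : S y.
    split; first by rewrite (le_trans ac (ltW cy)) ge_min lexx.
    apply: (etaP x) => //; first exact: ltW.
    by rewrite gt_min; apply/orP; right; rewrite ltrD2l ltr_pdivrMr// ltr_pMr// ltr1n.
  have : y <= c by exact: (ub_le_sup hS.2).
  by rewrite leNgt cy.
have [n [s [t [st tt mst fb]]]] := Pb.
have : \sum_(i < n) `|f (t i) - f (s i)| < e1.
  apply: dP => //; rewrite -lte_fin (le_lt_trans mst)//; apply: le_lt_trans mO.
  by apply: le_mu => //; exact: subIsetl.
have eE : e = e1 * (b - a) + e1.
  by rewrite -[X in _ + X]mulr1 -mulrDr /e1 divfK// gt_eqF.
move: fb eE; set A := e1 * (b - a); lra.
Qed.

End calculus.

(** * Linear systems of integral equations *)

Section picard.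
Context {R : realType}.
Local Notation mu := (@lebesgue_measure R).
Implicit Types (f g h a b : R -> R) (t T M : R).

(** Cauchy's criterion with the rate [e] carried over to the limit. *)
Lemma bounded_limit (u e : nat -> R) :
  (forall n m, (n <= m)%N -> `|u n - u m| <= e n) ->
  exists l, forall n, `|u n - l| <= e n.
Proof.
move=> ue; have e0 n : 0 <= e n by rewrite (le_trans _ (ue n n _)).
have vw n m : u m - e m <= u n + e n.
  have [nm|/ltnW mn] := leqP n m.
    by have := ue _ _ nm; rewrite ler_norml; have := e0 m; lra.
  by have := ue _ _ mn; rewrite ler_norml; have := e0 n; lra.
have hS : has_sup (range (fun m => u m - e m)).
  by split; [exists (u 0 - e 0); exists 0|exists (u 0 + e 0) => _ [m _ <-]].
exists (sup (range (fun m => u m - e m))) => n.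
have h1 : u n - e n <= sup (range (fun m => u m - e m)).
  by apply: ub_le_sup; [case: hS|exists n].
have h2 : sup (range (fun m => u m - e m)) <= u n + e n.
  by apply: ge_sup; [case: hS|move=> _ [m _ <-]].
by rewrite ler_norml; lra.
Qed.

Lemma cvg_half (c : R) : (fun n => c * 2^-1 ^+ n) @ \oo --> (0 : R).
Proof. by apply: cvg_geometric; rewrite ger0_norm ?invf_lt1 ?ltr1n// invr_ge0. Qed.

Lemma le_half (a b c : R) : (forall n, a <= b + c * 2^-1 ^+ n) -> a <= b.
Proof.
move=> abc; apply/ler_addgt0Pr => e e0.
have /cvgrPdist_lt/(_ _ e0)[N _ /(_ N (leqnn _))/=] := cvg_half c.
rewrite sub0r normrN => h; apply: (le_trans (abc N)); rewrite lerD2l.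
exact: le_trans (ler_norm _) (ltW h).
Qed.

Lemma geometric_limit (u : nat -> R) (c : R) :
  (forall n, `|u n.+1 - u n| <= c * 2^-1 ^+ n) ->
  exists l, forall n, `|u n - l| <= 2 * c * 2^-1 ^+ n.
Proof.
move=> uc; apply: bounded_limit => n m nm.
rewrite -(subnKC nm); elim: (m - n)%N => [|k IH].
  rewrite addn0 subrr normr0 -mulrA mulr_ge0// (le_trans _ (uc n))//.
suff H : `|u n - u (n + k)%N| <= 2 * c * (2^-1 ^+ n - 2^-1 ^+ (n + k)).
  have c0 : 0 <= c by rewrite (le_trans _ (le_trans (uc 0%N) _))// expr0 mulr1.
  apply: (le_trans (ler_distD (u (n + k)%N) _ _)).
  rewrite addnS; have h := uc (n + k)%N.
  have p0 : 0 <= c * 2^-1 ^+ (n + k) by rewrite mulr_ge0// exprn_ge0// invr_ge0.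
  have -> : 2 * c * 2^-1 ^+ n = 2 * c * (2^-1 ^+ n - 2^-1 ^+ (n + k)) + 2 * (c * 2^-1 ^+ (n + k)) by ring.
  rewrite (distrC (u (n + k)%N)).
  by apply: (lerD H); apply: (le_trans h); rewrite ler_peMl// ler1n.
elim: k {IH} => [|k IH]; first by rewrite addn0 !subrr normr0 mulr0.
apply: (le_trans (ler_distD (u (n + k)%N) _ _)).
have h := uc (n + k)%N; rewrite distrC in h; rewrite addnS exprS.
apply: (le_trans (lerD IH h)).
by rewrite le_eqVlt; apply/orP; left; apply/eqP; field.
Qed.

Lemma lbm_sum (I : finType) (F : I -> R -> R) : (forall i, lbm (F i)) ->
  lbm (fun t => \sum_i F i t).
Proof.
move=> lF; elim: (index_enum I) => [|i s IH].
  by under eq_fun do rewrite big_nil; exact: lbm_cst.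
by under eq_fun do rewrite big_cons; apply: lbmD.
Qed.

Section linear_system.
Context {J : finType} (A : J -> J -> R -> R) (f : J -> R -> R).
Hypotheses (lA : forall i j, lbm (A i j)) (lf : forall i, lbm (f i)).

Let step (Y : J -> R -> R) i t := f i t + prim (fun s => \sum_j A i j s * Y j s) t.
Let Yk k := iter k step f.

Let lbm_Yk k i : lbm (Yk k i).
Proof.
elim: k i => [|k IH] i; first exact: lf.
apply: lbmD => //; apply: lbm_prim; apply: lbm_locint; apply: lbm_sum => j.
exact: lbmM.
Qed.

Let lsum Y i : (forall j, lbm (Y j)) -> locint (fun s => \sum_j A i j s * Y j s).
Proof. by move=> lY; apply/lbm_locint/lbm_sum => j; exact: lbmM. Qed.

Let bounds T : exists2 K, 0 < K &
  forall i t, 0 <= t <= T -> \sum_j `|A i j t| <= K.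
Proof.
have /(_ T)[_ [M HM]] : lbm (fun t => \sum_i \sum_j `|A i j t|).
  by apply: lbm_sum => i; apply: lbm_sum => j; exact: lbm_norm.
exists (`|M| + 1); first by rewrite ltr_wpDl.
move=> i t /HM h; apply: (@le_trans _ _ M); last by rewrite (le_trans (ler_norm _))// lerDl.
apply: le_trans (le_trans (ler_norm _) h).
rewrite [leRHS](bigD1 i)//= lerDl; apply: sumr_ge0 => ? _; exact: sumr_ge0.
Qed.

Let geom T : exists c, forall i t, 0 <= t <= T ->
  forall k, `|Yk k.+1 i t - Yk k i t| <= c * 2^-1 ^+ k.
Proof.
have [K K0 KA] := bounds T.
have /(_ T)[_ [m Hm]] : lbm (fun t => \sum_i `|Yk 1 i t - Yk 0 i t|).
  by apply: lbm_sum => i; apply: lbm_norm; exact: lbmB.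
have main k i t : 0 <= t <= T ->
    `|Yk k.+1 i t - Yk k i t| <= (`|m| * 2^-1 ^+ k) * expR ((2 * K) * t).
  elim: k i t => [|k IH] i t tT.
    rewrite expr0 mulr1; apply: (@le_trans _ _ `|m|).
      apply: le_trans (le_trans (le_trans (ler_norm _) (Hm _ tT)) (ler_norm _)).
      by rewrite (bigD1 i)//= lerDl; apply: sumr_ge0.
    rewrite ler_peMr// -expR0 ler_expR mulr_ge0//; first by rewrite mulr_ge0// ltW.
    by case/andP : tT.
  have -> : Yk k.+2 i t - Yk k.+1 i t =
      prim (fun s => \sum_j A i j s * (Yk k.+1 j s - Yk k j s)) t.
    rewrite [Yk k.+2 _ _]/= [Yk k.+1 _ _]/= -/(Yk k.+1) -/(Yk k) /step.
    rewrite opprD addrACA subrr add0r -primB; [|exact: (lsum _ (lbm_Yk k.+1))|exact: (lsum _ (lbm_Yk k))].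
    by apply: eq_prim => s _; rewrite -sumrB; apply: eq_bigr => j _; rewrite mulrBr.
  set c := `|m| * 2^-1 ^+ k.
  have c0 : 0 <= c by rewrite mulr_ge0// exprn_ge0// invr_ge0.
  apply: (le_trans (prim_norm _ _)).
    by apply: lsum => j; exact: lbmB.
  have [lE EE] := isprim_expR (2 * K).
  apply: (@le_trans _ _ (prim (fun s => (c / 2) * (2 * K * expR (2 * K * s))) t)).
    apply: le_prim.
    - by apply/locint_norm/lsum => j; exact: lbmB.
    - exact: locintZ.
    - move=> s /andP[s0 st]; have sT : 0 <= s <= T.
        by rewrite s0/= (le_trans st)//; case/andP : tT.
      rewrite (_ : c / 2 * _ = K * (c * expR (2 * K * s))); last by field.
      apply: (le_trans (ler_norm_sum _ _ _)).
      apply: (@le_trans _ _ (\sum_j `|A i j s| * (c * expR (2 * K * s)))).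
        by apply: ler_sum => j _; rewrite normrM ler_wpM2l// IH.
      by rewrite -mulr_suml ler_wpM2r ?KA// mulr_ge0// expR_ge0.
  rewrite primZ//; have := EE t; rewrite mulr0 expR0 => E.
  have -> : prim (fun s => 2 * K * expR (2 * K * s)) t = expR (2 * K * t) - 1.
    by rewrite E; [ring|case/andP : tT].
  rewrite exprS mulrCA -/c mulrBr mulr1.
  have -> : c / 2 = 2^-1 * c by rewrite mulrC.
  by rewrite lerBlDr lerDl mulr_ge0// invr_ge0.
exists (`|m| * expR (2 * K * T)) => i t tT k; apply: (le_trans (main _ _ _ tT)).
rewrite mulrAC; apply: ler_wpM2r; first by rewrite exprn_ge0// invr_ge0.
apply: ler_wpM2l => //; rewrite ler_expR.
by apply: ler_wpM2l; [rewrite mulr_ge0// ltW|case/andP : tT].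
Qed.

(** Successive approximations; the weight [exp (2 K t)] makes one step a
    contraction by the factor 1/2 on every bounded interval, so the solution is
    global. *)
Lemma linear_system_exists : exists Y : J -> R -> R,
  (forall i, lbm (Y i)) /\
  forall i t, 0 <= t -> Y i t = f i t + prim (fun s => \sum_j A i j s * Y j s) t.
Proof.
have H (z : J * R) : exists l, 0 <= z.2 -> exists c, forall k, `|Yk k z.1 z.2 - l| <= c * 2^-1 ^+ k.
  have [t0|t0] := leP 0 z.2; last by exists 0.
  have [c /(_ z.1 z.2)] := geom z.2; rewrite t0 lexx => /(_ isT)/geometric_limit[l lP].
  by exists l => _; exists (2 * c).
have [Y0 YP0] := choice H; pose Y i t := Y0 (i, t).
have YP T : exists c, forall i t, 0 <= t <= T -> forall k, `|Yk k i t - Y i t| <= c * 2^-1 ^+ k.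
  have [c cP] := geom T; exists (2 * c) => i t tT k.
  have [l lP] := geometric_limit (cP i t tT).
  suff -> : Y i t = l by [].
  have /(_ _)[|c' c'P] := YP0 (i, t); first by case/andP : tT.
  apply/eqP; rewrite -subr_eq0 -normr_le0.
  apply: (@le_half _ _ (2 * c + c')) => n; rewrite add0r.
  apply: (le_trans (ler_distD (Yk n i t) _ _)); rewrite mulrDl addrC.
  by apply: lerD => //; rewrite distrC; exact: c'P.
have lY i : lbm (Y i).
  move=> T; have [c cP] := YP T; split.
    apply: (@measurable_fun_cvg _ _ _ _ (fun k => Yk k i)).
      by move=> k; have [] := lbm_Yk k i T.
    move=> t /=; rewrite in_itv/= => tT.
    apply/cvgrPdist_le => e e0; have /cvgrPdist_le/(_ _ e0) := cvg_half c.
    apply: filterS => n; rewrite sub0r normrN => h.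
    by rewrite distrC (le_trans (cP _ _ tT n))// (le_trans (ler_norm _)).
  have [_ [M HM]] := lbm_Yk 0 i T.
  exists (M + c) => t tT; have := cP i t tT 0%N; rewrite expr0 mulr1 => h.
  have -> : Y i t = Yk 0 i t - (Yk 0 i t - Y i t) by ring.
  by rewrite (le_trans (ler_normB _ _))// lerD// HM.
exists Y; split => // i t t0.
apply/eqP; rewrite -subr_eq0 -normr_le0.
have [c cP] := YP t; have [K K0 KA] := bounds t.
have tt : 0 <= t <= t by rewrite t0 lexx.
apply: (@le_half _ _ (c + K * c * t)) => n; rewrite add0r.
set S := f i t + _.
have -> : Y i t - S = (Y i t - Yk n.+1 i t) + (Yk n.+1 i t - S) by ring.
apply: (le_trans (ler_normD _ _)); rewrite mulrDl; apply: lerD.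
  rewrite distrC; apply: (le_trans (cP _ _ tt _)); rewrite exprS.
  have c0 : 0 <= c * 2^-1 ^+ n by exact: (le_trans _ (cP i t tt n)).
  have -> : c * (2^-1 * 2^-1 ^+ n) = (c * 2^-1 ^+ n) / 2 by field.
  by rewrite ler_pdivrMr// ler_peMr// ler1n.
have -> : Yk n.+1 i t - S = prim (fun s => \sum_j A i j s * (Yk n j s - Y j s)) t.
  rewrite [Yk n.+1 _ _]/= -/(Yk n) /step /S.
  rewrite opprD addrACA subrr add0r -primB; [|exact: (lsum _ (lbm_Yk n))|exact: (lsum _ lY)].
  by apply: eq_prim => s _; rewrite -sumrB; apply: eq_bigr => j _; rewrite mulrBr.
apply: (le_trans (prim_norm _ _)).
  by apply: lsum => j; exact: lbmB.
apply: (@le_trans _ _ (prim (fun=> K * (c * 2^-1 ^+ n)) t)).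
  apply: le_prim; [|exact: locint_cst|].
    by apply/locint_norm/lsum => j; exact: lbmB.
  move=> s st; apply: (le_trans (ler_norm_sum _ _ _)).
  apply: (@le_trans _ _ (\sum_j `|A i j s| * (c * 2^-1 ^+ n))).
    by apply: ler_sum => j _; rewrite normrM ler_wpM2l// cP.
  rewrite -mulr_suml; apply: ler_wpM2r; last exact: KA.
  exact: (le_trans _ (cP i s st n)).
by rewrite prim_cst//; rewrite le_eqVlt; apply/orP; left; apply/eqP; ring.
Qed.

End linear_system.
End picard.

(** * Solutions in terms of the quasi-derivative *)

Section quasi_derivative.
Context {R : realType}.
Local Notation mu := (@lebesgue_measure R).
Implicit Types (u w v f g h : R -> R) (t T : R).
Variables p Q : R -> R.
Hypotheses (lp : lbm p) (lQ : lbm Q).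

(** [H u = v] with quasi-derivative [w = u' - Q u]. *)
Definition qsol u w v : Prop :=
  isprim u (fun t => w t + Q t * u t) /\
  isprim w (fun t => (p t - Q t * Q t) * u t - Q t * w t - v t).

Lemma qsol_lbm u w v : qsol u w v -> lbm u /\ lbm w.
Proof. by move=> [/isprim_lbm ? /isprim_lbm ?]. Qed.

Lemma qsol_locint u w v : qsol u w v -> locint v.
Proof.
move=> qs; have [lu lw] := qsol_lbm qs; have [_ [ld _]] := qs.
have l1 : locint (fun t => (p t - Q t * Q t) * u t - Q t * w t).
  by apply: lbm_locint; apply: lbmB; apply: lbmM => //; apply: lbmB => //; apply: lbmM.
by have := locintB l1 ld; congr locint; apply/funext => t; ring.
Qed.

Lemma eq_qsol u w v u' w' v' : qsol u w v ->
  (forall t, 0 <= t -> u t = u' t) -> (forall t, 0 <= t -> w t = w' t) ->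
  (forall t, 0 <= t -> v t = v' t) -> qsol u' w' v'.
Proof.
move=> [pu pw] eu ew ev; split.
  by apply: (eq_isprim pu) => // t t0; rewrite eu// ew.
by apply: (eq_isprim pw) => // t t0; rewrite eu// ew// ev.
Qed.

Lemma qsolD u w v u' w' v' : qsol u w v -> qsol u' w' v' ->
  qsol (fun t => u t + u' t) (fun t => w t + w' t) (fun t => v t + v' t).
Proof.
move=> [pu pw] [pu' pw']; split.
  by apply: (eq_isprim (isprimD pu pu')) => // t _; ring.
by apply: (eq_isprim (isprimD pw pw')) => // t _; ring.
Qed.

Lemma qsolZ c u w v : qsol u w v ->
  qsol (fun t => c * u t) (fun t => c * w t) (fun t => c * v t).
Proof.
move=> [pu pw]; split.
  by apply: (eq_isprim (isprimZ c pu)) => // t _; ring.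
by apply: (eq_isprim (isprimZ c pw)) => // t _; ring.
Qed.

Lemma qsolB u w v u' w' v' : qsol u w v -> qsol u' w' v' ->
  qsol (fun t => u t - u' t) (fun t => w t - w' t) (fun t => v t - v' t).
Proof.
move=> qu /(qsolZ (-1)) qu'; apply: (eq_qsol (qsolD qu qu')) => t _; ring.
Qed.

(** Lagrange's identity; the terms with [p] and [Q] cancel. *)
Lemma qsol_lagrange u1 w1 v1 u2 w2 v2 : qsol u1 w1 v1 -> qsol u2 w2 v2 ->
  isprim (fun t => u1 t * w2 t - w1 t * u2 t) (fun t => v1 t * u2 t - u1 t * v2 t).
Proof.
move=> [pu1 pw1] [pu2 pw2].
by apply: (eq_isprim (isprimB (isprimM pu1 pw2) (isprimM pw1 pu2))) => // t _; ring.
Qed.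

(** Complex solutions of [H u = z u + g] with [z = x + i y], split into their
    real and imaginary parts. *)
Definition zsol x y u1 w1 u2 w2 g1 g2 : Prop :=
  qsol u1 w1 (fun t => x * u1 t - y * u2 t + g1 t) /\
  qsol u2 w2 (fun t => x * u2 t + y * u1 t + g2 t).

Lemma zsol_axpy a1 a2 x y u1 w1 u2 w2 g1 g2 v1 z1 v2 z2 h1 h2 :
  zsol x y u1 w1 u2 w2 g1 g2 -> zsol x y v1 z1 v2 z2 h1 h2 ->
  zsol x y (fun t => u1 t - (a1 * v1 t - a2 * v2 t))
           (fun t => w1 t - (a1 * z1 t - a2 * z2 t))
           (fun t => u2 t - (a1 * v2 t + a2 * v1 t))
           (fun t => w2 t - (a1 * z2 t + a2 * z1 t))
           (fun t => g1 t - (a1 * h1 t - a2 * h2 t))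
           (fun t => g2 t - (a1 * h2 t + a2 * h1 t)).
Proof.
move=> [qu1 qu2] [qv1 qv2]; split.
  by apply: (eq_qsol (qsolB qu1 (qsolB (qsolZ a1 qv1) (qsolZ a2 qv2)))) => // t _; ring.
by apply: (eq_qsol (qsolB qu2 (qsolD (qsolZ a1 qv2) (qsolZ a2 qv1)))) => // t _; ring.
Qed.

Lemma zsol_exists x y g1 g2 a1 a2 : locint g1 -> locint g2 ->
  exists u1 w1 u2 w2, [/\ zsol x y u1 w1 u2 w2 g1 g2,
    u1 0 = 0, u2 0 = 0, w1 0 = a1 & w2 0 = a2].
Proof.
move=> lg1 lg2.
pose V t := p t - Q t * Q t - x.
have lV : lbm V by apply: lbmB; [apply: lbmB => //; exact: lbmM|exact: lbm_cst].
(* The first boolean selects the real or imaginary part, the second [u] or [w]. *)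
pose A (i j : bool * bool) t : R :=
  match i, j with
  | (false, false), (false, false) | (true, false), (true, false) => Q t
  | (false, false), (false, true) | (true, false), (true, true) => 1
  | (false, true), (false, false) | (true, true), (true, false) => V t
  | (false, true), (false, true) | (true, true), (true, true) => - Q t
  | (false, true), (true, false) => y
  | (true, true), (false, false) => - y
  | _, _ => 0
  end.
pose f (i : bool * bool) t : R :=
  match i with
  | (false, true) => a1 - prim g1 t
  | (true, true) => a2 - prim g2 t
  | _ => 0
  end.
have lA i j : lbm (A i j).
  by case: i j => [[] []] [[] []] /=; rewrite /A; try exact: lbm_cst; try exact: lQ;
    try exact: lV; exact: lbmN.
have lf i : lbm (f i).
  case: i => [[] []]; rewrite /f; try exact: lbm_cst.
    by apply: lbmB; [exact: lbm_cst|exact: lbm_prim].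
  by apply: lbmB; [exact: lbm_cst|exact: lbm_prim].
have [Y [lY YE]] := linear_system_exists lA lf.
have sumE (F : bool * bool -> R) :
    \sum_j F j = F (false, false) + F (false, true) + F (true, false) + F (true, true).
  transitivity (\sum_(b : bool) \sum_(c : bool) F (b, c)).
    by rewrite pair_bigA; apply: eq_bigr => -[].
  by rewrite !big_bool/=; ring.
have Y0 i : Y i 0 = f i 0 by rewrite YE// prim0 addr0.
have lAY i : locint (fun s => \sum_j A i j s * Y j s).
  by apply/lbm_locint/lbm_sum => j; exact: lbmM.
have iY i : isprim (fun t => Y i t - f i t) (fun s => \sum_j A i j s * Y j s).
  apply: (eq_isprim (isprim_prim (lAY i))) => // t t0.
  by rewrite YE//; ring.
have ig1 := isprimB (isprim_cst a1) (isprim_prim lg1).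
have ig2 := isprimB (isprim_cst a2) (isprim_prim lg2).
exists (Y (false, false)), (Y (false, true)), (Y (true, false)), (Y (true, true)); split.
- split; split.
  + by apply: (eq_isprim (iY (false, false))) => t t0; rewrite ?sumE /A /f; ring.
  + apply: (eq_isprim (isprimD (iY (false, true)) ig1)) => t t0.
      by rewrite /f; ring.
    by rewrite sumE /A /V; ring.
  + by apply: (eq_isprim (iY (true, false))) => t t0; rewrite ?sumE /A /f; ring.
  + apply: (eq_isprim (isprimD (iY (true, true)) ig2)) => t t0.
      by rewrite /f; ring.
    by rewrite sumE /A /V; ring.
- by rewrite Y0.
- by rewrite Y0.
- by rewrite Y0 /f prim0 subr0.
- by rewrite Y0 /f prim0 subr0.
Qed.

(** Cauchy-Schwarz against the constant 1, from the square of [|g| - a / T] where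
    [a / T] is the mean of [|g|]. *)
Lemma sqr_prim_norm g T : 0 <= T -> locint g -> locint (fun t => g t * g t) ->
  prim (fun t => `|g t|) T ^+ 2 <= T * prim (fun t => g t * g t) T.
Proof.
rewrite le_eqVlt => /predU1P[<-|T0] lg lgg; first by rewrite !prim0 mul0r expr0n.
set a := prim (fun t => `|g t|) T; have lng := locint_norm lg.
have : 0 <= prim (fun t => g t * g t - (2 * (a / T) * `|g t| - (a / T) ^+ 2)) T.
  apply: prim_ge0 => s _.
  have -> : g s * g s = `|g s| ^+ 2 by rewrite real_normK ?num_real// expr2.
  by have := sqr_ge0 (`|g s| - a / T); congr (0 <= _); ring.
rewrite primB//; last by apply: locintB; [exact: locintZ|exact: locint_cst].
rewrite primB; [|exact: locintZ|exact: locint_cst].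
rewrite primZ// -/a prim_cst; last exact: ltW.
move=> h; have : 0 <= T * (prim (fun t => g t * g t) T - (2 * (a / T) * a - (a / T) ^+ 2 * T)).
  by rewrite mulr_ge0// ltW.
have -> : T * (prim (fun t => g t * g t) T - (2 * (a / T) * a - (a / T) ^+ 2 * T)) =
  T * prim (fun t => g t * g t) T - a ^+ 2 by field; rewrite gt_eqF.
by rewrite subr_ge0.
Qed.

(** Gronwall's inequality for the sum of the moduli of [u] and [w]. *)
Lemma zsol_estimate x y T : 0 <= T -> exists2 C, 0 <= C &
  forall u1 w1 u2 w2 g1 g2, zsol x y u1 w1 u2 w2 g1 g2 ->
  u1 0 = 0 -> u2 0 = 0 -> w1 0 = 0 -> w2 0 = 0 ->
  locint (fun t => g1 t * g1 t) -> locint (fun t => g2 t * g2 t) ->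
  forall t, 0 <= t <= T -> u1 t * u1 t + u2 t * u2 t <=
    C * (prim (fun t => g1 t * g1 t) T + prim (fun t => g2 t * g2 t) T).
Proof.
move=> T0.
have [_ [M HM]] := (lbmD (lbm_norm lp) (lbmM lQ lQ)) T.
have [_ [N HN]] := lQ T.
pose K := 1 + `|N| + `|M| + `|x| + `|y|.
have K0 : 0 <= K by rewrite /K !addr_ge0.
exists (2 * T * expR (K * T) ^+ 2); first by rewrite !mulr_ge0// exprn_ge0// expR_ge0.
move=> u1 w1 u2 w2 g1 g2 zs u10 u20 w10 w20 lgg1 lgg2 t tT.
have [qs1 qs2] := zs.
have [lu1 lw1] := qsol_lbm qs1; have [lu2 lw2] := qsol_lbm qs2.
have lg1 : locint g1.
  have l1 : locint (fun t => x * u1 t - y * u2 t).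
    by apply/lbm_locint/lbmB; apply: lbmM => //; exact: lbm_cst.
  by have := locintB (qsol_locint qs1) l1; congr locint; apply/funext => s; ring.
have lg2 : locint g2.
  have l1 : locint (fun t => x * u2 t + y * u1 t).
    by apply/lbm_locint/lbmD; apply: lbmM => //; exact: lbm_cst.
  by have := locintB (qsol_locint qs2) l1; congr locint; apply/funext => s; ring.
pose Y t := `|u1 t| + `|w1 t| + (`|u2 t| + `|w2 t|).
have lY : lbm Y by do !apply: lbmD; exact: lbm_norm.
pose G t := `|g1 t| + `|g2 t|.
have lG : locint G by apply: locintD; exact: locint_norm.
have [[[ld1 E1] [ld2 E2]] [[ld3 E3] [ld4 E4]]] := zs.
have bound s : 0 <= s <= T -> Y s <= prim G T + K * prim Y s.
  move=> /andP[s0 sT].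
  apply: (@le_trans _ _ (prim (fun r => G r + K * Y r) s)); last first.
    rewrite primD//; last exact/locintZ/lbm_locint.
    rewrite primZ; last exact: lbm_locint.
    by rewrite lerD2r; apply: prim_nd => // r _; rewrite addr_ge0.
  rewrite /Y E1// E2// E3// E4// u10 u20 w10 w20 !add0r.
  apply: (le_trans (lerD (lerD (prim_norm _ ld1) (prim_norm _ ld2)) (lerD (prim_norm _ ld3) (prim_norm _ ld4)))).
  rewrite -!primD; [|by repeat first [apply: locintD|exact: locint_norm]..].
  apply: le_prim; [by repeat first [apply: locintD|exact: locint_norm]
                  |by apply: locintD => //; exact/locintZ/lbm_locint|].
  move=> r /andP[r0 rs]; have rT : 0 <= r <= T by rewrite r0 (le_trans rs).
  have hN : `|Q r| <= `|N| by rewrite (le_trans (HN _ rT))// ler_norm.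
  have hM : `|p r| + `|Q r * Q r| <= `|M|.
    have QQ0 : 0 <= Q r * Q r by rewrite -expr2 sqr_ge0.
    rewrite (ger0_norm QQ0); apply: le_trans (le_trans (HM _ rT) (ler_norm M)).
    exact: ler_norm.
  have tri (c1 c2 c3 : R) : `|c1 - c2 - c3| <= `|c1| + `|c2| + `|c3|.
    by rewrite (le_trans (ler_normB _ _))// lerD2r (le_trans (ler_normB _ _)).
  have b1 : `|w1 r + Q r * u1 r| <= `|w1 r| + `|N| * `|u1 r|.
    by rewrite (le_trans (ler_normD _ _))// lerD2l normrM ler_wpM2r.
  have b3 : `|w2 r + Q r * u2 r| <= `|w2 r| + `|N| * `|u2 r|.
    by rewrite (le_trans (ler_normD _ _))// lerD2l normrM ler_wpM2r.
  have bV : `|p r - Q r * Q r| <= `|M| by rewrite (le_trans (ler_normB _ _)).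
  have b2 : `|(p r - Q r * Q r) * u1 r - Q r * w1 r - (x * u1 r - y * u2 r + g1 r)| <=
     `|M| * `|u1 r| + `|N| * `|w1 r| + (`|x| * `|u1 r| + `|y| * `|u2 r| + `|g1 r|).
    rewrite (le_trans (tri _ _ _))//; apply: lerD; first apply: lerD.
    - by rewrite normrM ler_wpM2r.
    - by rewrite normrM ler_wpM2r.
    - rewrite (le_trans (ler_normD _ _))// lerD2r (le_trans (ler_normB _ _))//.
      by rewrite !normrM.
  have b4 : `|(p r - Q r * Q r) * u2 r - Q r * w2 r - (x * u2 r + y * u1 r + g2 r)| <=
     `|M| * `|u2 r| + `|N| * `|w2 r| + (`|x| * `|u2 r| + `|y| * `|u1 r| + `|g2 r|).
    rewrite (le_trans (tri _ _ _))//; apply: lerD; first apply: lerD.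
    - by rewrite normrM ler_wpM2r.
    - by rewrite normrM ler_wpM2r.
    - rewrite (le_trans (ler_normD _ _))// lerD2r (le_trans (ler_normD _ _))//.
      by rewrite !normrM.
  apply: (le_trans (lerD (lerD b1 b2) (lerD b3 b4))).
  rewrite /G /Y /K.
  have := normr_ge0 (u1 r); have := normr_ge0 (u2 r); have := normr_ge0 (w1 r).
  have := normr_ge0 (w2 r); have := normr_ge0 N; have := normr_ge0 M.
  have := normr_ge0 x; have := normr_ge0 y.
  move: `|u1 r| `|u2 r| `|w1 r| `|w2 r| `|N| `|M| `|x| `|y| `|g1 r| `|g2 r| => a b c d e f0 g h i j.
  move=> h0 g0 f00 e0 d0 c0 b0 a0.
  rewrite -subr_ge0.
  have -> : i + j + (1 + e + f0 + g + h) * (a + c + (b + d)) -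
   (c + e * a + (f0 * a + e * c + (g * a + h * b + i)) +
    (d + e * b + (f0 * b + e * d + (g * b + h * a + j)))) =
   a + b + f0 * c + f0 * d + g * c + g * d + h * c + h * d by ring.
  by rewrite !addr_ge0 ?mulr_ge0.
have gY := gronwall (lbm_locint lY) K0 bound tT.
have cG : prim G T ^+ 2 <= 2 * T * (prim (fun t => g1 t * g1 t) T + prim (fun t => g2 t * g2 t) T).
  rewrite /G primD; [|exact: locint_norm|exact: locint_norm].
  have := sqr_prim_norm T0 lg1 lgg1; have := sqr_prim_norm T0 lg2 lgg2.
  move: (prim (fun t => `|g1 t|) T) (prim (fun t => `|g2 t|) T) (prim (fun t => g1 t * g1 t) T)
    (prim (fun t => g2 t * g2 t) T) => a b A B hB hA.
  rewrite -subr_ge0; have -> : 2 * T * (A + B) - (a + b) ^+ 2 =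
   2 * (T * A - a ^+ 2) + 2 * (T * B - b ^+ 2) + (a - b) ^+ 2 by ring.
  by apply: addr_ge0; [apply: addr_ge0; apply: mulr_ge0 => //; rewrite subr_ge0|exact: sqr_ge0].
have Y0 : 0 <= Y t by rewrite !addr_ge0.
have G0 : 0 <= prim G T by apply: prim_ge0 => s _; rewrite addr_ge0.
have YT : Y t <= prim G T * expR (K * T).
  by rewrite (le_trans gY)// ler_wpM2l// ler_expR ler_wpM2l//; case/andP : tT.
apply: (@le_trans _ _ (Y t ^+ 2)).
  have -> : u1 t * u1 t = `|u1 t| ^+ 2 by rewrite real_normK ?num_real// expr2.
  have -> : u2 t * u2 t = `|u2 t| ^+ 2 by rewrite real_normK ?num_real// expr2.
  rewrite /Y; have := normr_ge0 (u1 t); have := normr_ge0 (u2 t).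
  have := normr_ge0 (w1 t); have := normr_ge0 (w2 t).
  move: `|u1 t| `|u2 t| `|w1 t| `|w2 t| => a b c d d0 c0 b0 a0.
  rewrite -subr_ge0; have -> : (a + c + (b + d)) ^+ 2 - (a ^+ 2 + b ^+ 2) =
    2 * (a * b + a * c + a * d + b * c + b * d + c * d) + c ^+ 2 + d ^+ 2 by ring.
  by rewrite !addr_ge0 ?mulr_ge0 ?addr_ge0 ?mulr_ge0 ?sqr_ge0.
apply: (@le_trans _ _ ((prim G T * expR (K * T)) ^+ 2)).
  by rewrite lerXn2r ?nnegrE// mulr_ge0// expR_ge0.
by rewrite exprMn [leRHS]mulrAC; apply: ler_wpM2r => //; rewrite exprn_ge0// expR_ge0.
Qed.

End quasi_derivative.

(** * Energy estimates for confining coefficients *)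

Lemma lbm_sqr (R : realType) (f : R -> R) : lbm f -> lbm (fun t => f t ^+ 2).
Proof. by move=> lf; under eq_fun do rewrite expr2; exact: lbmM. Qed.

Lemma lbm_id (R : realType) : lbm (fun t : R => t).
Proof. exact: isprim_lbm (@isprim_id R). Qed.

Section energy.
Context {R : realType}.
Local Notation mu := (@lebesgue_measure R).
Implicit Types (u w v f g h : R -> R) (t T : R).
Variables (p Q Qt q : R -> R) (C : R).
Hypotheses (lp : lbm p) (lQ : lbm Q) (pQt : isprim Qt q).
Hypothesis (C0 : 0 <= C).
Hypothesis confining :
  forall t, 0 <= t -> t / 2 - C <= p t + q t - 2 * (Q t - Qt t) ^+ 2.

(** The energy inequality, for the cutoff [f = (1 - k t) u]; it needs [f b = 0]
    only, so [k = 0] serves for solutions vanishing at [b] and [k = 1 / b] for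
    arbitrary ones.  Adding the two integrations by parts [E1] (the equation tested
    with [(1 - k t) f]) and [E2] (of [Qt] against [f^2]), the rough term becomes
    [2 (Q - Qt) f f'], which is absorbed by completing a square. *)
Lemma qsol_energy u w v (k b : R) : qsol p Q u w v -> locint (fun t => v t * v t) ->
  u 0 = 0 -> 0 <= b -> 0 <= k -> k * b <= 1 -> (1 - k * b) * u b = 0 ->
  prim (fun t => ((1 - k * t) * (w t + Q t * u t) - k * u t) ^+ 2 / 2 +
                 t / 2 * ((1 - k * t) * u t) ^+ 2) b <=
  (C + k ^+ 2 + 1) * prim (fun t => u t * u t) b + prim (fun t => v t * v t) b.
Proof.
move=> qs lvv u0 b0 k0 kb ub.
have [lu lw] := qsol_lbm qs; have lv := qsol_locint lp lQ qs; have [pu pw] := qs.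
have pchi : isprim (fun t => 1 - k * t) (fun=> - k).
  by apply: (eq_isprim (isprimB (isprim_cst 1) (isprimZ k (@isprim_id R)))) => t _; ring.
pose f t := (1 - k * t) * u t.
pose f' t := (1 - k * t) * (w t + Q t * u t) - k * u t.
have pf : isprim f f' by apply: (eq_isprim (isprimM pchi pu)) => t _; rewrite /f /f'; ring.
have [l1 E1] := isprimM (isprimM pchi pf) pw.
have [l2 E2] := isprimM (isprimM pQt pf) pf.
have fb : f b = 0 by [].
have f0 : f 0 = 0 by rewrite /f u0 mulr0.
have {}E1 := E1 b b0; have {}E2 := E2 b b0.
rewrite fb f0 !(mulr0, mul0r) add0r in E1; rewrite fb f0 !(mulr0, mul0r) add0r in E2.
have lchi : lbm (fun t => 1 - k * t) := isprim_lbm pchi.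
have lid : lbm (fun t : R => t) := isprim_lbm (@isprim_id R).
have lf : lbm f := isprim_lbm pf.
have lf' : lbm f'.
  apply: lbmB; last by apply: lbmM => //; exact: lbm_cst.
  by apply: lbmM => //; apply: lbmD => //; exact: lbmM.
have luu : locint (fun t => u t * u t) by apply: lbm_locint; exact: lbmM.
rewrite -[X in X + _]primZ// -primD//; last exact: locintZ.
rewrite -[leRHS]addr0 -[X in _ + X](addr0 0) [X in _ + (X + _)]E1 [X in _ + (_ + X)]E2.
rewrite -!primD//; last 2 first.
- by apply: locintD => //; exact: locintZ.
- exact: locintD.
apply: le_prim.
- apply: lbm_locint; apply: lbmD.
    by apply: lbmM; [exact: lbm_sqr|exact: lbm_cst].
  by apply: lbmM; [apply: lbmM => //; exact: lbm_cst|exact: lbm_sqr].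
- by apply: locintD; [apply: locintD => //; exact: locintZ|exact: locintD].
move=> s /andP[s0 sb].
have chi0 : 0 <= 1 - k * s by rewrite subr_ge0 (le_trans _ kb)// ler_wpM2l.
have chi1 : 1 - k * s <= 1 by rewrite gerBl mulr_ge0.
rewrite -/(f s) -/(f' s) -subr_ge0.
set X := (X in 0 <= X).
pose c := 1 - k * s.
(* The difference of the two integrands is a sum of nonnegative terms: the
   confining condition, the completed square, the error of the cutoff and the
   source [v]. *)
have -> : X = (p s + q s - 2 * (Q s - Qt s) ^+ 2 - (s / 2 - C)) * (c * u s) ^+ 2
   + (f' s - 2 * (Q s - Qt s) * (c * u s)) ^+ 2 / 2
   + C * (1 - c ^+ 2) * (u s) ^+ 2
   + ((u s - c ^+ 2 * v s) ^+ 2 / 2 + (u s) ^+ 2 / 2 + (1 - c ^+ 4 / 2) * (v s) ^+ 2).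
  by rewrite /X /f' /f /c; field.
have c2 : c ^+ 2 <= 1 by rewrite exprn_ile1.
have c4 : c ^+ 4 <= 1 by rewrite exprn_ile1.
apply: addr_ge0; first apply: addr_ge0; first apply: addr_ge0.
- by rewrite mulr_ge0 ?sqr_ge0// subr_ge0 confining.
- by rewrite mulr_ge0 ?sqr_ge0.
- by apply: mulr_ge0; [apply: mulr_ge0 => //; rewrite subr_ge0|exact: sqr_ge0].
- apply: addr_ge0; first by apply: addr_ge0; rewrite mulr_ge0 ?sqr_ge0.
  apply: mulr_ge0; last exact: sqr_ge0.
  by lra.
Qed.

(** No condition at infinity is needed: the linear cutoff [1 - t / b] removes the
    boundary term, and it is at least 1/2 on [[0, T]] when [b >= 2 T]. *)
Lemma qsol_apriori u w v (A B : R) : qsol p Q u w v -> u 0 = 0 ->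
  locint (fun t => v t * v t) ->
  (forall t, 0 <= t -> prim (fun t => u t * u t) t <= A) ->
  (forall t, 0 <= t -> prim (fun t => v t * v t) t <= B) ->
  forall T, 0 <= T ->
    prim (fun t => (w t + Q t * u t) ^+ 2 + t * (u t * u t)) T <= 16 * ((C + 3) * A + B).
Proof.
move=> qs u0 lvv uA vB T T0.
have [lu lw] := qsol_lbm qs.
pose b := 2 * T + 2; pose k := b^-1.
have b0 : 0 < b by rewrite /b; lra.
have k0 : 0 <= k by rewrite invr_ge0 ltW.
have kb : k * b = 1 by rewrite mulVf// gt_eqF.
have k1 : k <= 1 by rewrite invf_le1//; rewrite /b; lra.
have := qsol_energy qs lvv u0 (ltW b0) k0; rewrite kb lexx subrr mul0r => /(_ isT erefl) E.
have luu : locint (fun t => u t * u t) by apply: lbm_locint; exact: lbmM.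
have lchi : lbm (fun t => 1 - k * t).
  by apply: lbmB; [exact: lbm_cst|apply: lbmM; [exact: lbm_cst|exact: (isprim_lbm (@isprim_id R))]].
have lid : lbm (fun t : R => t) := isprim_lbm (@isprim_id R).
have lsq f : lbm f -> lbm (fun t => f t ^+ 2).
  by move=> lf; under eq_fun do rewrite expr2; exact: lbmM.
have lu' : lbm (fun t => w t + Q t * u t) by apply: lbmD => //; exact: lbmM.
have lE : locint (fun t => ((1 - k * t) * (w t + Q t * u t) - k * u t) ^+ 2 / 2 +
                 t / 2 * ((1 - k * t) * u t) ^+ 2).
  apply: lbm_locint; apply: lbmD.
    apply: lbmM; last exact: lbm_cst.
    by apply: lsq; apply: lbmB; apply: lbmM => //; exact: lbm_cst.
  by apply: lbmM; [apply: lbmM => //; exact: lbm_cst|apply: lsq; exact: lbmM].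
have A0 : 0 <= A by apply: le_trans (uA 0 (lexx _)); rewrite prim0.
have Tb : T <= b by rewrite /b; lra.
have h1 : prim (fun t => ((w t + Q t * u t) ^+ 2 + t * (u t * u t)) / 16) T <=
   prim (fun t => ((1 - k * t) * (w t + Q t * u t) - k * u t) ^+ 2 / 2 +
                 t / 2 * ((1 - k * t) * u t) ^+ 2) T + prim (fun t => u t * u t) T.
  rewrite -primD//; apply: le_prim.
  - apply: lbm_locint; apply: lbmM; last exact: lbm_cst.
    by apply: lbmD; [exact: lsq|apply: lbmM => //; exact: lbmM].
  - exact: locintD.
  move=> s /andP[s0 sT].
  have c2 : 1 / 2 <= 1 - k * s.
    have : k * s <= 1 / 2 by rewrite /k mulrC ler_pdivrMr// /b; lra.
    by lra.
  move: (w s + Q s * u s) => a; move: (u s) => d; rewrite -subr_ge0.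
  pose c := 1 - k * s; rewrite -/c in c2.
  set X := (X in 0 <= X); have -> : X =
    (c * a - 2 * (k * d)) ^+ 2 / 4 + (c ^+ 2 - 1 / 4) * a ^+ 2 / 4 + (1 - k ^+ 2 / 2) * d ^+ 2
    + (c ^+ 2 - 1 / 4) * s / 2 * d ^+ 2 + s * d ^+ 2 / 16 by rewrite /X /c; field.
  have c4 : 0 <= c ^+ 2 - 1 / 4.
    rewrite subr_ge0 (_ : 1 / 4 = (1 / 2) ^+ 2); last by field.
    by rewrite lerXn2r// nnegrE; lra.
  have k2 : k ^+ 2 <= 1 by rewrite exprn_ile1.
  apply: addr_ge0; first apply: addr_ge0; first apply: addr_ge0; first apply: addr_ge0.
  - by rewrite mulr_ge0 ?sqr_ge0.
  - by apply: mulr_ge0 => //; apply: mulr_ge0 => //; exact: sqr_ge0.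
  - by apply: mulr_ge0; [lra|exact: sqr_ge0].
  - apply: mulr_ge0; last exact: sqr_ge0.
    by apply: mulr_ge0 => //; exact: mulr_ge0.
  - by apply: mulr_ge0 => //; apply: mulr_ge0 => //; exact: sqr_ge0.
have h2 : prim (fun t => ((1 - k * t) * (w t + Q t * u t) - k * u t) ^+ 2 / 2 +
                 t / 2 * ((1 - k * t) * u t) ^+ 2) T <=
   (C + k ^+ 2 + 1) * A + B.
  apply: le_trans (le_trans E _).
    apply: prim_nd => // x /andP[x0 _].
    apply: addr_ge0; first by rewrite mulr_ge0 ?sqr_ge0.
    by apply: mulr_ge0; [rewrite divr_ge0|exact: sqr_ge0].
  have K0 : 0 <= C + k ^+ 2 + 1 by rewrite !addr_ge0// exprn_ge0.
  by apply: lerD; [apply: ler_wpM2l => //; exact/uA/ltW|exact/vB/ltW].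
have h3 := uA T T0.
have lL : locint (fun t => (w t + Q t * u t) ^+ 2 + t * (u t * u t)).
  by apply: lbm_locint; apply: lbmD; [exact: lsq|apply: lbmM => //; exact: lbmM].
have : prim (fun t => ((w t + Q t * u t) ^+ 2 + t * (u t * u t)) / 16) T =
   prim (fun t => ((w t + Q t * u t) ^+ 2 + t * (u t * u t))) T / 16.
  by rewrite mulrC -primZ//; apply: eq_prim => s _; rewrite mulrC.
move: h1 => /[swap] -> h1.
have kA : k ^+ 2 * A <= A by rewrite ler_piMl// exprn_ile1.
move: h1 h2 h3; move: (prim _ T) => X; move: (prim _ T) => Y; move: (prim _ T) => Z h1 h2 h3.
have : X <= 16 * (Y + Z) by lra.
have -> : 16 * ((C + 3) * A + B) = 16 * (((C + k ^+ 2 + 1) * A + B) + A) + 16 * (A - k ^+ 2 * A) by ring.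
by lra.
Qed.

Lemma qsol_dirichlet u w v (b : R) : qsol p Q u w v -> locint (fun t => v t * v t) ->
  u 0 = 0 -> 0 <= b -> u b = 0 ->
  prim (fun t => t * (u t * u t)) b <=
  2 * ((C + 1) * prim (fun t => u t * u t) b + prim (fun t => v t * v t) b).
Proof.
move=> qs lvv u0 b0 ub; have [lu lw] := qsol_lbm qs.
have := qsol_energy qs lvv u0 b0 (lexx 0).
rewrite mul0r subr0 ub mulr0 ler01 => /(_ isT erefl).
rewrite expr0n addr0 => E.
have lid : lbm (fun t : R => t) := isprim_lbm (@isprim_id R).
have luu : lbm (fun t => t * (u t * u t)) := lbmM lid (lbmM lu lu).
rewrite -ler_pdivrMl// -[leLHS]primZ; last exact: (lbm_locint luu).
apply: le_trans E; apply: le_prim.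
- exact: (locintZ _ (lbm_locint luu)).
- apply: lbm_locint; apply: lbmD.
    apply: lbmM; last exact: lbm_cst.
    apply: lbm_sqr; apply: lbmB; last by apply: lbmM => //; exact: lbm_cst.
    apply: lbmM; last by apply: lbmD => //; exact: lbmM.
    by apply: lbmB; [exact: lbm_cst|apply: lbmM => //; exact: lbm_cst].
  apply: lbmM; first by apply: lbmM => //; exact: lbm_cst.
  apply: lbm_sqr; apply: lbmM => //.
  by apply: lbmB; [exact: lbm_cst|apply: lbmM => //; exact: lbm_cst].
move=> s /andP[s0 _]; rewrite mul0r subr0 !mul1r.
rewrite (_ : 2^-1 * _ = s / 2 * u s ^+ 2); last by rewrite expr2; ring.
by rewrite lerDr mulr_ge0// sqr_ge0.
Qed.

End energy.

(** * Square norms and the fundamental solution *)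

Section sq_norm.
Context {R : realType}.
Local Notation mu := (@lebesgue_measure R).
Implicit Types (u w v f g h : R -> R) (t T : R).

(** The square norm on [[0, T]] of the complex function [f1 + i f2]. *)
Definition sq f1 f2 T : R := prim (fun t => f1 t * f1 t + f2 t * f2 t) T.

Definition sqint f1 f2 : Prop :=
  locint (fun t => f1 t * f1 t) /\ locint (fun t => f2 t * f2 t).

Lemma lbm_sqint f1 f2 : lbm f1 -> lbm f2 -> sqint f1 f2.
Proof. by move=> l1 l2; split; apply/lbm_locint/lbmM. Qed.

Lemma sqE f1 f2 T : sqint f1 f2 ->
  sq f1 f2 T = prim (fun t => f1 t * f1 t) T + prim (fun t => f2 t * f2 t) T.
Proof. by move=> [l1 l2]; rewrite /sq primD. Qed.

Lemma sqint_locint f1 f2 : sqint f1 f2 -> locint (fun t => f1 t * f1 t + f2 t * f2 t).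
Proof. by move=> [l1 l2]; exact: locintD. Qed.

Lemma sq_ge0 f1 f2 T : 0 <= sq f1 f2 T.
Proof. by apply: prim_ge0 => s _; rewrite -!expr2 addr_ge0 ?sqr_ge0. Qed.

Lemma le_sq f1 f2 s t : sqint f1 f2 -> 0 <= s -> s <= t -> sq f1 f2 s <= sq f1 f2 t.
Proof.
move=> /sqint_locint l s0 st; apply: prim_nd => // x _.
by rewrite -!expr2 addr_ge0 ?sqr_ge0.
Qed.

Lemma sq_split f1 f2 g1 g2 T : sqint f1 f2 -> sqint g1 g2 ->
  sqint (fun t => f1 t - g1 t) (fun t => f2 t - g2 t) ->
  sq f1 f2 T <= 2 * sq g1 g2 T + 2 * sq (fun t => f1 t - g1 t) (fun t => f2 t - g2 t) T.
Proof.
move=> /sqint_locint lf /sqint_locint lg /sqint_locint ld.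
rewrite /sq -!primZ// -primD; [|exact: locintZ|exact: locintZ].
apply: le_prim => //; first by apply: locintD; exact: locintZ.
move=> s _; rewrite -subr_ge0.
set X := (X in 0 <= X).
have -> : X = (f1 s - 2 * g1 s) ^+ 2 + (f2 s - 2 * g2 s) ^+ 2 by rewrite /X; ring.
by rewrite addr_ge0 ?sqr_ge0.
Qed.

Lemma sq_sym f1 f2 g1 g2 T :
  sq (fun t => f1 t - g1 t) (fun t => f2 t - g2 t) T =
  sq (fun t => g1 t - f1 t) (fun t => g2 t - f2 t) T.
Proof. by apply: eq_prim => s _; ring. Qed.

(** Multiplication by the complex number [a1 + i a2]. *)
Lemma sqZ a1 a2 f1 f2 T : sqint f1 f2 ->
  sq (fun t => a1 * f1 t - a2 * f2 t) (fun t => a1 * f2 t + a2 * f1 t) T =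
  (a1 ^+ 2 + a2 ^+ 2) * sq f1 f2 T.
Proof.
by move=> /sqint_locint l; rewrite /sq -primZ//; apply: eq_prim => s _; ring.
Qed.

(** Chebyshev's inequality for the weight [t]. *)
Lemma prim_tail h T b : locint h -> locint (fun t => t * h t) ->
  (forall t, 0 <= t -> 0 <= h t) -> 0 < T -> T <= b ->
  prim h b <= prim h T + T^-1 * prim (fun t => t * h t) b.
Proof.
move=> lh lth h0 T0 Tb; rewrite -lerBlDl prim_itv//; last exact: ltW.
have lk := locintZ T^-1 lth.
apply: (@le_trans _ _ (prim (fun t => T^-1 * (t * h t)) b - prim (fun t => T^-1 * (t * h t)) T)).
  rewrite prim_itv//; last exact: ltW.
  apply: le_Rintegral => //.
  - by apply: (locint_sub (T := b) lh) => //; apply: subset_itvr; rewrite bnd_simp ltW.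
  - by apply: (locint_sub (T := b) lk) => //; apply: subset_itvr; rewrite bnd_simp ltW.
  move=> x /=; rewrite in_itv/= => /andP[Tx xb]; rewrite mulrA ler_peMl//.
    by rewrite h0// (le_trans (ltW T0))// ltW.
  by rewrite ler_pdivlMl// mulr1 ltW.
rewrite !primZ// gerBl; apply: mulr_ge0; first by rewrite invr_ge0 ltW.
apply: prim_ge0 => s /andP[s0 _].
by rewrite mulr_ge0// h0.
Qed.

Lemma isprim_cvg0 f h (e : R) : isprim f h -> 0 < e ->
  exists2 d, 0 < d & forall t, 0 <= t <= d -> `|f t - f 0| <= e.
Proof.
move=> [lh fE] e0.
have := @parameterized_integral_cvg_left R 0 1 h ltr01 (lh 1).
move=> /cvgrPdist_le/(_ _ e0)[d /= d0 dP]; exists (d / 2); first by rewrite divr_gt0.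
move=> t /andP[t0 td]; rewrite fE// addrC addKr.
have /= := dP t; rewrite !sub0r !normrN (ger0_norm t0); apply.
by rewrite (le_lt_trans td)// ltr_pdivrMr// ltr_pMr// ltr1n.
Qed.

(** Otherwise [|W| >= |l| / 2] from some point on, and its integral exceeds [B]. *)
Lemma integrable_limit0 W (l B : R) : locint W ->
  (forall t, 0 <= t -> prim (fun s => `|W s|) t <= B) ->
  (forall e, 0 < e -> exists T, forall t, T <= t -> `|W t - l| <= e) -> l = 0.
Proof.
move=> lW WB Wl; apply/eqP/negPn/negP => l0.
have l20 : 0 < `|l| / 2 by rewrite divr_gt0 ?normr_gt0.
have [T0 TP] := Wl _ l20.
pose T := `|T0|; have T00 : 0 <= T by exact: normr_ge0.
have B0 : 0 <= B by apply: le_trans (WB 0 (lexx _)); rewrite prim0.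
pose b := T + (B + 1) / (`|l| / 2).
have Tb : T < b by rewrite ltrDl divr_gt0// ltr_wpDl.
have lnW := locint_norm lW.
have : prim (fun s => `|W s|) b - prim (fun s => `|W s|) T <= B.
  apply: le_trans (WB b (le_trans T00 (ltW Tb))); rewrite gerBl.
  by apply: prim_ge0 => s _; exact: normr_ge0.
apply/negP; rewrite -ltNge prim_itv//; last exact: ltW.
apply: (@lt_le_trans _ _ (\int[mu]_(x in `]T, b]) (`|l| / 2))).
  rewrite Rintegral_cst//= lebesgue_measure_itv/= lte_fin Tb -EFinD/=.
  have -> : b - T = (B + 1) / (`|l| / 2) by rewrite /b; ring.
  by rewrite mulrC divfK ?ltrDl// gt_eqF.
apply: le_Rintegral => //.
- by apply: (locint_sub (T := b) (locint_cst _)) => //; apply: subset_itvr; rewrite bnd_simp.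
- by apply: (locint_sub (T := b) lnW) => //; apply: subset_itvr; rewrite bnd_simp.
move=> x /=; rewrite in_itv/= => /andP[Tx _].
have := TP x (le_trans (ler_norm _) (ltW Tx)).
have := ler_normD (W x) (l - W x); rewrite subrKC (distrC l) => h1 h2.
by lra.
Qed.

End sq_norm.

Section fundamental.
Context {R : realType}.
Implicit Types (u w v f g h : R -> R) (t T : R).
Variables (p Q : R -> R).
Hypotheses (lp : lbm p) (lQ : lbm Q).
Variables (x y : R) (phi1 zeta1 phi2 zeta2 : R -> R).
Hypothesis phiP : zsol p Q x y phi1 zeta1 phi2 zeta2 (fun=> 0) (fun=> 0).
Hypotheses (phi10 : phi1 0 = 0) (phi20 : phi2 0 = 0) (zeta10 : zeta1 0 = 1)
  (zeta20 : zeta2 0 = 0).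

Let lphi1 : lbm phi1. Proof. by have [/qsol_lbm[]] := phiP. Qed.
Let lphi2 : lbm phi2. Proof. by have [_ /qsol_lbm[]] := phiP. Qed.
Let sphi : sqint phi1 phi2 := lbm_sqint lphi1 lphi2.

(** Near 0 the quasi-derivative stays close to 1, so [phi1 t >= t / 2]. *)
Lemma sq_phi_gt0 T : 0 < T -> 0 < sq phi1 phi2 T.
Proof.
move=> T0; have [[pu pw] _] := phiP.
have [_ [N HN]] := lQ T.
have q0 : 0 < (4 : R)^-1 by rewrite invr_gt0.
have e0 : 0 < (4 * (`|N| + 1))^-1 by rewrite invr_gt0 mulr_gt0// ltr_wpDl.
have [d1 d10 d1P] := isprim_cvg0 pw q0.
have [d2 d20 d2P] := isprim_cvg0 pu e0.
pose d := Num.min T (Num.min d1 d2).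
have d0 : 0 < d by rewrite !lt_min T0 d10.
have dT : d <= T by rewrite ge_min lexx.
have lower t : 0 <= t <= d -> t / 2 <= phi1 t.
  move=> /andP[t0 td]; have [lu uE] := pu; rewrite uE// phi10 add0r.
  have -> : t / 2 = prim (fun=> 2^-1) t by rewrite prim_cst// mulrC.
  apply: le_prim => //; first exact: locint_cst.
  move=> s /andP[s0 st].
  have sd : s <= d := le_trans st td.
  have h1 : `|zeta1 s - 1| <= 4^-1.
    by have := d1P s; rewrite zeta10; apply; rewrite s0 (le_trans sd)// !ge_min lexx orbT.
  have h2 : `|phi1 s| <= (4 * (`|N| + 1))^-1.
    by have := d2P s; rewrite phi10 subr0; apply; rewrite s0 (le_trans sd)// !ge_min lexx !orbT.
  have h3 : `|Q s| <= `|N|.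
    by rewrite (le_trans _ (ler_norm _))// HN// s0 (le_trans sd).
  have h4 : `|Q s * phi1 s| <= 4^-1.
    rewrite normrM (le_trans (ler_pM _ _ h3 h2))//.
    by rewrite invfM mulrCA ler_piMr// ?invr_ge0// ler_pdivrMr ?mul1r ?lerDl// ltr_wpDl.
  move: h1 h4; rewrite !ler_norml => /andP[h1 _] /andP[h4 _]; lra.
apply: lt_le_trans (le_sq sphi (ltW d0) dT).
have d20' : 0 <= d / 2 by rewrite divr_ge0// ltW.
have dd : d / 2 <= d by rewrite ler_pdivrMr// ler_peMr ?ler1n// ltW.
apply: (@lt_le_trans _ _ (sq phi1 phi2 d - sq phi1 phi2 (d / 2))); last first.
  by rewrite gerBl sq_ge0.
rewrite /sq prim_itv//; last exact: sqint_locint.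
apply: (@lt_le_trans _ _ (\int[@lebesgue_measure R]_(x in `]d / 2, d]) (d / 4 * (d / 4)))).
  rewrite Rintegral_cst//= lebesgue_measure_itv/= lte_fin.
  have ltdd : d / 2 < d by rewrite ltr_pdivrMr// ltr_pMr// ltr1n.
  rewrite ltdd -EFinD/= mulr_gt0 ?mulr_gt0 ?divr_gt0// subr_gt0//.
apply: le_Rintegral => //.
- by apply: (locint_sub (T := d) (locint_cst _)) => //; apply: subset_itvr; rewrite bnd_simp.
- by apply: (locint_sub (T := d) (sqint_locint sphi)) => //; apply: subset_itvr; rewrite bnd_simp.
move=> s /=; rewrite in_itv/= => /andP[ds sd].
have s0 : 0 <= s by rewrite (le_trans d20')// ltW.
have h : d / 4 <= phi1 s.
  apply: le_trans (lower s _); last by rewrite s0.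
  by move: ds; lra.
rewrite -[leLHS]addr0 lerD//; last by rewrite -expr2 sqr_ge0.
by apply: ler_pM => //; rewrite divr_ge0// ltW.
Qed.

(** Subtracting the multiple of [phi] with the same initial slope leaves a solution
    with vanishing initial data, to which [zsol_estimate] applies. *)
Lemma zsol_decomp T : 0 <= T -> exists2 C, 0 <= C &
  forall u1 w1 u2 w2 g1 g2, zsol p Q x y u1 w1 u2 w2 g1 g2 ->
  u1 0 = 0 -> u2 0 = 0 -> sqint g1 g2 ->
  sq (fun t => u1 t - (w1 0 * phi1 t - w2 0 * phi2 t))
     (fun t => u2 t - (w1 0 * phi2 t + w2 0 * phi1 t)) T <= C * sq g1 g2 T.
Proof.
move=> T0; have [C C0 CP] := zsol_estimate lp lQ x y T0.
exists (C * T); first by rewrite mulr_ge0.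
move=> u1 w1 u2 w2 g1 g2 zs u10 u20 sg.
have := zsol_axpy (w1 0) (w2 0) zs phiP.
set r1 := fun t => u1 t - _; set r2 := fun t => u2 t - _.
set s1 := fun t => w1 t - _; set s2 := fun t => w2 t - _.
have -> : (fun t => g1 t - (w1 0 * 0 - w2 0 * 0)) = g1.
  by apply/funext => t; ring.
have -> : (fun t => g2 t - (w1 0 * 0 + w2 0 * 0)) = g2.
  by apply/funext => t; ring.
move=> zr; have [lg1 lg2] := sg.
have E := CP _ _ _ _ _ _ zr _ _ _ _ lg1 lg2.
have {}E t : 0 <= t <= T -> r1 t * r1 t + r2 t * r2 t <= C * sq g1 g2 T.
  rewrite sqE//; apply: E.
  - by rewrite /r1 u10 phi10 phi20; ring.
  - by rewrite /r2 u20 phi10 phi20; ring.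
  - by rewrite /s1 zeta10 zeta20; ring.
  - by rewrite /s2 zeta10 zeta20; ring.
have sr : sqint r1 r2.
  by have [/qsol_lbm[l1 _] /qsol_lbm[l2 _]] := zr; exact: lbm_sqint.
have -> : C * T * sq g1 g2 T = C * sq g1 g2 T * T by ring.
rewrite -prim_cst//; apply: le_prim => //; [exact: sqint_locint|exact: locint_cst].
Qed.

End fundamental.

(** * Coercivity away from the fundamental solution *)

Section coercivity.
Context {R : realType}.
Implicit Types (u w v f g h : R -> R) (t T : R).
Variables (p Q : R -> R).
Hypotheses (lp : lbm p) (lQ : lbm Q).
Variables (x y : R) (phi1 zeta1 phi2 zeta2 : R -> R).
Hypothesis phiP : zsol p Q x y phi1 zeta1 phi2 zeta2 (fun=> 0) (fun=> 0).
Hypotheses (phi10 : phi1 0 = 0) (phi20 : phi2 0 = 0) (zeta10 : zeta1 0 = 1)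
  (zeta20 : zeta2 0 = 0).

Let lphi1 : lbm phi1. Proof. by have [/qsol_lbm[]] := phiP. Qed.
Let lphi2 : lbm phi2. Proof. by have [_ /qsol_lbm[]] := phiP. Qed.
Let sphi : sqint phi1 phi2 := lbm_sqint lphi1 lphi2.

Definition weight u1 u2 T : R := prim (fun t => t * (u1 t * u1 t + u2 t * u2 t)) T.

Let slope a1 a2 T : sqint (fun t => a1 * phi1 t - a2 * phi2 t)
                          (fun t => a1 * phi2 t + a2 * phi1 t).
Proof.
by apply: lbm_sqint; [apply: lbmB|apply: lbmD]; apply: lbmM => //; exact: lbm_cst.
Qed.

Let lsub a1 a2 u1 u2 : lbm u1 -> lbm u2 ->
  sqint (fun t => u1 t - (a1 * phi1 t - a2 * phi2 t))
        (fun t => u2 t - (a1 * phi2 t + a2 * phi1 t)).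
Proof.
move=> l1 l2; apply: lbm_sqint; apply: lbmB => //.
  by apply: lbmB; apply: lbmM => //; exact: lbm_cst.
by apply: lbmD; apply: lbmM => //; exact: lbm_cst.
Qed.

Let sq_tail u1 u2 T b : lbm u1 -> lbm u2 -> 0 < T -> T <= b ->
  sq u1 u2 b <= sq u1 u2 T + T^-1 * weight u1 u2 b.
Proof.
move=> l1 l2 T0 Tb; have l : lbm (fun t => u1 t * u1 t + u2 t * u2 t).
  by apply: lbmD; exact: lbmM.
apply: prim_tail => //; first exact: lbm_locint.
  exact: lbm_locint (lbmM (@lbm_id R) l).
by move=> t _; rewrite -!expr2 addr_ge0 ?sqr_ge0.
Qed.

(** Three consequences of [zsol_decomp] for the initial slope [a] of a solution:
    the mass of [u] bounds that of [a phi] and conversely, up to the right-hand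
    side.  When [phi] is large on [[0, T]] the first makes [a] small, and the
    second then makes [u] small on a fixed initial interval [[0, S]]. *)
Lemma slope_bound T : 0 <= T -> exists2 C, 0 <= C &
  forall u1 w1 u2 w2 g1 g2, zsol p Q x y u1 w1 u2 w2 g1 g2 ->
  u1 0 = 0 -> u2 0 = 0 -> sqint g1 g2 ->
  [/\ (w1 0 ^+ 2 + w2 0 ^+ 2) * sq phi1 phi2 T <= 2 * sq u1 u2 T + C * sq g1 g2 T,
      forall S, 0 <= S <= T ->
        sq u1 u2 S <= 2 * ((w1 0 ^+ 2 + w2 0 ^+ 2) * sq phi1 phi2 S) + C * sq g1 g2 T &
      sq (fun t => u1 t - (w1 0 * phi1 t - w2 0 * phi2 t))
         (fun t => u2 t - (w1 0 * phi2 t + w2 0 * phi1 t)) T <= C * sq g1 g2 T].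
Proof.
move=> T0; have [C C0 CP] := zsol_decomp lp lQ phiP phi10 phi20 zeta10 zeta20 T0.
exists (2 * C); first by rewrite mulr_ge0.
move=> u1 w1 u2 w2 g1 g2 zs u10 u20 sg; have E := CP _ _ _ _ _ _ zs u10 u20 sg.
have [[qs1 _] [qs2 _]] := zs; have lu1 := isprim_lbm qs1; have lu2 := isprim_lbm qs2.
have su := lbm_sqint lu1 lu2.
have sr := lsub (w1 0) (w2 0) lu1 lu2.
have g0 := sq_ge0 g1 g2 T.
split.
- rewrite -sqZ//; apply: (le_trans (sq_split T (slope (w1 0) (w2 0) 0) su _)).
    apply: lbm_sqint; apply: lbmB => //.
      by apply: lbmB; apply: lbmM => //; exact: lbm_cst.
    by apply: lbmD; apply: lbmM => //; exact: lbm_cst.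
  rewrite sq_sym lerD2l -mulrA ler_pM2l//.
- move=> S /andP[S0 ST]; rewrite -sqZ//.
  apply: (le_trans (sq_split S su (slope (w1 0) (w2 0) 0) sr)).
  by rewrite lerD2l -mulrA ler_pM2l// (le_trans _ E)// le_sq.
- by rewrite (le_trans E)// ler_wpM2r// ler_peMl// ler1n.
Qed.

(** The weight leaves at most 1/8 of the mass bound [M] beyond [T]; choosing [T1]
    with [sq phi T1] much larger than [sq phi T], the slope of [u] is so small
    that at most another fraction of [M] sits on [[0, T]].  The conclusion is
    stated on [[0, b]] with constants independent of [b], so that it applies both
    to solutions on bounded intervals vanishing at [b] and to global ones. *)
Lemma coercive_nonL2 (C0 : R) : 0 <= C0 ->
  (forall A, exists2 T, 0 <= T & A <= sq phi1 phi2 T) ->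
  exists2 d, 0 < d & exists2 B, 0 <= B & forall b, B <= b ->
  forall u1 w1 u2 w2 g1 g2 M, zsol p Q x y u1 w1 u2 w2 g1 g2 ->
  u1 0 = 0 -> u2 0 = 0 -> sqint g1 g2 -> 0 <= M ->
  sq u1 u2 b <= M -> weight u1 u2 b <= C0 * M -> sq g1 g2 b <= d * M ->
  sq u1 u2 b <= M / 2.
Proof.
move=> C00 phioo; pose T := 8 * C0 + 1.
have T0 : 0 < T by rewrite ltr_wpDl// mulr_ge0.
have S0 := sq_ge0 phi1 phi2 T.
have [T1' T1'0 T1'P] := phioo (32 * (sq phi1 phi2 T + 1)).
pose T1 := Num.max T T1'.
have TT1 : T <= T1 by rewrite le_max lexx.
have T10 : 0 <= T1 by rewrite (le_trans (ltW T0)).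
have T1P : 32 * (sq phi1 phi2 T + 1) <= sq phi1 phi2 T1.
  by rewrite (le_trans T1'P)// le_sq// le_max lexx orbT.
have [C C_0 CP] := slope_bound T10.
have C10 : 0 < 32 * (C + 1) by rewrite mulr_gt0// ltr_wpDl.
exists (32 * (C + 1))^-1; first by rewrite invr_gt0.
exists T1 => // b T1b u1 w1 u2 w2 g1 g2 M zs u10 u20 sg M0 ub wb gb.
have [h1 h2 _] := CP _ _ _ _ _ _ zs u10 u20 sg.
have [[qs1 _] [qs2 _]] := zs; have lu1 := isprim_lbm qs1; have lu2 := isprim_lbm qs2.
have su := lbm_sqint lu1 lu2.
have Cg : C * sq g1 g2 T1 <= M / 32.
  apply: (@le_trans _ _ ((C + 1) * ((32 * (C + 1))^-1 * M))).
    apply: ler_pM => //; [exact: sq_ge0|by rewrite lerDl|].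
    by rewrite (le_trans _ gb)// le_sq.
  by rewrite invfM mulrA mulrCA divff ?mulr1 ?gt_eqF// ?ltr_wpDl// mulrC.
have uT1 : sq u1 u2 T1 <= M by rewrite (le_trans _ ub)// le_sq.
have {}h2 := h2 T; rewrite (ltW T0) TT1 in h2; have {}h2 := h2 isT.
have tail := sq_tail lu1 lu2 T0 (le_trans TT1 T1b).
have wT : T^-1 * weight u1 u2 b <= M / 8.
  rewrite ler_pdivrMl// (le_trans wb)// /T.
  have -> : (8 * C0 + 1) * (M / 8) = C0 * M + M / 8 by field.
  by rewrite lerDl divr_ge0.
set X := w1 0 ^+ 2 + w2 0 ^+ 2 in h1 h2.
have X0 : 0 <= X by rewrite addr_ge0 ?sqr_ge0.
have XS : X * sq phi1 phi2 T <= 3 * M / 32.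
  have : X * (32 * (sq phi1 phi2 T + 1)) <= X * sq phi1 phi2 T1 by rewrite ler_wpM2l.
  have -> : X * (32 * (sq phi1 phi2 T + 1)) = 32 * (X * sq phi1 phi2 T) + 32 * X by ring.
  by move: (X * sq phi1 phi2 T) (X * _) h1 => a c h1; lra.
by move: (X * sq phi1 phi2 T) XS h2 => a; lra.
Qed.

(** If [phi] is square integrable, [u - a phi] is small on a bounded interval by
    [slope_bound], and beyond it because both [u] and [a phi] have small tails.
    Orthogonality to [phi] enters as the last hypothesis: no multiple of [phi]
    brings [u] closer to 0. *)
Lemma coercive_orthogonal (C0 F : R) : 0 <= C0 ->
  (forall T, 0 <= T -> sq phi1 phi2 T <= F) ->
  exists2 d, 0 < d &
  forall u1 w1 u2 w2 g1 g2 M, zsol p Q x y u1 w1 u2 w2 g1 g2 ->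
  u1 0 = 0 -> u2 0 = 0 -> sqint g1 g2 -> 0 <= M ->
  (forall T, 0 <= T -> sq u1 u2 T <= M) ->
  (forall T, 0 <= T -> weight u1 u2 T <= C0 * M) ->
  (forall T, 0 <= T -> sq g1 g2 T <= d * M) ->
  (forall a1 a2 A, (forall T, 0 <= T ->
      sq (fun t => u1 t - (a1 * phi1 t - a2 * phi2 t))
         (fun t => u2 t - (a1 * phi2 t + a2 * phi1 t)) T <= A) ->
    forall T, 0 <= T -> sq u1 u2 T <= A) ->
  forall T, 0 <= T -> sq u1 u2 T <= M / 2.
Proof.
move=> C00 phiF.
have s10 := sq_phi_gt0 lQ phiP phi10 zeta10 ltr01.
(* The slope is bounded through the mass on [[0, 1]]; beyond [T2] the remaining
   mass of [phi] is at most [eps], so that of [a phi] is at most [M / 16]. *)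
pose eps := sq phi1 phi2 1 / 48.
have eps0 : 0 < eps by rewrite divr_gt0.
have [T2 T20 T2P] : exists2 T2, 0 <= T2 & forall t, T2 <= t -> sq phi1 phi2 t - sq phi1 phi2 T2 <= eps.
  pose E := [set sq phi1 phi2 T | T in [set T | 0 <= T]].
  have hE : has_sup E.
    split; first by exists (sq phi1 phi2 0); exists 0 => //=.
    by exists F => _ [T /= T0 <-]; exact: phiF.
  have [_ [T2 /= T20 <-] T2P] := sup_adherent eps0 hE.
  exists T2 => // t T2t.
  have : sq phi1 phi2 t <= sup E.
    by apply: ub_le_sup; [case: hE|exists t => //=; exact: le_trans T2t].
  by move: T2P; lra.
pose T := T2 + (16 * C0 + 1).
have C160 : 0 <= 16 * C0 by rewrite mulr_ge0.
have T1 : 1 <= T by rewrite /T; lra.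
have T0 : 0 < T by apply: lt_le_trans T1.
have [C C_0 CP] := slope_bound (ltW T0).
have C10 : 0 < 32 * (C + 1) by rewrite mulr_gt0// ltr_wpDl.
exists (32 * (C + 1))^-1; first by rewrite invr_gt0.
move=> u1 w1 u2 w2 g1 g2 M zs u10 u20 sg M0 uM wM gM ort.
have [h1 _ h3] := CP _ _ _ _ _ _ zs u10 u20 sg.
have [[qs1 _] [qs2 _]] := zs; have lu1 := isprim_lbm qs1; have lu2 := isprim_lbm qs2.
have su := lbm_sqint lu1 lu2.
have Cg : C * sq g1 g2 T <= M / 32.
  apply: (@le_trans _ _ ((C + 1) * ((32 * (C + 1))^-1 * M))).
    apply: ler_pM => //; [exact: sq_ge0|by rewrite lerDl|].
    by rewrite gM// ltW.
  by rewrite invfM mulrA mulrCA divff ?mulr1 ?gt_eqF// ?ltr_wpDl// mulrC.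
set X := w1 0 ^+ 2 + w2 0 ^+ 2 in h1.
have X0 : 0 <= X by rewrite addr_ge0 ?sqr_ge0.
have uT := uM _ (ltW T0).
have XS : X * sq phi1 phi2 1 <= 3 * M.
  have : X * sq phi1 phi2 1 <= X * sq phi1 phi2 T by rewrite ler_wpM2l// le_sq.
  by move: (X * sq phi1 phi2 1) (X * _) h1 => a c h1; lra.
apply: (ort (w1 0) (w2 0)) => t t0.
set r1 := fun t => u1 t - _; set r2 := fun t => u2 t - _.
have sr : sqint r1 r2 := lsub (w1 0) (w2 0) lu1 lu2.
have [tT|/ltW Tt] := leP t T.
  apply: (le_trans (le_sq sr t0 tT)); apply: (le_trans h3); lra.
have ut : sq u1 u2 t - sq u1 u2 T <= M / 16.
  have := sq_tail lu1 lu2 T0 Tt; rewrite lerBlDl => /le_trans; apply; rewrite lerD2l.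
  rewrite ler_pdivrMl// (le_trans (wM _ t0))// /T.
  have -> : (T2 + (16 * C0 + 1)) * (M / 16) = C0 * M + (T2 + 1) * (M / 16) by field.
  by rewrite lerDl mulr_ge0// ?divr_ge0// addr_ge0.
have pt : sq phi1 phi2 t - sq phi1 phi2 T <= eps.
  have T2T : T2 <= T by rewrite /T lerDl; lra.
  have := T2P t (le_trans T2T Tt); have := le_sq sphi T20 T2T; lra.
have rt : sq r1 r2 t - sq r1 r2 T <= 2 * (sq u1 u2 t - sq u1 u2 T) +
    2 * (X * (sq phi1 phi2 t - sq phi1 phi2 T)).
  rewrite (mulrBr X) /X -!sqZ// /sq !prim_itv//; try exact: ltW; try exact: sqint_locint;
    last exact: (sqint_locint (slope (w1 0) (w2 0) 0)).
  have sub h : locint h -> (@lebesgue_measure R).-integrable `]T, t] (EFin \o h).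
    by move=> lh; apply: (locint_sub (T := t) lh) => //; apply: subset_itvr; rewrite bnd_simp ltW.
  have iu := sub _ (sqint_locint su).
  have ip := sub _ (sqint_locint (slope (w1 0) (w2 0) 0)).
  rewrite -!RintegralZl// -RintegralD//; last 2 first.
  - exact: sub (locintZ 2 (sqint_locint su)).
  - exact: sub (locintZ 2 (sqint_locint (slope (w1 0) (w2 0) 0))).
  apply: le_Rintegral => //.
  - exact: sub (sqint_locint sr).
  - exact: sub (locintD (locintZ 2 (sqint_locint su)) (locintZ 2 (sqint_locint (slope (w1 0) (w2 0) 0)))).
  move=> s _; rewrite /r1 /r2 -subr_ge0.
  set Y := (Y in 0 <= Y).
  have -> : Y = (u1 s + (w1 0 * phi1 s - w2 0 * phi2 s)) ^+ 2 +
    (u2 s + (w1 0 * phi2 s + w2 0 * phi1 s)) ^+ 2 by rewrite /Y; ring.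
  by rewrite addr_ge0 ?sqr_ge0.
have Xe : X * (sq phi1 phi2 t - sq phi1 phi2 T) <= M / 16.
  apply: (@le_trans _ _ (X * eps)); first by rewrite ler_wpM2l.
  by rewrite /eps mulrA; lra.
move: h3 rt Xe; rewrite -/r1 -/r2.
move: (X * _) => a; lra.
Qed.

End coercivity.

(** * Solvability of the inhomogeneous equation *)

Section solvability.
Context {R : realType}.
Implicit Types (u w v f g h : R -> R) (t T : R).
Variables (p Q Qt q : R -> R) (C : R).
Hypotheses (lp : lbm p) (lQ : lbm Q) (pQt : isprim Qt q).
Hypothesis (C0 : 0 <= C).
Hypothesis confining :
  forall t, 0 <= t -> t / 2 - C <= p t + q t - 2 * (Q t - Qt t) ^+ 2.
Variables (x y : R).

Lemma locint_sqrD f g : lbm f -> locint g -> locint (fun t => g t * g t) ->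
  locint (fun t => (f t + g t) * (f t + g t)).
Proof.
move=> lf lg lgg.
have := locintD (lbm_locint (lbmM lf lf)) (locintD (locintZ 2 (locint_mul lf lg)) lgg).
by congr locint; apply/funext => t; ring.
Qed.

(** Real and imaginary part of [z u + g], the image of [u] under [H]. *)
Definition src1 u1 u2 g1 t : R := x * u1 t - y * u2 t + g1 t.
Definition src2 u1 u2 g2 t : R := x * u2 t + y * u1 t + g2 t.

Lemma zsol_src u1 w1 u2 w2 g1 g2 : zsol p Q x y u1 w1 u2 w2 g1 g2 -> sqint g1 g2 ->
  sqint (src1 u1 u2 g1) (src2 u1 u2 g2) /\ forall T,
  sq (src1 u1 u2 g1) (src2 u1 u2 g2) T <= 3 * (x ^+ 2 + y ^+ 2) * sq u1 u2 T + 3 * sq g1 g2 T.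
Proof.
move=> [qs1 qs2] sg; have [lg1 lg2] := sg.
have [lu1 _] := qsol_lbm qs1; have [lu2 _] := qsol_lbm qs2.
have l1 : lbm (fun t => x * u1 t - y * u2 t).
  by apply: lbmB; apply: lbmM => //; exact: lbm_cst.
have l2 : lbm (fun t => x * u2 t + y * u1 t).
  by apply: lbmD; apply: lbmM => //; exact: lbm_cst.
have ss : sqint (src1 u1 u2 g1) (src2 u1 u2 g2).
  split.
    apply: (locint_sqrD l1) => //.
    by have := locintB (qsol_locint lp lQ qs1) (lbm_locint l1); congr locint; apply/funext => s; ring.
  apply: (locint_sqrD l2) => //.
  by have := locintB (qsol_locint lp lQ qs2) (lbm_locint l2); congr locint; apply/funext => s; ring.
split => // T; have su := lbm_sqint lu1 lu2.
rewrite /sq -!primZ; [|exact: sqint_locint|exact: sqint_locint].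
rewrite -primD; [|apply: locintZ; exact: sqint_locint|apply: locintZ; exact: sqint_locint].
apply: le_prim; first exact: sqint_locint.
  by apply: locintD; apply: locintZ; exact: sqint_locint.
move=> s _; rewrite -subr_ge0; set X := (X in 0 <= X).
have -> : X = (x * u1 s + y * u2 s) ^+ 2 + (x * u2 s - y * u1 s) ^+ 2 +
   (x * u1 s - g1 s) ^+ 2 + (y * u2 s + g1 s) ^+ 2
   + (x * u2 s - g2 s) ^+ 2 + (y * u1 s - g2 s) ^+ 2.
  by rewrite /X /src1 /src2; ring.
by rewrite !addr_ge0 ?sqr_ge0.
Qed.

Definition weight_cst : R := 16 * (C + 3) + 16 * 3 * (x ^+ 2 + y ^+ 2) + 16 * 3.

Lemma weight_cst_ge0 : 0 <= weight_cst.
Proof. by rewrite /weight_cst !addr_ge0// ?mulr_ge0// ?addr_ge0// ?sqr_ge0. Qed.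

Let weightE u1 u2 T : lbm u1 -> lbm u2 -> weight u1 u2 T =
  prim (fun t => t * (u1 t * u1 t)) T + prim (fun t => t * (u2 t * u2 t)) T.
Proof.
move=> l1 l2; rewrite -primD; last 2 first.
- exact: lbm_locint (lbmM (@lbm_id R) (lbmM l1 l1)).
- exact: lbm_locint (lbmM (@lbm_id R) (lbmM l2 l2)).
by apply: eq_prim => s _; rewrite mulrDr.
Qed.

(** Both components satisfy the energy inequality with source [z u + g]. *)
Lemma zsol_dirichlet_weight u1 w1 u2 w2 g1 g2 b : zsol p Q x y u1 w1 u2 w2 g1 g2 ->
  sqint g1 g2 -> u1 0 = 0 -> u2 0 = 0 -> 0 <= b -> u1 b = 0 -> u2 b = 0 ->
  weight u1 u2 b <= weight_cst * (sq u1 u2 b + sq g1 g2 b).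
Proof.
move=> zs sg u10 u20 b0 u1b u2b; have [[s1 s2] /(_ b) sb] := zsol_src zs sg.
have [qs1 qs2] := zs; have [lu1 _] := qsol_lbm qs1; have [lu2 _] := qsol_lbm qs2.
have su := lbm_sqint lu1 lu2.
have E1 := qsol_dirichlet lp lQ pQt C0 confining qs1 s1 u10 b0 u1b.
have E2 := qsol_dirichlet lp lQ pQt C0 confining qs2 s2 u20 b0 u2b.
rewrite weightE//; apply: (le_trans (lerD E1 E2)).
have U0 := sq_ge0 u1 u2 b; have G0 := sq_ge0 g1 g2 b.
have xy0 : 0 <= x ^+ 2 + y ^+ 2 by rewrite addr_ge0 ?sqr_ge0.
rewrite [sq (src1 _ _ _) _ _]sqE// in sb.
have U : sq u1 u2 b = prim (fun t => u1 t * u1 t) b + prim (fun t => u2 t * u2 t) b by rewrite sqE.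
move: sb; rewrite /weight_cst -/(src1 u1 u2 g1) -/(src2 u1 u2 g2).
move: (prim (fun t => src1 u1 u2 g1 t * _) b) => V1.
move: (prim (fun t => src2 u1 u2 g2 t * _) b) => V2.
move=> sb; rewrite -subr_ge0.
have -> : (16 * (C + 3) + 16 * 3 * (x ^+ 2 + y ^+ 2) + 16 * 3) * (sq u1 u2 b + sq g1 g2 b) -
  (2 * ((C + 1) * prim (fun t => u1 t * u1 t) b + V1) +
   2 * ((C + 1) * prim (fun t => u2 t * u2 t) b + V2)) =
   2 * (3 * (x ^+ 2 + y ^+ 2) * sq u1 u2 b + 3 * sq g1 g2 b - (V1 + V2)) +
   ((14 * C + 94) * sq u1 u2 b + 42 * (x ^+ 2 + y ^+ 2) * sq u1 u2 b +
   (16 * C + 48 * (x ^+ 2 + y ^+ 2) + 90) * sq g1 g2 b).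
  by rewrite U; ring.
apply: addr_ge0; first by rewrite mulr_ge0// subr_ge0.
apply: addr_ge0; first apply: addr_ge0.
- by apply: mulr_ge0 => //; apply: addr_ge0 => //; rewrite mulr_ge0.
- by apply: mulr_ge0 => //; rewrite mulr_ge0.
- by apply: mulr_ge0 => //; apply: addr_ge0 => //; apply: addr_ge0; rewrite mulr_ge0.
Qed.

Lemma zsol_global_weight u1 w1 u2 w2 g1 g2 A B : zsol p Q x y u1 w1 u2 w2 g1 g2 ->
  sqint g1 g2 -> u1 0 = 0 -> u2 0 = 0 ->
  (forall T, 0 <= T -> sq u1 u2 T <= A) -> (forall T, 0 <= T -> sq g1 g2 T <= B) ->
  forall T, 0 <= T -> weight u1 u2 T <= 2 * weight_cst * (A + B).
Proof.
move=> zs sg u10 u20 uA gB T T0; have [[s1 s2] sb] := zsol_src zs sg.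
have [qs1 qs2] := zs; have [lu1 lw1] := qsol_lbm qs1; have [lu2 lw2] := qsol_lbm qs2.
have su := lbm_sqint lu1 lu2.
have A0 : 0 <= A := le_trans (sq_ge0 _ _ 0) (uA 0 (lexx _)).
have B0 : 0 <= B := le_trans (sq_ge0 _ _ 0) (gB 0 (lexx _)).
have xy0 : 0 <= x ^+ 2 + y ^+ 2 by rewrite addr_ge0 ?sqr_ge0.
pose V := 3 * (x ^+ 2 + y ^+ 2) * A + 3 * B.
have half (f : R -> R) t : 0 <= prim (fun t => f t * f t) t.
  by apply: prim_ge0 => s _; rewrite -expr2 sqr_ge0.
have sV t : 0 <= t -> prim (fun t => src1 u1 u2 g1 t * src1 u1 u2 g1 t) t +
    prim (fun t => src2 u1 u2 g2 t * src2 u1 u2 g2 t) t <= V.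
  move=> t0; rewrite -sqE//; apply: (le_trans (sb t)); apply: lerD.
    by apply: ler_wpM2l; [rewrite mulr_ge0|exact: uA].
  by rewrite ler_pM2l// gB.
have uA' t : 0 <= t -> prim (fun t => u1 t * u1 t) t + prim (fun t => u2 t * u2 t) t <= A.
  by move=> t0; rewrite -sqE// uA.
have E1 : prim (fun t => t * (u1 t * u1 t)) T <= 16 * ((C + 3) * A + V).
  apply: le_trans (qsol_apriori lp lQ pQt C0 confining qs1 u10 s1 _ _ T0).
  - apply: le_prim; first exact: lbm_locint (lbmM (@lbm_id R) (lbmM lu1 lu1)).
      apply: lbm_locint; apply: lbmD; last exact: (lbmM (@lbm_id R) (lbmM lu1 lu1)).
      by apply: lbm_sqr; apply: lbmD => //; exact: lbmM.
    by move=> s _; rewrite lerDr sqr_ge0.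
  - by move=> t t0; apply: le_trans (uA' t t0); rewrite lerDl half.
  - by move=> t t0; apply: le_trans (sV t t0); rewrite lerDl half.
have E2 : prim (fun t => t * (u2 t * u2 t)) T <= 16 * ((C + 3) * A + V).
  apply: le_trans (qsol_apriori lp lQ pQt C0 confining qs2 u20 s2 _ _ T0).
  - apply: le_prim; first exact: lbm_locint (lbmM (@lbm_id R) (lbmM lu2 lu2)).
      apply: lbm_locint; apply: lbmD; last exact: (lbmM (@lbm_id R) (lbmM lu2 lu2)).
      by apply: lbm_sqr; apply: lbmD => //; exact: lbmM.
    by move=> s _; rewrite lerDr sqr_ge0.
  - by move=> t t0; apply: le_trans (uA' t t0); rewrite lerDr half.
  - by move=> t t0; apply: le_trans (sV t t0); rewrite lerDr half.
rewrite weightE//; apply: (le_trans (lerD E1 E2)); rewrite /V /weight_cst -subr_ge0.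
set X := (X in 0 <= X).
have -> : X = 96 * A + (32 * C + 96 + 96 * (x ^+ 2 + y ^+ 2)) * B by rewrite /X; ring.
apply: addr_ge0; first by rewrite mulr_ge0.
apply: mulr_ge0 => //; apply: addr_ge0; last by rewrite mulr_ge0.
by apply: addr_ge0 => //; rewrite mulr_ge0.
Qed.

Variables (phi1 zeta1 phi2 zeta2 : R -> R).
Hypothesis phiP : zsol p Q x y phi1 zeta1 phi2 zeta2 (fun=> 0) (fun=> 0).
Hypotheses (phi10 : phi1 0 = 0) (phi20 : phi2 0 = 0) (zeta10 : zeta1 0 = 1)
  (zeta20 : zeta2 0 = 0).

Let lphi1 : lbm phi1. Proof. by have [/qsol_lbm[]] := phiP. Qed.
Let lphi2 : lbm phi2. Proof. by have [_ /qsol_lbm[]] := phiP. Qed.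
Let sphi : sqint phi1 phi2 := lbm_sqint lphi1 lphi2.

(** Weyl's construction.  Start from any solution [s] and subtract the multiple of
    [phi] that makes it vanish at [b]; coercivity bounds the result on [[0, b]] by
    the right-hand side.  The coefficients for [b -> oo] form a Cauchy sequence,
    at the rate [e n] tending to 0, because [phi] is not square integrable. *)
Lemma solvable_nonL2 g1 g2 G :
  (forall A, exists2 T, 0 <= T & A <= sq phi1 phi2 T) ->
  locint g1 -> locint g2 -> sqint g1 g2 -> (forall T, 0 <= T -> sq g1 g2 T <= G) ->
  exists u1 w1 u2 w2, [/\ zsol p Q x y u1 w1 u2 w2 g1 g2, u1 0 = 0, u2 0 = 0 &
    exists A, forall T, 0 <= T -> sq u1 u2 T <= A].
Proof.
move=> phioo lg1 lg2 sg gG.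
have G0 : 0 <= G := le_trans (sq_ge0 _ _ 0) (gG 0 (lexx _)).
have W0 := weight_cst_ge0.
have [d0 d00 [B B0 KP]] := coercive_nonL2 lp lQ phiP phi10 phi20 zeta10 zeta20
  (mulr_ge0 (ler0n R 2) W0) phioo.
pose d := Num.min d0 1.
have d_0 : 0 < d by rewrite lt_min d00 ltr01.
have d1 : d <= 1 by rewrite ge_min lexx orbT.
have dd0 : d <= d0 by rewrite ge_min lexx.
have [s1 [z1 [s2 [z2 [sP s10 s20 z10 z20]]]]] := zsol_exists lp lQ x y 0 0 lg1 lg2.
pose c1 a1 a2 t := s1 t - (a1 * phi1 t - a2 * phi2 t).
pose c2 a1 a2 t := s2 t - (a1 * phi2 t + a2 * phi1 t).
have cP a1 a2 : zsol p Q x y (c1 a1 a2) (fun t => z1 t - (a1 * zeta1 t - a2 * zeta2 t))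
    (c2 a1 a2) (fun t => z2 t - (a1 * zeta2 t + a2 * zeta1 t)) g1 g2.
  have := zsol_axpy a1 a2 sP phiP.
  have -> : (fun t => g1 t - (a1 * 0 - a2 * 0)) = g1 by apply/funext => t; ring.
  by have -> : (fun t => g2 t - (a1 * 0 + a2 * 0)) = g2 by apply/funext => t; ring.
have c10 a1 a2 : c1 a1 a2 0 = 0 by rewrite /c1 s10 phi10 phi20; ring.
have c20 a1 a2 : c2 a1 a2 0 = 0 by rewrite /c2 s20 phi10 phi20; ring.
have cl a1 a2 : lbm (c1 a1 a2) /\ lbm (c2 a1 a2).
  by have [/qsol_lbm[? _] /qsol_lbm[? _]] := cP a1 a2.
have cs a1 a2 : sqint (c1 a1 a2) (c2 a1 a2).
  by have [? ?] := cl a1 a2; exact: lbm_sqint.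
(* A solution vanishing at some [b >= T], where [phi b] is nonzero. *)
have step T : 0 <= T -> exists a : R * R, sq (c1 a.1 a.2) (c2 a.1 a.2) T <= G / d.
  move=> T0; pose b0 := Num.max T B.
  have b00 : 0 <= b0 by rewrite le_max T0.
  have [b bb0 phib] : exists2 b, b0 <= b & phi1 b * phi1 b + phi2 b * phi2 b != 0.
    apply: contrapT => h.
    have z b : b0 <= b -> phi1 b * phi1 b + phi2 b * phi2 b = 0.
      by move=> bb; apply: contrapT => /eqP hb; apply: h; exists b.
    have [S S0 SP] := phioo (sq phi1 phi2 b0 + 1).
    have [Sb|/ltW bS] := leP S b0.
      by have := le_sq sphi S0 Sb; lra.
    have : sq phi1 phi2 S - sq phi1 phi2 b0 = 0; last by lra.
    rewrite /sq prim_itv//; last exact: sqint_locint.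
    rewrite (@eq_Rintegral _ _ _ _ _ (fun=> 0)).
      by rewrite Rintegral_cst// mul0r.
    by move=> r; rewrite inE/= in_itv/= => /andP[/ltW br _]; exact: z.
  have b_0 := le_trans b00 bb0.
  pose D := phi1 b * phi1 b + phi2 b * phi2 b; rewrite -/D in phib.
  pose a1 := (s1 b * phi1 b + s2 b * phi2 b) / D.
  pose a2 := (s2 b * phi1 b - s1 b * phi2 b) / D.
  have c1b : c1 a1 a2 b = 0 by rewrite /c1 /a1 /a2 /D; field.
  have c2b : c2 a1 a2 b = 0 by rewrite /c2 /a1 /a2 /D; field.
  exists (a1, a2) => /=.
  have Tb : T <= b by apply: le_trans bb0; rewrite le_max lexx.
  have Bb : B <= b by apply: le_trans bb0; rewrite le_max lexx orbT.
  apply: (le_trans (le_sq (cs _ _) T0 Tb)).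
  (* With this [M] the conclusion [sq u b <= M / 2] of coercivity leaves only the
     case that the maximum is [G / d]. *)
  pose M := Num.max (sq (c1 a1 a2) (c2 a1 a2) b) (G / d).
  have Gd0 : 0 <= G / d by rewrite divr_ge0// ltW.
  have M0 : 0 <= M by rewrite le_max sq_ge0.
  have uM : sq (c1 a1 a2) (c2 a1 a2) b <= M by rewrite le_max lexx.
  have GM : G <= d * M by rewrite mulrC -ler_pdivrMr// le_max lexx orbT.
  have gM : sq g1 g2 b <= d * M by rewrite (le_trans (gG _ b_0)).
  have : sq (c1 a1 a2) (c2 a1 a2) b <= M / 2.
    apply: (KP b Bb _ _ _ _ _ _ M (cP a1 a2)) => //.
    - apply: (le_trans (zsol_dirichlet_weight (cP a1 a2) sg (c10 _ _) (c20 _ _) b_0 c1b c2b)).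
      rewrite (mulrC 2) -mulrA ler_wpM2l// mulr_natl mulr2n lerD//.
      by rewrite (le_trans gM)// ler_piMl.
    - by rewrite (le_trans gM)// ler_wpM2r.
  rewrite /M; case: (leP (sq (c1 a1 a2) (c2 a1 a2) b) (G / d)) => // h.
  by have := sq_ge0 (c1 a1 a2) (c2 a1 a2) b; lra.
have : forall n : nat, exists a : R * R, sq (c1 a.1 a.2) (c2 a.1 a.2) n%:R <= G / d.
  by move=> n; exact: step.
move=> /choice[a aP].
have Gd0 : 0 <= G / d by rewrite divr_ge0// ltW.
set K := G / d in aP Gd0.
have [T1 T10 T1P] := phioo 1.
pose n0 := (Num.truncn T1).+1.
have n0P n : (n0 <= n)%N -> 1 <= sq phi1 phi2 n%:R.
  move=> nn; rewrite (le_trans T1P)// le_sq//.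
  by rewrite (le_trans (ltW (truncnS_gt _)))// ler_nat.
have diff a1 a2 b1 b2 T : ((a1 - b1) ^+ 2 + (a2 - b2) ^+ 2) * sq phi1 phi2 T <=
    2 * sq (c1 a1 a2) (c2 a1 a2) T + 2 * sq (c1 b1 b2) (c2 b1 b2) T.
  rewrite -sqZ// /sq -!primZ; [|exact: sqint_locint..].
  rewrite -primD; [|apply: locintZ; exact: sqint_locint|apply: locintZ; exact: sqint_locint].
  apply: le_prim.
  - apply: sqint_locint; apply: lbm_sqint; [apply: lbmB|apply: lbmD]; apply: lbmM => //; exact: lbm_cst.
  - by apply: locintD; apply: locintZ; exact: sqint_locint.
  move=> s _; rewrite -subr_ge0; set X := (X in 0 <= X).
  have -> : X = (c1 a1 a2 s + c1 b1 b2 s) ^+ 2 + (c2 a1 a2 s + c2 b1 b2 s) ^+ 2.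
    by rewrite /X /c1 /c2; ring.
  by rewrite addr_ge0 ?sqr_ge0.
pose e n := Num.sqrt (4 * K / sq phi1 phi2 (n0 + n)%:R).
have pos n : 0 < sq phi1 phi2 (n0 + n)%:R.
  by rewrite (lt_le_trans ltr01)// n0P// leq_addr.
have cau n m : (n <= m)%N -> ((a (n0 + n)%N).1 - (a (n0 + m)%N).1) ^+ 2 +
    ((a (n0 + n)%N).2 - (a (n0 + m)%N).2) ^+ 2 <= e n ^+ 2.
  move=> nm; rewrite sqr_sqrtr; last by apply: divr_ge0; [rewrite mulr_ge0|exact: ltW (pos n)].
  rewrite ler_pdivlMr//; apply: (le_trans (diff _ _ _ _ _)).
  have h1 := aP (n0 + n)%N.
  have h2 : sq (c1 (a (n0 + m)%N).1 (a (n0 + m)%N).2) (c2 (a (n0 + m)%N).1 (a (n0 + m)%N).2) (n0 + n)%:R <= K.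
    by apply: le_trans (aP (n0 + m)%N); apply: le_sq => //; rewrite ler_nat leq_add2l.
  by lra.
have sqr_le (r s : R) (E : R) : 0 <= E -> r ^+ 2 + s ^+ 2 <= E ^+ 2 -> `|r| <= E.
  move=> E0 h; rewrite -(ger0_norm E0) -ler_sqr ?nnegrE//.
  by rewrite !real_normK ?num_real//; have := sqr_ge0 s; lra.
have [l1 l1P] : exists l, forall n, `|(a (n0 + n)%N).1 - l| <= e n.
  by apply: bounded_limit => n m /cau; apply: sqr_le; exact: sqrtr_ge0.
have [l2 l2P] : exists l, forall n, `|(a (n0 + n)%N).2 - l| <= e n.
  apply: bounded_limit => n m /cau; rewrite addrC; apply: sqr_le; exact: sqrtr_ge0.
exists (c1 l1 l2), (fun t => z1 t - (l1 * zeta1 t - l2 * zeta2 t)),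
  (c2 l1 l2), (fun t => z2 t - (l1 * zeta2 t + l2 * zeta1 t)); split => //.
exists (18 * K) => T T0.
pose n := (Num.truncn T).+1.
have Tn : T <= (n0 + n)%:R.
  by rewrite (le_trans (ltW (truncnS_gt T)))// ler_nat leq_addl.
apply: (le_trans (le_sq (cs _ _) T0 Tn)).
have sd : sqint (fun t => c1 l1 l2 t - c1 (a (n0 + n)%N).1 (a (n0 + n)%N).2 t)
    (fun t => c2 l1 l2 t - c2 (a (n0 + n)%N).1 (a (n0 + n)%N).2 t).
  have [? ?] := cl l1 l2; have [? ?] := cl (a (n0 + n)%N).1 (a (n0 + n)%N).2.
  by apply: lbm_sqint; exact: lbmB.
apply: (le_trans (sq_split _ (cs l1 l2) (cs (a (n0 + n)%N).1 (a (n0 + n)%N).2) sd)).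
have h1 := aP (n0 + n)%N.
have -> : sq (fun t => c1 l1 l2 t - c1 (a (n0 + n)%N).1 (a (n0 + n)%N).2 t)
    (fun t => c2 l1 l2 t - c2 (a (n0 + n)%N).1 (a (n0 + n)%N).2 t) (n0 + n)%:R =
   (((a (n0 + n)%N).1 - l1) ^+ 2 + ((a (n0 + n)%N).2 - l2) ^+ 2) * sq phi1 phi2 (n0 + n)%:R.
  by rewrite -sqZ//; apply: eq_prim => s _; rewrite /c1 /c2; ring.
have en : e n ^+ 2 * sq phi1 phi2 (n0 + n)%:R = 4 * K.
  rewrite sqr_sqrtr; last by apply: divr_ge0; [rewrite mulr_ge0|exact: ltW (pos n)].
  by rewrite divfK// gt_eqF.
have h2 : ((a (n0 + n)%N).1 - l1) ^+ 2 + ((a (n0 + n)%N).2 - l2) ^+ 2 <= 2 * e n ^+ 2.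
  have sq_le (r E : R) : `|r| <= E -> r ^+ 2 <= E ^+ 2.
    by move=> rE; rewrite -[r ^+ 2]real_normK ?num_real// lerXn2r// nnegrE// (le_trans _ rE).
  by have := sq_le _ _ (l1P n); have := sq_le _ _ (l2P n); lra.
have : (((a (n0 + n)%N).1 - l1) ^+ 2 + ((a (n0 + n)%N).2 - l2) ^+ 2) * sq phi1 phi2 (n0 + n)%:R <=
    2 * (4 * K).
  by rewrite -en mulrA ler_wpM2r// ltW.
lra.
Qed.

End solvability.

(** * From the almost everywhere equation to the quasi-derivative *)

Section rough_integrals.
Context {R : realType}.
Local Notation mu := (@lebesgue_measure R).
Import HBNNSimple.

(** No measurability is assumed of [f] and [g]: simple functions below [f] are
    modified on the null set.  This is needed because derivatives that exist only
    almost everywhere appear under integral signs. *)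
Lemma le_integral_off_null (f g : R -> \bar R) (N : set R) :
  measurable N -> mu N = 0%E -> (forall x, (0 <= f x)%E) -> (forall x, (0 <= g x)%E) ->
  (forall x, ~ N x -> (f x <= g x)%E) ->
  (\int[mu]_x f x <= \int[mu]_x g x)%E.
Proof.
move=> mN N0 f0 g0 fg; rewrite ge0_integralTE// [leRHS]ge0_integralTE//.
apply: ge_ereal_sup => _ [h hf <-].
have mNc := measurableC mN; pose h' := proj_nnsfun h mNc.
have h'E x : h' x = h x * \1_(~` N) x by [].
have -> : sintegral mu h = sintegral mu h'.
  rewrite -!integralT_nnsfun; apply: ae_eq_integral => //.
  - exact/measurable_EFinP.
  - exact/measurable_EFinP.
  exists N; split => // x /= h1; apply: contrapT => nN; apply: h1 => _.
  by rewrite mindicE mem_set// mulr1.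
apply: ereal_sup_ubound; exists h' => // x.
rewrite h'E indicE; have [xN|xN] := pselect (N x).
  by rewrite memNset ?mulr0//= => /(_ xN).
by rewrite mem_set//= mulr1 (le_trans (hf x))// fg.
Qed.

Lemma eq_integral_off_null (D : set R) (f g : R -> \bar R) (N : set R) :
  measurable N -> mu N = 0%E -> (forall x, D x -> ~ N x -> f x = g x) ->
  (\int[mu]_(x in D) f x = \int[mu]_(x in D) g x)%E.
Proof.
move=> mN N0 fg.
have le1 (f1 g1 : R -> \bar R) : (forall x, D x -> ~ N x -> f1 x = g1 x) ->
    (\int[mu]_(x in D) f1^\+ x <= \int[mu]_(x in D) g1^\+ x)%E.
  move=> e; rewrite integral_mkcond [leRHS]integral_mkcond.
  apply: (le_integral_off_null mN N0).
  - by move=> x; rewrite patchE; case: ifP.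
  - by move=> x; rewrite patchE; case: ifP.
  - by move=> x Nx; rewrite !patchE; case: ifP => //; rewrite inE => Dx; rewrite !funeposE e.
have le2 (f1 g1 : R -> \bar R) : (forall x, D x -> ~ N x -> f1 x = g1 x) ->
    (\int[mu]_(x in D) f1^\- x <= \int[mu]_(x in D) g1^\- x)%E.
  move=> e; rewrite integral_mkcond [leRHS]integral_mkcond.
  apply: (le_integral_off_null mN N0).
  - by move=> x; rewrite patchE; case: ifP.
  - by move=> x; rewrite patchE; case: ifP.
  - by move=> x Nx; rewrite !patchE; case: ifP => //; rewrite inE => Dx; rewrite !funenegE e.
have gf x : D x -> ~ N x -> g x = f x by move=> Dx Nx; rewrite fg.
rewrite integralE [RHS]integralE; congr (_ - _)%E; apply/eqP; rewrite eq_le.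
  by rewrite le1//= le1.
by rewrite le2//= le2.
Qed.

(** The real-valued integral of a measurable function that is not integrable has
    the conventional value 0. *)
Lemma fine_integral_nonint (D : set R) (f : R -> \bar R) : measurable D ->
  measurable_fun D f -> ~ mu.-integrable D f -> fine (\int[mu]_(x in D) f x) = 0.
Proof.
move=> mD mf nf.
have p0 : (0 <= \int[mu]_(x in D) f^\+ x)%E by exact: integral_ge0.
have n0 : (0 <= \int[mu]_(x in D) f^\- x)%E by exact: integral_ge0.
have : ~ ((\int[mu]_(x in D) f^\+ x < +oo) /\ (\int[mu]_(x in D) f^\- x < +oo))%E.
  move=> [fp fn]; apply: nf; apply/integrableP; split => //.
  rewrite (_ : (fun x => `|f x|)%E = (fun x => f^\+ x + f^\- x)%E); last first.
    by apply/funext => x; have := fune_abse f => /(congr1 (fun k => k x)).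
  rewrite ge0_integralD//; last 2 first.
  - exact: measurable_funepos.
  - exact: measurable_funeneg.
  exact: lte_add_pinfty.
rewrite [X in _ -> fine X = _]integralE; move: (\int[mu]_(x in D) f^\+ x)%E p0 (\int[mu]_(x in D) f^\- x)%E n0.
by move=> [a| |] // _ [b| |] //= _ h; exfalso; apply: h; split; exact: ltry.
Qed.

End rough_integrals.

Section regularity.
Context {R : realType}.
Local Notation mu := (@lebesgue_measure R).
Implicit Types (u w v f g h : R -> R) (t T : R).

Lemma eq_lbm f g : (forall t, 0 <= t -> f t = g t) -> lbm f -> lbm g.
Proof.
move=> fg lf T; have [mf [M HM]] := lf T; split; last first.
  by exists M => t tT; have /andP[t0 _] := tT; rewrite -fg// HM.
by apply: eq_measurable_fun mf => t; rewrite inE/= in_itv/= => /andP[t0 _]; rewrite fg.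
Qed.

Lemma isprim_continuous_at f h t : isprim f h -> 0 < t -> {for t, continuous f}.
Proof.
move=> [lh fE] t0; have t1 : 0 < t + 1 by rewrite addr_gt0.
have := prim_cont_within lh (ltW t1).
move=> /(continuous_within_itvP _ t1)[/(_ t) + _ _].
rewrite in_itv/= t0 ltrDl ltr01 => /(_ isT) ct.
have cf : {for t, continuous (fun t => f 0 + prim h t)}.
  by apply: cvgD; [exact: cvg_cst|exact: ct].
have ft := fE t (ltW t0); rewrite /prop_for /continuous_at ft.
apply: cvg_trans cf; apply: near_eq_cvg.
near=> s; have s0 : 0 < s by near: s; exact: lt_nbhsr.
by rewrite (fE s (ltW s0)).
Unshelve. all: by end_near. Qed.

Lemma prim_increment_le (h : R -> R) (s t M : R) : locint h -> 0 <= s -> s <= t ->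
  (forall x, s < x <= t -> `|h x| <= M) -> `|prim h t - prim h s| <= M * (t - s).
Proof.
move=> lh s0 st hM; rewrite prim_itv//.
have sub : `]s, t]%classic `<=` `[0, t]%classic.
  by move=> x /=; rewrite !in_itv/= => /andP[/ltW/(le_trans s0)-> ->].
have i1 := locint_sub lh (measurable_itv _) sub.
have i2 := locint_sub (locint_norm lh) (measurable_itv _) sub.
have i3 := locint_sub (locint_cst M) (measurable_itv _) sub.
apply: (le_trans (le_normr_Rintegral _ i1)) => //.
have -> : M * (t - s) = \int[mu]_(x in `]s, t]) M.
  rewrite Rintegral_cst//= lebesgue_measure_itv/= lte_fin.
  move: st; rewrite le_eqVlt => /predU1P[->|st]; first by rewrite ltxx subrr.
  by rewrite st -EFinD.
by apply: le_Rintegral => // x /=; rewrite in_itv; exact: hM.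
Qed.

Lemma prim_lip h T : lbm h -> exists2 M, 0 <= M &
  forall s t, 0 <= s -> s <= t -> t <= T -> `|prim h t - prim h s| <= M * (t - s).
Proof.
move=> lh; have [_ [M HM]] := lh T; exists `|M| => // s t s0 st tT.
apply: prim_increment_le => //; first exact: lbm_locint.
move=> x /andP[sx xt]; rewrite (le_trans _ (ler_norm M))// HM//.
by rewrite (le_trans s0 (ltW sx)) (le_trans xt).
Qed.

Lemma eq_prim_off_null f g t (N : set R) : measurable N -> mu N = 0%E ->
  (forall s, 0 <= s <= t -> ~ N s -> f s = g s) -> prim f t = prim g t.
Proof.
move=> mN N0 fg; congr fine; apply: (eq_integral_off_null mN N0) => s /=.
by rewrite in_itv/= => st Ns; rewrite fg.
Qed.

(** The primitive is Lipschitz on [[0, T]]. *)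
Lemma rac_sub_prim u h T : 0 <= T -> rac 0 T u -> lbm h ->
  rac 0 T (fun t => u t - prim h t).
Proof.
move=> T0 ru lh e e0; have e20 : 0 < e / 2 by rewrite divr_gt0.
have [d d0 dP] := ru _ e20; have [M M0 HM] := prim_lip T lh.
have M10 : 0 < M + 1 by rewrite ltr_wpDl.
exists (Num.min d (e / 2 / (M + 1))); first by rewrite lt_min d0 divr_gt0.
move=> n s t st tt; rewrite lt_min => /andP[sd se].
have h1 := dP n s t st tt sd.
apply: (@le_lt_trans _ _ (\sum_(i < n) `|u (t i) - u (s i)| + \sum_(i < n) (M * (t i - s i)))).
  rewrite -big_split/=; apply: ler_sum => i _.
  have [s0 [sti tT]] := st i (ltn_ord i).
  have -> : u (t i) - prim h (t i) - (u (s i) - prim h (s i)) =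
    (u (t i) - u (s i)) - (prim h (t i) - prim h (s i)) by ring.
  by rewrite (le_trans (ler_normB _ _))// lerD2l HM.
rewrite -mulr_sumr (_ : e = e / 2 + e / 2); last by field.
apply: ltr_leD => //.
have S0 : 0 <= \sum_(i < n) (t i - s i).
  by apply: sumr_ge0 => i _; have [_ [h2 _]] := st i (ltn_ord i); rewrite subr_ge0.
apply: (@le_trans _ _ ((M + 1) * \sum_(i < n) (t i - s i))).
  by rewrite ler_wpM2r// lerDl.
by rewrite mulrC -ler_pdivlMr// ltW.
Qed.

Lemma rac_unif u T (e : R) : rac 0 T u -> 0 < e -> exists2 d, 0 < d &
  forall s t, 0 <= s <= T -> 0 <= t <= T -> `|t - s| < d -> `|u t - u s| < e.
Proof.
move=> ru e0; have [d d0 dP] := ru _ e0; exists d => //.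
have H s t : 0 <= s -> s <= t -> t <= T -> t - s < d -> `|u t - u s| < e.
  move=> s0 st tT sd; have := dP 1 (fun=> s) (fun=> t); rewrite !big_ord1; apply => //.
  by move=> i j /andP[ij]; rewrite ltnS leqn0 => /eqP j0; move: ij; rewrite j0.
move=> s t /andP[s0 sT] /andP[t0 tT]; have [st|/ltW ts] := leP s t.
  by rewrite ger0_norm ?subr_ge0//; exact: H.
by rewrite distrC ger0_norm ?subr_ge0// => h; rewrite distrC; exact: H.
Qed.

Lemma rac_continuous u : (forall T, 0 <= T -> rac 0 T u) ->
  continuous (fun t => u (Num.max t 0)).
Proof.
move=> ru t; apply/cvgrPdist_lt => e e0.
have T0 : 0 <= `|t| + 1 by rewrite addr_ge0.
have [d d0 dP] := rac_unif (ru _ T0) e0.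
exists (Num.min d 1) => /=; first by rewrite lt_min d0 ltr01.
move=> s /=; rewrite lt_min => /andP[sd s1]; rewrite distrC in sd; rewrite distrC in s1.
have mx (a : R) : `|a| <= `|t| + 1 -> 0 <= Num.max a 0 <= `|t| + 1.
  move=> ha; rewrite le_max lexx orbT/= ge_max T0 andbT.
  exact: le_trans (ler_norm _) ha.
apply: dP; [apply: mx| apply: mx|].
- rewrite -[s](subrK t) (le_trans (ler_normD _ _))// addrC lerD2l ltW//.
- by rewrite lerDl.
apply: le_lt_trans sd; rewrite distrC.
have := ler_norm (s - t); have := ler_norm (t - s); rewrite (distrC t).
move=> h1 h2; have h3 : 0 <= `|s - t| by [].
by rewrite ler_norml; case: (leP s 0) => hs; case: (leP t 0) => ht;
  apply/andP; split; lra.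
Qed.

End regularity.

Section component.
Context {R : realType}.
Local Notation mu := (@lebesgue_measure R).
Implicit Types (u w v f g h : R -> R) (t T : R).

Lemma is_derive_seq f t (l : R) : is_derive t 1 f l ->
  (fun n => n.+1%:R * (f (t + n.+1%:R^-1) - f t)) @ \oo --> l.
Proof.
move=> [cd <-]; apply/cvgrPdist_lt => e e0.
have /cvgrPdist_lt/(_ _ e0) : (fun h : R => h^-1 *: (f (h *: 1 + t) - f t)) @ 0^' --> 'D_1 f t.
  exact: cd.
move=> [d /= d0 dP].
near=> n.
have := dP n.+1%:R^-1; rewrite /= sub0r normrN ger0_norm ?invr_ge0//.
rewrite invrK [_ *: 1]mulr1 (addrC _ t); apply.
  by near: n; exact: near_infty_natSinv_lt (PosNum d0).
by rewrite invr_eq0 pnatr_eq0.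
Unshelve. all: by end_near. Qed.

(** Recovering a genuine primitive from the almost everywhere equation.  The
    integral [J] on its right-hand side is not known beforehand to converge;
    but where it diverges it has the conventional value 0, so that [J] obeys a
    Gronwall inequality in either case, is bounded, and hence converges. *)
Lemma hop_real p Q u v (alpha : R) : lbm p -> lbm Q ->
  (forall t, 0 < t -> {for t, continuous Q}) ->
  (forall T, 0 <= T -> rac 0 T u) -> locint v ->
  {ae mu, forall t, 0 <= t -> is_derive t 1 u (alpha + Q t * u t +
     \int[mu]_(y in `[0, t]) (p y * u y - Q y * derive1 u y - v y))} ->
  exists w, qsol p Q u w v.
Proof.
move=> lp lQ cQ ru lv [N [mN N0 subN]].
have good t : 0 <= t -> ~ N t -> is_derive t 1 u (alpha + Q t * u t +
     \int[mu]_(y in `[0, t]) (p y * u y - Q y * derive1 u y - v y)).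
  by move=> t0 Nt; apply: contrapT => h; apply: Nt; apply: subN => /= /(_ t0).
have cu := rac_continuous ru.
set U := (fun t => u (Num.max t 0)) in cu.
have uU t : 0 <= t -> U t = u t by move=> t0; rewrite /U max_l.
have lu : lbm u by apply: eq_lbm uU (lbm_continuous cu).
have cut t : 0 < t -> {for t, continuous u}.
  move=> t0; rewrite /prop_for /continuous_at -uU; last exact: ltW.
  apply: cvg_trans (cu t); apply: near_eq_cvg; near=> s.
  have s0 : 0 < s by near: s; exact: lt_nbhsr.
  by rewrite uU// ltW.
(* A Borel version [d] of the derivative: the upper limit of difference quotients
   off the null set [N], and 0 on [N]. *)
pose D n t := n.+1%:R * (U (t + n.+1%:R^-1) - U t).
have mD n : measurable_fun setT (D n).
  apply: continuous_measurable_fun => t; apply: cvgM; first exact: cvg_cst.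
  apply: cvgB; last exact: cu.
  apply: (@continuous_comp _ _ _ (fun t : R => t + n.+1%:R^-1) U); last exact: cu.
  by apply: cvgD; [exact: cvg_id|exact: cvg_cst].
pose d0 t := fine (limn_esup (fun n => (D n t)%:E)).
have md0 : measurable_fun setT d0.
  apply: (measurableT_comp (@fine_measurable R setT measurableT)).
  by apply: measurable_fun_limn_esup => n; exact/measurable_EFinP.
pose d t := d0 t * \1_(~` N) t.
have md : measurable_fun setT d.
  by apply: measurable_funM => //; apply: measurable_indic; exact: measurableC.
have dN t : N t -> d t = 0 by move=> Nt; rewrite /d indicE memNset ?mulr0//=; apply.
have dgood t (l : R) : 0 <= t -> ~ N t -> is_derive t 1 u l -> d t = l.
  move=> t0 Nt du; rewrite /d indicE mem_set// mulr1 /d0.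
  have cD : (fun n => (D n t)%:E) @ \oo --> l%:E.
    apply: cvg_EFin; first exact: nearW.
    rewrite (_ : fine \o _ = fun n => n.+1%:R * (u (t + n.+1%:R^-1) - u t)).
      exact: is_derive_seq du.
    by apply/funext => n; rewrite /= /D !uU// addr_ge0.
  by rewrite is_cvg_limn_esupE ?(cvg_lim _ cD)//; apply/cvg_ex; exists l%:E.
pose k t := p t * u t - Q t * d t - v t.
have mk T : measurable_fun `[0, T] k.
  have [mp _] := lp T; have [mQ _] := lQ T; have [mu_ _] := lu T.
  have mv := locint_meas (T := T) lv.
  apply: measurable_funB => //; apply: measurable_funB; apply: measurable_funM => //.
  exact: measurable_funTS.
pose J t := \int[mu]_(y in `[0, t]) k y.
have JE t : \int[mu]_(y in `[0, t]) (p y * u y - Q y * derive1 u y - v y) = J t.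
  congr fine; apply: (eq_integral_off_null mN N0) => y /=.
  rewrite in_itv/= => /andP[y0 _] Ny; congr EFin; rewrite /k.
  have dy := good _ y0 Ny; rewrite (dgood _ _ y0 Ny dy) derive1E.
  by have [_ ->] := dy.
have {}good t : 0 <= t -> ~ N t -> is_derive t 1 u (alpha + Q t * u t + J t).
  by move=> t0 Nt; rewrite -JE; exact: good.
have dE t : 0 <= t -> ~ N t -> d t = alpha + Q t * u t + J t.
  by move=> t0 Nt; apply: dgood => //; exact: good.
pose h t := `|p t * u t| + `|Q t| * `|alpha + Q t * u t| + `|v t|.
have lh : locint h.
  apply: locintD; last exact: locint_norm.
  apply: lbm_locint; apply: lbmD; first by apply: lbm_norm; exact: lbmM.
  apply: lbmM; apply: lbm_norm => //; apply: lbmD; first exact: lbm_cst.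
  exact: lbmM.
have h0 t : 0 <= h t by rewrite !addr_ge0// mulr_ge0.
(* The integrand is bounded through the integral itself, which makes Gronwall's
   inequality applicable. *)
have kh t : 0 <= t -> `|k t| <= h t + `|Q t| * `|J t|.
  move=> t0; rewrite /k /h; have [Nt|Nt] := pselect (N t).
    rewrite dN// mulr0 subr0 (le_trans (ler_normB _ _))// -[leLHS]addr0.
    apply: lerD; last by rewrite mulr_ge0.
    by rewrite lerD2r lerDl mulr_ge0.
  rewrite dE// (le_trans (ler_normB _ _))//.
  rewrite [leRHS]addrAC lerD2r (le_trans (ler_normB _ _))// -[leRHS]addrA lerD2l normrM -mulrDr.
  by rewrite ler_wpM2l// ler_normD.
have Jb T : 0 <= T -> exists B, forall t, 0 <= t <= T -> `|J t| <= B.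
  move=> T0; have [_ [N1' HN1]] := lQ T; pose N1 := `|N1'|.
  have QN1 t : 0 <= t <= T -> `|Q t| <= N1.
    by move=> tT; rewrite (le_trans (HN1 _ tT))// ler_norm.
  exists (prim h T * expR (N1 * T)) => t tT; have /andP[t0 tT'] := tT.
  have hT0 : 0 <= prim h T by apply: prim_ge0 => s _.
  have [ik|nk] := pselect (mu.-integrable `[0, t] (EFin \o k)); last first.
    rewrite /J /Rintegral fine_integral_nonint//; last exact/measurable_EFinP.
    by rewrite normr0 mulr_ge0// expR_ge0.
  pose kt : R -> R := k \_ `[0, t].
  have lkt : locint kt.
    move=> T1; move: ik; rewrite integrable_mkcond//= (restrict_EFin k) => ik.
    exact: (@integrableS _ _ _ mu setT `[0, T1]%classic _ measurableT (measurable_itv _) (@subsetT _ _) ik).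
  have Jkt s : 0 <= s <= t -> J s = prim kt s.
    move=> /andP[s0 st]; apply: eq_Rintegral => y; rewrite inE/= in_itv/= => /andP[y0 ys].
    by rewrite /kt patchE mem_set//= in_itv/= y0 (le_trans ys).
  rewrite Jkt ?t0 ?lexx//.
  have lpk : lbm (fun s => `|prim kt s|) by apply: lbm_norm; exact: lbm_prim.
  have key s : 0 <= s <= t -> `|prim kt s| <= prim h T + N1 * prim (fun s => `|prim kt s|) s.
    move=> /andP[s0 st].
    apply: (@le_trans _ _ (prim (fun r => h r + N1 * `|prim kt r|) s)).
      apply: (le_trans (prim_norm _ lkt)); apply: le_prim.
      - exact: locint_norm.
      - by apply: locintD => //; apply: locintZ; exact: lbm_locint.
      move=> r /andP[r0 rs]; have rt := le_trans rs st.
      rewrite /kt patchE mem_set ?(le_trans (kh _ r0))//=; last by rewrite in_itv/= r0.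
      rewrite lerD2l Jkt ?r0// ler_wpM2r// QN1// r0.
      exact: le_trans rt tT'.
    rewrite primD//; last by apply: locintZ; exact: lbm_locint.
    rewrite primZ; last exact: lbm_locint.
    rewrite lerD2r; apply: prim_nd => //; exact: le_trans st tT'.
  have tt : 0 <= t <= t by rewrite t0 lexx.
  have N10 : 0 <= N1 := normr_ge0 _.
  apply: (le_trans (gronwall (lbm_locint lpk) N10 key tt)).
  by rewrite ler_wpM2l// ler_expR ler_wpM2l.
have lk : locint k.
  move=> T; have [T0|T0] := ltP T 0.
    rewrite set_itv_ge; first exact: integrable_set0.
    by rewrite bnd_simp -ltNge.
  have [B HB] := Jb T T0; have lQB := locintD lh (lbm_locint (lbmM (lbm_norm lQ) (@lbm_cst R B))).
  apply: (@le_integrable _ _ _ mu `[0%R, T]%classic (measurable_itv _) (EFin \o k) _ _ _ (lQB T)).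
    by apply/measurable_EFinP; exact: mk.
  move=> t /=.
  rewrite in_itv/= => tT; have /andP[t0 _] := tT.
  rewrite lee_fin (le_trans (kh t t0))// [leRHS]ger0_norm.
    by rewrite lerD2l ler_wpM2l// HB.
  by rewrite addr_ge0// mulr_ge0// (le_trans _ (HB t tT)).
have Jp t : J t = prim k t by [].
have pw := isprimD (isprim_cst alpha) (isprim_prim lk).
have lw : lbm (fun t => alpha + prim k t) := isprim_lbm pw.
exists (fun t => alpha + prim k t).
pose H t := alpha + prim k t + Q t * u t.
have lH : lbm H by apply: lbmD => //; exact: lbmM.
split; last first.
  have l1 : locint (fun t => (p t - Q t * Q t) * u t - Q t * (alpha + prim k t) - v t).
    apply: locintB => //; apply: lbm_locint; apply: lbmB; apply: lbmM => //.
    by apply: lbmB => //; exact: lbmM.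
  split=> // t t0; rewrite prim0 addr0; congr (_ + _).
  apply: (eq_prim_off_null mN N0) => s /andP[s0 _] Ns.
  by rewrite /k dE// Jp; ring.
split=> [|T]; first exact: lbm_locint.
rewrite le_eqVlt => /predU1P[<-|T0]; first by rewrite prim0 addr0.
have F0 : u T - prim H T = u 0 - prim H 0.
  apply: (rac_derive0 (f := fun t => u t - prim H t) T0).
    by apply: rac_sub_prim => //; [exact: ltW|exact: ru (ltW T0)].
  exists (N `|` [set 0]); split.
  - exact: measurableU.
  - apply/eqP; rewrite -measure_le0; apply: (le_trans (measureU2 _ _ _)) => //.
    have e1 : lebesgue_measure N = 0%E := N0.
    by rewrite /= e1 lebesgue_measure_set1 adde0.
  move=> t /=; apply: contra_notP => /not_orP[Nt tn0] /andP[t0 tT].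
  have {}t0 : 0 < t by rewrite lt_neqAle t0 andbT eq_sym; apply/eqP.
  have du := good _ (ltW t0) Nt.
  have dH : is_derive t 1 (prim H) (H t).
    apply: prim_is_derive => //; first exact: lbm_locint.
    apply: cvgD; first exact: isprim_continuous_at pw t0.
    by apply: cvgM; [exact: cQ|exact: cut].
  have dz : alpha + Q t * u t + J t - H t = 0 by rewrite /H Jp; ring.
  by have := is_deriveB du dH; rewrite dz.
by rewrite -[LHS](subrK (prim H T)) F0 prim0 subr0.
Unshelve. all: by end_near. Qed.

End component.

Section complex_bridge.
Context {R : realType}.
Local Notation mu := (@lebesgue_measure R).
Implicit Types (t T : R) (u v : R -> R[i]) (z : R[i]).

Lemma Re_le_normc z : `|Re z| <= normc z.
Proof.
case: z => a b /=; rewrite -(ger0_norm (sqrtr_ge0 _)) -ler_sqr ?nnegrE//.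
by rewrite !real_normK ?num_real// sqr_sqrtr ?addr_ge0 ?sqr_ge0// lerDl sqr_ge0.
Qed.

Lemma Im_le_normc z : `|Im z| <= normc z.
Proof.
case: z => a b /=; rewrite -(ger0_norm (sqrtr_ge0 _)) -ler_sqr ?nnegrE//.
by rewrite !real_normK ?num_real// sqr_sqrtr ?addr_ge0 ?sqr_ge0// lerDr sqr_ge0.
Qed.

Lemma normc_le z : normc z <= `|Re z| + `|Im z|.
Proof.
case: z => a b /=; rewrite -[leRHS]ger0_norm ?addr_ge0// -[leLHS](ger0_norm (sqrtr_ge0 _)).
rewrite -ler_sqr ?nnegrE// !real_normK ?num_real// sqr_sqrtr ?addr_ge0 ?sqr_ge0//.
rewrite -[a ^+ 2]real_normK ?num_real// -[b ^+ 2]real_normK ?num_real// sqrrD.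
by rewrite addrAC lerDl mulrn_wge0// mulr_ge0.
Qed.

Lemma loc_abs_cont_rac u T : loc_abs_cont u -> 0 <= T ->
  rac 0 T (fun t => Re (u t)) /\ rac 0 T (fun t => Im (u t)).
Proof.
move=> au T0.
have key (F : R[i] -> R) : (forall z, `|F z| <= normc z) -> (forall z1 z2, F (z1 - z2) = F z1 - F z2) ->
    rac 0 T (fun t => F (u t)).
  move=> Fn FB e e0; have [d d0 dP] := au 0 T (lexx _) T0 _ e0; exists d => // n s t st tt sd.
  have := dP n (fun i => s i) (fun i => t i) (fun i => st i (ltn_ord i)).
  have tr : trivIset setT (fun i : 'I_n => `]s i, t i[%classic).
    move=> i j _ _ [x [/= + +]]; rewrite !in_itv/= => /andP[six xti] /andP[sjx xtj].
    apply/val_inj; case: (ltngtP i j) => // ij.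
      have := tt i j; rewrite ij ltn_ord => /(_ isT) h.
      by have := lt_trans xti (le_lt_trans h sjx); rewrite ltxx.
    have := tt j i; rewrite ij ltn_ord => /(_ isT) h.
    by have := lt_trans xtj (le_lt_trans h six); rewrite ltxx.
  move=> /(_ tr sd); apply: le_lt_trans; apply: ler_sum => i _.
  by rewrite -FB Fn.
by split; apply: key => [z|[? ?] [? ?]] //; [exact: Re_le_normc|exact: Im_le_normc].
Qed.

Lemma within_continuous_at (f : R -> R) t : {within half_line, continuous f} ->
  0 < t -> {for t, continuous f}.
Proof. by move=> /continuous_within_itvcyP[/(_ t) h _] t0; apply: h; rewrite in_itv/= t0. Qed.

(** Extends a function on the half-line continuously by its value at 0. *)
Lemma within_max0_continuous (f : R -> R) : {within half_line, continuous f} ->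
  continuous (fun t => f (Num.max t 0)).
Proof.
move=> cf t; have [t0|t0|t0] := ltgtP t 0.
- rewrite /continuous_at max_r; last exact: ltW.
  apply: cvg_near_cst; near=> s; rewrite max_r//; apply: ltW; near: s; exact: lt_nbhsl.
- rewrite /continuous_at max_l; last exact: ltW.
  apply: cvg_trans (within_continuous_at cf t0); apply: near_eq_cvg.
  by near=> s; rewrite max_l//; apply: ltW; near: s; exact: lt_nbhsr.
- rewrite t0 /continuous_at maxxx.
  have /continuous_within_itvcyP[_ c0] := cf.
  apply/cvgrPdist_lt => e e0; have /cvgrPdist_lt/(_ _ e0)[d /= d0 dP] := c0.
  exists d => // s /= sd; have [s0|s0] := leP s 0; first by rewrite subrr normr0.
  exact: dP.
Unshelve. all: by end_near. Qed.

Lemma lbm_within (f : R -> R) : {within half_line, continuous f} -> lbm f.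
Proof.
move=> cf; apply: (@eq_lbm _ (fun t => f (Num.max t 0))).
  by move=> t t0; rewrite max_l.
exact/lbm_continuous/within_max0_continuous.
Qed.

(** Taken componentwise, the definition of [is_Hop] becomes a real first-order system. *)
Lemma hop_qsol (p Q : R -> R) u v :
  {within half_line, continuous p} -> {within half_line, continuous Q} ->
  is_Hop p Q u v -> exists w1 w2,
    qsol p Q (fun t => Re (u t)) w1 (fun t => Re (v t)) /\
    qsol p Q (fun t => Im (u t)) w2 (fun t => Im (v t)).
Proof.
move=> cp cQ [au lv [alpha Hae]].
have lp := lbm_within cp; have lQ := lbm_within cQ.
have cQ' t (t0 : 0 < t) := within_continuous_at cQ t0.
have li (F : R[i] -> R) : (forall T, 0 <= T -> mu.-integrable `[0, T] (fun t => (F (v t))%:E)) ->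
    locint (fun t => F (v t)).
  move=> h T; have [T0|T0] := ltP T 0; last exact: h.
  rewrite set_itv_ge; first exact: integrable_set0.
  by rewrite bnd_simp -ltNge.
have [w1 q1] : exists w, qsol p Q (fun t => Re (u t)) w (fun t => Re (v t)).
  apply: (@hop_real _ p Q _ _ (Re alpha)) => //.
  - by move=> T /(loc_abs_cont_rac au)[].
  - by apply: li => T /lv[].
  apply: negligibleS Hae => t /=; apply: contra_not => h t0; have [+ _] := h t0.
  congr (is_derive _ _ _ _); rewrite /cintegral /=.
  case: (alpha) => a1 a2; case: (u t) => b1 b2 /=; congr (_ + _); first by ring.
  apply: eq_Rintegral => s _ /=; case: (u s) (v s) => c1 c2 [e1 e2] /=.
  by ring.
have [w2 q2] : exists w, qsol p Q (fun t => Im (u t)) w (fun t => Im (v t)).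
  apply: (@hop_real _ p Q _ _ (Im alpha)) => //.
  - by move=> T /(loc_abs_cont_rac au)[].
  - by apply: li => T /lv[].
  apply: negligibleS Hae => t /=; apply: contra_not => h t0; have [_ +] := h t0.
  congr (is_derive _ _ _ _); rewrite /cintegral /=.
  case: (alpha) => a1 a2; case: (u t) => b1 b2 /=; congr (_ + _); first by ring.
  apply: eq_Rintegral => s _ /=; case: (u s) (v s) => c1 c2 [e1 e2] /=.
  by ring.
by exists w1, w2.
Qed.

Lemma qsol_lip (p Q u w v : R -> R) T : lbm Q -> qsol p Q u w v -> exists2 M, 0 <= M &
  forall s t, 0 <= s -> s <= t -> t <= T -> `|u t - u s| <= M * (t - s).
Proof.
move=> lQ qs; have [lu lw] := qsol_lbm qs.
have [M M0 HM] := prim_lip T (lbmD lw (lbmM lQ lu)); exists M => // s t s0 st tT.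
have [[_ uE] _] := qs; rewrite (uE t (le_trans s0 st)) (uE s s0).
by rewrite opprD addrACA subrr add0r HM.
Qed.

Lemma qsol_is_derive (p Q u w v : R -> R) t : lbm Q ->
  (forall t, 0 < t -> {for t, continuous Q}) -> qsol p Q u w v -> 0 < t ->
  is_derive t 1 u (w t + Q t * u t).
Proof.
move=> lQ cQ qs t0; have [[lu' uE] _] := qs; have [pu pw] := qs.
have dH : is_derive t 1 (prim (fun t => w t + Q t * u t)) (w t + Q t * u t).
  apply: prim_is_derive => //; apply: cvgD; first exact: isprim_continuous_at pw t0.
  by apply: cvgM; [exact: cQ|exact: isprim_continuous_at pu t0].
have := is_deriveD (is_derive_cst (u 0) t 1) dH; rewrite add0r.
apply: near_eq_is_derive.
near=> s; have s0 : 0 < s by near: s; exact: lt_nbhsr.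
by rewrite /= (uE s (ltW s0)).
Unshelve. all: by end_near. Qed.

(* The derivative that occurs in the defining equation agrees with [w + Q u] on
   the open interval; the endpoint 0 is negligible. *)
Lemma qsol_quasi_integral (p Q u w v : R -> R) t : lbm p -> lbm Q ->
  (forall t, 0 < t -> {for t, continuous Q}) -> qsol p Q u w v -> 0 < t ->
  w t = w 0 + \int[mu]_(y in `[0, t]) (p y * u y - Q y * derive1 u y - v y).
Proof.
move=> lp lQ cQ qs t0; have [_ [lw' wE]] := qs; rewrite (wE _ (ltW t0)); congr (_ + _).
have k0 : measurable [set 0 : R] by [].
congr fine; apply: (eq_integral_off_null k0); first exact: lebesgue_measure_set1.
move=> y /=; rewrite in_itv/= => /andP[y0 _] /eqP yn0; congr EFin.
have {}y0 : 0 < y by rewrite lt_neqAle eq_sym yn0.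
have [_ du] := qsol_is_derive lQ cQ qs y0.
by rewrite derive1E du; ring.
Qed.

Lemma qsol_hop (p Q : R -> R) (u1 w1 v1 u2 w2 v2 : R -> R) :
  {within half_line, continuous p} -> {within half_line, continuous Q} ->
  qsol p Q u1 w1 v1 -> qsol p Q u2 w2 v2 ->
  is_Hop p Q (fun t => u1 t +i* u2 t) (fun t => v1 t +i* v2 t) /\
  is_cont_deriv (fun t => u1 t +i* u2 t)
    (fun t => (w1 t + Q t * u1 t) +i* (w2 t + Q t * u2 t)).
Proof.
move=> cp cQ q1 q2; have lp := lbm_within cp; have lQ := lbm_within cQ.
have cQ' t (t0 : 0 < t) := within_continuous_at cQ t0.
have null0 : mu.-negligible [set 0 : R].
  by exists [set 0]; split => //; exact: lebesgue_measure_set1.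
split; last first.
  have cont (u w v : R -> R) : qsol p Q u w v ->
      {within half_line, continuous (fun t => w t + Q t * u t)}.
    have pc (f h : R -> R) : isprim f h -> {within half_line, continuous f}.
      move=> pf; apply/continuous_within_itvcyP; split.
        by move=> t; rewrite in_itv/= andbT => t0; exact: isprim_continuous_at pf t0.
      apply/cvgrPdist_le => e e0; have [d d0 dP] := isprim_cvg0 pf e0.
      near=> t; rewrite distrC dP//; apply/andP; split.
        by apply: ltW; near: t; exact: nbhs_right_gt.
      by near: t; exact: nbhs_right_le.
    move=> [pu pw] x; apply: cvgD; first exact: (pc _ _ pw x).
    by apply: cvgM; [exact: (cQ x)|exact: (pc _ _ pu x)].
  split; [exact: cont q1|exact: cont q2|].
  apply: negligibleS null0 => t /=; apply: contra_notP => /eqP tn0 t0.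
  have {}t0 : 0 < t by rewrite lt_neqAle eq_sym tn0.
  by split; [exact: qsol_is_derive q1 t0|exact: qsol_is_derive q2 t0].
split.
- move=> a b a0 ab e e0.
  have [M1 M10 H1] := qsol_lip b lQ q1; have [M2 M20 H2] := qsol_lip b lQ q2.
  have M0 : 0 < M1 + M2 + 1 by rewrite ltr_wpDl// addr_ge0.
  exists (e / (M1 + M2 + 1)); first by rewrite divr_gt0.
  move=> n s t st _ sd.
  apply: (@le_lt_trans _ _ (\sum_(i < n) (M1 + M2 + 1) * (t i - s i))).
    apply: ler_sum => i _; have [as_ [sti tb]] := st i.
    rewrite (le_trans (normc_le _))//=.
    have s0 := le_trans a0 as_.
    have := H1 _ _ s0 sti tb; have := H2 _ _ s0 sti tb.
    have : 0 <= t i - s i by rewrite subr_ge0.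
    by rewrite !mulrDl mul1r; lra.
  by rewrite -mulr_sumr mulrC -ltr_pdivlMr.
- by move=> T _; split; [exact: (qsol_locint lp lQ q1)|exact: (qsol_locint lp lQ q2)].
exists (w1 0 +i* w2 0).
apply: negligibleS null0 => t /=; apply: contra_notP => /eqP tn0 t0.
have {}t0 : 0 < t by rewrite lt_neqAle eq_sym tn0.
have e1 := qsol_quasi_integral lp lQ cQ' q1 t0.
have e2 := qsol_quasi_integral lp lQ cQ' q2 t0.
split => /=.
  have := qsol_is_derive lQ cQ' q1 t0; congr (is_derive _ _ _ _); rewrite e1.
  rewrite mul0r subr0 addrAC; congr (_ + _ + _); apply: eq_Rintegral => y _ /=.
  by ring.
have := qsol_is_derive lQ cQ' q2 t0; congr (is_derive _ _ _ _); rewrite e2.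
rewrite mul0r addr0 addrAC; congr (_ + _ + _); apply: eq_Rintegral => y _ /=.
by ring.
Unshelve. all: by end_near. Qed.

End complex_bridge.

(** * Operators in an inner product space *)

Section prehilbert.
Context {R : realType} {E : lmodType R[i]} (dot : E -> E -> R[i]).
Hypotheses (dotDl : forall a x y z, dot (a *: x + y) z = a * dot x z + dot y z)
  (dotC : forall x y, dot y x = conjc (dot x y))
  (dot_ge0 : forall x, 0 <= Re (dot x x))
  (dot_eq0 : forall x, Re (dot x x) = 0 -> x = 0).
Implicit Types (x y z : E) (G : set (E * E)).

Lemma dot0l x : dot 0 x = 0.
Proof.
have := dotDl 1 0 0 x; rewrite scale1r addr0 mul1r => h.
by apply: (addrI (dot 0 x)); rewrite addr0 -h.
Qed.

Lemma dotZl a x y : dot (a *: x) y = a * dot x y.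
Proof. by rewrite -[a *: x]addr0 dotDl dot0l addr0. Qed.

Lemma dotDl' x y z : dot (x + y) z = dot x z + dot y z.
Proof. by rewrite -[x]scale1r dotDl scale1r mul1r. Qed.

Lemma dotBl x y z : dot (x - y) z = dot x z - dot y z.
Proof. by rewrite dotDl' -scaleN1r dotZl mulN1r. Qed.

Lemma dotBr x y z : dot z (x - y) = dot z x - dot z y.
Proof.
rewrite dotC dotBl (dotC z x) (dotC z y).
by case: (dot z x) => a b; case: (dot z y) => c d; rewrite /= !opprK; congr Complex; ring.
Qed.

Lemma dotDr x y z : dot z (x + y) = dot z x + dot z y.
Proof.
rewrite dotC dotDl' (dotC z x) (dotC z y).
by case: (dot z x) => a b; case: (dot z y) => c d; rewrite /=; congr Complex; ring.
Qed.

Lemma dotZr a x y : dot x (a *: y) = conjc a * dot x y.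
Proof.
rewrite dotC dotZl (dotC x y).
by case: a (dot x y) => a b [c d] /=; congr Complex; ring.
Qed.

Lemma dot_Im x : Im (dot x x) = 0.
Proof.
have := dotC x x; case: (dot x x) => a b [/eqP]; rewrite -addr_eq0 -mulr2n mulrn_eq0/=.
by move/eqP.
Qed.

Lemma dot_normE x : dot_norm dot x ^+ 2 = Re (dot x x).
Proof. by rewrite sqr_sqrtr. Qed.

Lemma dot_norm_ge0 x : 0 <= dot_norm dot x.
Proof. exact: sqrtr_ge0. Qed.

Lemma Re_dot_axpy (s : R) x y : Re (dot (x + s%:C *: y) (x + s%:C *: y)) =
  Re (dot x x) + 2 * s * Re (dot x y) + s ^+ 2 * Re (dot y y).
Proof.
have e : x + s%:C *: y = x - (- s)%:C *: y.
  congr (_ + _); rewrite -scaleNr; congr (_ *: _).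
  by congr Complex; rewrite ?opprK// oppr0.
rewrite e dotBl !dotBr !dotZl !dotZr (dotC x y).
have := dot_Im x; have := dot_Im y.
by case: (dot x x) => a b; case: (dot x y) => c d; case: (dot y y) => f g /= -> _; ring.
Qed.

Lemma Re_dot_cauchy x y : Re (dot x y) ^+ 2 <= Re (dot x x) * Re (dot y y).
Proof.
set r := Re (dot x y); have h s := dot_ge0 (x + s%:C *: y).
have {}h s : 0 <= Re (dot x x) + 2 * s * r + s ^+ 2 * Re (dot y y).
  by rewrite -Re_dot_axpy.
have a0 := dot_ge0 x; have := dot_ge0 y; move: (Re (dot x x)) (Re (dot y y)) a0 h => a b a0 h.
rewrite le_eqVlt => /predU1P[b0|b0].
  rewrite -b0 mulr0; have := h (- (a + 1) * r); rewrite -b0 mulr0 addr0 => h1.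
  rewrite leNgt; apply/negP => r0.
  have : (a + 1) * r ^+ 2 * 2 <= a by move: h1; rewrite expr2; lra.
  have [r1|r1] := leP 1 (r ^+ 2).
    have : (a + 1) * 1 <= (a + 1) * r ^+ 2 by rewrite ler_wpM2l// addr_ge0.
    by lra.
  have := h (- (a + 1) / (r ^+ 2) * r); rewrite -b0 mulr0 addr0.
  have -> : 2 * (- (a + 1) / r ^+ 2 * r) * r = - 2 * (a + 1) by field; rewrite -sqrf_eq0 gt_eqF.
  by lra.
have := h (- r / b).
have -> : a + 2 * (- r / b) * r + (- r / b) ^+ 2 * b = (a * b - r ^+ 2) / b by field; rewrite gt_eqF.
by rewrite pmulr_lge0 ?invr_gt0// subr_ge0.
Qed.

Lemma normc_dot_le x y : normc (dot x y) <= 2 * (dot_norm dot x * dot_norm dot y).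
Proof.
have key r a b : 0 <= a -> 0 <= b -> r ^+ 2 <= a * b -> `|r| <= Num.sqrt a * Num.sqrt b :> R.
  move=> a0 b0 h; rewrite -sqrtrM// -sqrtr_sqr ler_sqrt// mulr_ge0//.
have h1 := key _ _ _ (dot_ge0 x) (dot_ge0 y) (Re_dot_cauchy x y).
have h2 : `|Im (dot x y)| <= dot_norm dot x * dot_norm dot y.
  have := Re_dot_cauchy x ('i *: y); rewrite !dotZr !dotZl.
  have -> : Re (conjc 'i * ('i * dot y y)) = Re (dot y y) by case: (dot y y) => a b /=; ring.
  have -> : Re (conjc 'i * dot x y) = Im (dot x y) by case: (dot x y) => a b /=; ring.
  exact: key.
by rewrite (le_trans (normc_le _))// mulr_natl mulr2n lerD.
Qed.

Lemma dot_small0 (c : R[i]) : (forall e : R, 0 < e -> normc c <= e) -> c = 0.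
Proof.
move=> h; apply: eq0_normc; apply/eqP; rewrite eq_le; apply/andP; split.
  by apply/ler_addgt0Pr => e e0; rewrite add0r h.
by case: c {h} => a b; exact: sqrtr_ge0.
Qed.

(** Density is used in this form: an orthogonal complement is trivial. *)
Lemma dense_orth0 (D : set E) y :
  (forall x (e : R), 0 < e -> exists2 a, D a & dot_norm dot (x - a) < e) ->
  (forall a, D a -> dot y a = 0) -> y = 0.
Proof.
move=> dD yD; apply: dot_eq0.
have yy : dot y y = 0.
  apply: dot_small0 => e e0.
  pose e1 := e / (2 * (dot_norm dot y + 1)).
  have n0 : 0 < dot_norm dot y + 1 by rewrite ltr_wpDl// dot_norm_ge0.
  have e10 : 0 < e1 by rewrite divr_gt0// mulr_gt0.
  have [a Da ya] := dD y e1 e10.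
  have -> : dot y y = dot y (y - a) by rewrite dotBr (yD a Da) subr0.
  apply: (le_trans (normc_dot_le _ _)).
  have -> : e = 2 * ((dot_norm dot y + 1) * e1) by rewrite /e1; field; rewrite gt_eqF.
  rewrite ler_pM2l//; apply: ler_pM; rewrite ?dot_norm_ge0//; [by rewrite lerDl|exact: ltW].
by rewrite yy.
Qed.

Section symmetric_part.
Variable G0 : set (E * E).
Hypotheses (G00 : G0 (0, 0))
  (G0lin : forall c x1 y1 x2 y2, G0 (x1, y1) -> G0 (x2, y2) -> G0 (c *: x1 + x2, c *: y1 + y2))
  (G0closed : closed_operator dot G0).

(** The intersection of [G0] with its adjoint. *)
Definition symmetric_part : set (E * E) :=
  [set p | G0 p /\ forall q, G0 q -> dot p.2 q.1 = dot p.1 q.2].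

Lemma symmetric_part_symmetric : symmetric_operator dot symmetric_part.
Proof. by move=> x1 y1 x2 y2 [_ h] [g2 _]; exact: (h (x2, y2)). Qed.

Lemma symmetric_part_closed : closed_operator dot symmetric_part.
Proof.
move=> x y h; split.
  by apply: G0closed => e /h[a [b [[gab _] xa yb]]]; exists a, b.
move=> [a' b'] Gq /=; apply/eqP; rewrite -subr_eq0; apply/eqP; apply: dot_small0 => e e0.
pose K := dot_norm dot a' + dot_norm dot b' + 1.
have K0 : 0 < K by rewrite ltr_wpDl// addr_ge0// dot_norm_ge0.
have e10 : 0 < e / (4 * K) by rewrite divr_gt0// mulr_gt0.
have [a [b [[_ sab] xa yb]]] := h _ e10.
have -> : dot y a' - dot x b' = dot (y - b) a' - dot (x - a) b'.
  by rewrite !dotBl (sab (a', b') Gq)/=; ring.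
apply: (le_trans (le_normcD _ _)); rewrite normcN.
have na := dot_norm_ge0 a'; have nb := dot_norm_ge0 b'.
have h1 : normc (dot (y - b) a') <= 2 * (e / (4 * K) * K).
  apply: (le_trans (normc_dot_le _ _)); rewrite ler_pM2l//.
  by apply: ler_pM; rewrite ?dot_norm_ge0 ?(ltW yb)// /K; lra.
have h2 : normc (dot (x - a) b') <= 2 * (e / (4 * K) * K).
  apply: (le_trans (normc_dot_le _ _)); rewrite ler_pM2l//.
  by apply: ler_pM; rewrite ?dot_norm_ge0 ?(ltW xa)// /K; lra.
apply: (le_trans (lerD h1 h2)).
have -> : 2 * (e / (4 * K) * K) + 2 * (e / (4 * K) * K) = e by field; rewrite gt_eqF.
by [].
Qed.

(** If [x] had two images, their difference would be orthogonal to the domain. *)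
Lemma symmetric_part_linear : densely_defined dot symmetric_part ->
  linear_operator symmetric_part.
Proof.
move=> dd; have lin c x1 y1 x2 y2 : symmetric_part (x1, y1) -> symmetric_part (x2, y2) ->
    symmetric_part (c *: x1 + x2, c *: y1 + y2).
  move=> [g1 s1] [g2 s2]; split; first exact: G0lin.
  by move=> q gq /=; rewrite !dotDl (s1 _ gq) (s2 _ gq).
split=> //; first by split=> // q _; rewrite !dot0l.
move=> x y1 y2 h1 h2; apply/eqP; rewrite -subr_eq0; apply/eqP.
apply: (dense_orth0 dd) => a [b [gab _]].
have [_ s] := lin (-1) _ _ _ _ h2 h1.
have := s (a, b) gab; rewrite /= !scaleN1r addNr dot0l => <-.
by rewrite addrC.
Qed.

End symmetric_part.

(** If [(x, y)] is in the adjoint and [x'] solves [(G - l) x' = y - l x], then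
    [x - x'] is orthogonal to the range of [G - l], which is everything. *)
Lemma symmetric_onto_self_adjoint G (l : R) : linear_operator G ->
  densely_defined dot G -> symmetric_operator dot G ->
  (forall y, exists x, G (x, y + l%:C *: x)) -> self_adjoint dot G.
Proof.
move=> linG dG sG ontoG; split=> //.
apply/seteqP; split=> [[x y] /= adj|[x y] Gxy a b Gab /=]; last exact: sG Gab Gxy.
have [x' Gx'] := ontoG (y - l%:C *: x).
have cl z : dot z (l%:C *: x) = l%:C * dot z x by rewrite dotZr; congr (_ * _); congr Complex; rewrite oppr0.
have cl' z : dot z (l%:C *: x') = l%:C * dot z x' by rewrite dotZr; congr (_ * _); congr Complex; rewrite oppr0.
suff : x - x' = 0.
  by move/eqP; rewrite subr_eq0 => /eqP xx'; rewrite -xx' subrK in Gx'.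
apply: dot_eq0.
have [a Ga] := ontoG (x - x').
have e1 := adj _ _ Ga; have e2 := sG _ _ _ _ Ga Gx'.
rewrite /= dotDl' dotZl in e1; rewrite dotDl' dotZl in e2.
have : dot (x - x') (x - x') = 0.
  rewrite [LHS]dotBr.
  have -> : dot (x - x') x = dot a y - l%:C * dot a x by rewrite -e1; ring.
  have -> : dot (x - x') x' = dot a (y - l%:C *: x + l%:C *: x') - l%:C * dot a x' by rewrite -e2; ring.
  by rewrite dotDr cl' dotBr cl; ring.
by move=> ->.
Qed.

End prehilbert.

(** * The inner product of square integrable functions *)

Section L2_inner_product.
Context {R : realType}.
Local Notation mu := (@lebesgue_measure R).
Local Notation hl := (@half_line R).
Implicit Types (f g h : L2fun R) (F G : R -> R) (T : R).

Let mhl : measurable hl := measurable_half_line.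

Definition msq F : Prop :=
  measurable_fun hl F /\ mu.-integrable hl (fun t => (F t * F t)%:E).

Lemma L2fun_msq f : msq (fun t => Re (f t)) /\ msq (fun t => Im (f t)).
Proof.
have /asboolP[[m1 m2] fin] := L2fun_valP f.
have key (F : R[i] -> R) : (forall z, F z ^+ 2 <= normc z ^+ 2) ->
    measurable_fun hl (fun t => F (f t)) -> msq (fun t => F (f t)).
  move=> Fn mF; split=> //; apply/integrableP; split.
    by apply/measurable_EFinP; exact: measurable_funM.
  apply: le_lt_trans fin; apply: ge0_le_integral => //.
  - by apply: measurableT_comp => //; apply/measurable_EFinP; exact: measurable_funM.
  - exact: measurable_normc2.
  - by move=> t _; rewrite /= lee_fin ger0_norm -?expr2 ?sqr_ge0// Fn.
split; apply: key => // z; rewrite normc2E ?lerDl ?lerDr sqr_ge0//.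
Qed.

Lemma msq_mul F G : msq F -> msq G -> mu.-integrable hl (fun t => (F t * G t)%:E).
Proof.
move=> [mF iF] [mG iG].
have iFG : mu.-integrable hl (fun t => (F t * F t + G t * G t)%:E).
  exact: (@integrableD _ _ _ mu _ mhl _ _ iF iG).
apply: (@le_integrable _ _ _ mu hl mhl (fun t => (F t * G t)%:E) _ _ _ iFG).
  by apply/measurable_EFinP; exact: measurable_funM.
move=> t _; rewrite /= lee_fin normrM [leRHS]ger0_norm -?expr2 ?addr_ge0 ?sqr_ge0//.
rewrite -[F t ^+ 2]real_normK ?num_real// -[G t ^+ 2]real_normK ?num_real//.
have := sqr_ge0 (`|F t| - `|G t|); have := normr_ge0 (F t); have := normr_ge0 (G t).
move: `|F t| `|G t| => a b a0 b0; have := mulr_ge0 a0 b0; rewrite sqrrB; lra.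
Qed.

Lemma L2dot_fun f g : L2dot (L2class f) (L2class g) =
  (\int[mu]_(t in hl) (Re (f t) * Re (g t) + Im (f t) * Im (g t))) +i*
  (\int[mu]_(t in hl) (Im (f t) * Re (g t) - Re (f t) * Im (g t))).
Proof.
rewrite L2dotE /cintegral; congr Complex; apply: eq_Rintegral => t _;
  by case: (f t) => a b; case: (g t) => c d /=; ring.
Qed.

Let iRR f g := msq_mul (L2fun_msq f).1 (L2fun_msq g).1.
Let iII f g := msq_mul (L2fun_msq f).2 (L2fun_msq g).2.
Let iIR f g := msq_mul (L2fun_msq f).2 (L2fun_msq g).1.
Let iRI f g := msq_mul (L2fun_msq f).1 (L2fun_msq g).2.

Let iRe f g : mu.-integrable hl (EFin \o (fun t => Re (f t) * Re (g t) + Im (f t) * Im (g t))).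
Proof. exact: (@integrableD _ _ _ mu _ mhl _ _ (iRR f g) (iII f g)). Qed.

Let iIm f g : mu.-integrable hl (EFin \o (fun t => Im (f t) * Re (g t) - Re (f t) * Im (g t))).
Proof. exact: (@integrableB _ _ _ mu _ mhl _ _ (iIR f g) (iRI f g)). Qed.

Let iZ (c : R) (F : R -> R) : mu.-integrable hl (EFin \o F) ->
  mu.-integrable hl (EFin \o (fun t => c * F t)).
Proof. by move=> iF; exact: (@integrableZl _ _ _ mu _ mhl c _ iF). Qed.

Lemma L2dotDl (a : R[i]) (x y z : L2 R) : L2dot (a *: x + y) z = a * L2dot x z + L2dot y z.
Proof.
have [f ->] := L2class_surj x; have [g ->] := L2class_surj y; have [h ->] := L2class_surj z.
have -> : a *: L2class f + L2class g = L2class (a *: f + g) by rewrite L2classD L2classZ.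
rewrite !L2dot_fun.
have E t : (a *: f + g) t = a * f t + g t by [].
case: a E => a1 a2 E.
set I1 := \int[mu]_(t in hl) (Re (f t) * Re (h t) + Im (f t) * Im (h t)).
set I2 := \int[mu]_(t in hl) (Im (f t) * Re (h t) - Re (f t) * Im (h t)).
set J1 := \int[mu]_(t in hl) (Re (g t) * Re (h t) + Im (g t) * Im (h t)).
set J2 := \int[mu]_(t in hl) (Im (g t) * Re (h t) - Re (g t) * Im (h t)).
transitivity ((a1 * I1 - a2 * I2 + J1) +i* (a1 * I2 + a2 * I1 + J2)); last first.
  by [].
have i1 := iRe f h; have i2 := iIm f h; have j1 := iRe g h; have j2 := iIm g h.
congr Complex.
  rewrite /I1 /I2 /J1 -!RintegralZl// -RintegralB//; [|exact: iZ|exact: iZ].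
  rewrite -RintegralD//; last exact: (@integrableB _ _ _ mu _ mhl _ _ (iZ a1 i1) (iZ a2 i2)).
  by apply: eq_Rintegral => t _; rewrite E; case: (f t) => b c; case: (g t) => d e /=; ring.
rewrite /I1 /I2 /J2 -!RintegralZl// -RintegralD//; [|exact: iZ|exact: iZ].
rewrite -RintegralD//; last exact: (@integrableD _ _ _ mu _ mhl _ _ (iZ a1 i2) (iZ a2 i1)).
by apply: eq_Rintegral => t _; rewrite E; case: (f t) => b c; case: (g t) => d e /=; ring.
Qed.

Lemma L2dotC (x y : L2 R) : L2dot y x = conjc (L2dot x y).
Proof.
have [f ->] := L2class_surj x; have [g ->] := L2class_surj y.
rewrite !L2dot_fun /=; congr Complex; first by apply: eq_Rintegral => t _; ring.
have i2 := iIm f g.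
rewrite -mulN1r -RintegralZl//; apply: eq_Rintegral => t _; ring.
Qed.

Lemma L2dot_Re f : Re (L2dot (L2class f) (L2class f)) =
  \int[mu]_(t in hl) (Re (f t) * Re (f t) + Im (f t) * Im (f t)).
Proof. by rewrite L2dot_fun. Qed.

Lemma L2dot_ge0 (x : L2 R) : 0 <= Re (L2dot x x).
Proof.
have [f ->] := L2class_surj x; rewrite L2dot_Re; apply: Rintegral_ge0 => t _.
by rewrite -!expr2 addr_ge0 ?sqr_ge0.
Qed.

Lemma L2dot_eq0 (x : L2 R) : Re (L2dot x x) = 0 -> x = 0.
Proof.
have [f ->] := L2class_surj x; rewrite L2dot_Re => h.
have if_ := iRe f f.
have e0 : (\int[mu]_(t in hl) `|(Re (f t) * Re (f t) + Im (f t) * Im (f t))%:E| = 0)%E.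
  under eq_integral => t _.
    rewrite gee0_abs; last by rewrite lee_fin -!expr2 addr_ge0 ?sqr_ge0.
    over.
  by rewrite -[LHS]fineK ?(integrable_fin_num _ if_)//; congr EFin.
have mf : measurable_fun hl (fun t => (Re (f t) * Re (f t) + Im (f t) * Im (f t))%:E).
  by have /integrableP[] := if_.
have := (ae_eq_integral_abs mu mhl mf).1 e0.
move=> ae0; have -> : 0 = L2class 0 :> L2 R.
  by apply: (addrI (L2class 0)); rewrite addr0 -L2classD addr0.
apply/L2classP; apply: negligibleS ae0 => t /=; apply: contra_not => e Dt.
have := e Dt; case: (f t) => a b [/=] /eqP.
rewrite -!expr2 paddr_eq0 ?sqr_ge0// !sqrf_eq0 => /andP[/eqP -> /eqP ->].
by [].
Qed.

Lemma msq_locint F : msq F -> locint (fun t => F t * F t) /\ locint F.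
Proof.
move=> [mF iF].
have sub T : `[0, T] `<=` hl by move=> t /=; rewrite /half_line/= !in_itv/= andbT => /andP[].
have lFF : locint (fun t => F t * F t).
  by move=> T; exact: (@integrableS _ _ _ mu hl `[0%R, T]%classic _ mhl (measurable_itv _) (@sub T) iF).
split=> // T; have l2 := locintD (@locint_cst R 1) lFF.
apply: (@le_integrable _ _ _ mu `[0%R, T]%classic (measurable_itv _) (EFin \o F) _ _ _ (l2 T)).
  by apply/measurable_EFinP; exact: measurable_funS mF.
move=> t _; rewrite lee_fin [leRHS]ger0_norm; last by rewrite addr_ge0// -expr2 sqr_ge0.
rewrite -expr2 -[F t ^+ 2]real_normK ?num_real//.
by have := sqr_ge0 (1 - `|F t|); rewrite sqrrB expr1n mul1r; have := normr_ge0 (F t); lra.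
Qed.

Lemma L2fun_locint f : [/\ sqint (fun t => Re (f t)) (fun t => Im (f t)),
  locint (fun t => Re (f t)) & locint (fun t => Im (f t))].
Proof.
have [m1 m2] := L2fun_msq f.
by have [? ?] := msq_locint m1; have [? ?] := msq_locint m2; split.
Qed.

Lemma half_line_integral_sup F : (forall t, 0 <= F t) -> measurable_fun hl F ->
  (\int[mu]_(t in `[0%R, +oo[) (F t)%:E =
   ereal_sup [set \int[mu]_(t in `[0%R, i.+1%:R]) (F t)%:E | i in [set: nat]])%E.
Proof.
move=> F0 mF; pose G : R -> R := F \_ hl.
have mG : measurable_fun setT G by exact/(measurable_restrictT _ _).1.
have G0 t : 0 <= G t by rewrite /G patchE; case: ifP.
have GF t : 0 <= t -> G t = F t.
  by move=> t0; rewrite /G patchE mem_set//= /half_line/= in_itv/= t0.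
have := @ge0_integral_ereal_sup R mu G G0 mG.
rewrite (_ : (\int[mu]_(x in `[0%R, +oo[) (G x)%:E = \int[mu]_(x in `[0%R, +oo[) (F x)%:E)%E); last first.
  by apply: eq_integral => t; rewrite inE/= in_itv/= andbT => t0; rewrite GF.
move=> ->; congr ereal_sup; apply/seteqP; split => _ [n _ <-]; exists n => //;
  by apply: eq_integral => t; rewrite inE/= in_itv/= => /andP[t0 _]; rewrite GF.
Qed.

(** Passing from the half-line to bounded intervals; all estimates are made on
    bounded intervals. *)
Lemma integrable_tail F (e : R) : mu.-integrable hl (EFin \o F) -> 0 < e ->
  exists2 T0, 0 <= T0 & forall T, T0 <= T -> `|prim F T - \int[mu]_(t in hl) F t| <= e.
Proof.
move=> iF e0; have inF := integrable_norm iF.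
have mF : measurable_fun hl F by have /integrableP[/measurable_EFinP] := iF.
have fin0 : (\int[mu]_(t in hl) (`|F t|)%:E \is a fin_num)%E by apply: integrable_fin_num.
have [n nP] : exists n : nat, \int[mu]_(t in hl) `|F t| - e < \int[mu]_(t in `[0, n.+1%:R]) `|F t|.
  have sE := half_line_integral_sup (fun t => normr_ge0 (F t)) (measurableT_comp (@normr_measurable _ _) mF).
  have : (\int[mu]_(x in `[0%R, +oo[) (`|F x|)%:E - e%:E < ereal_sup [set \int[mu]_(x in `[0%R, i.+1%:R]) (`|F x|)%:E | i in [set: nat]])%E.
    rewrite -sE lteBlDr// lteDl// lte_fin//.
  move=> /ereal_sup_gt[_ [n _ <-]] nP; exists n.
  have fn : (\int[mu]_(x in `[0%R, n.+1%:R]) (`|F x|)%:E \is a fin_num)%E.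
    apply: integrable_fin_num => //.
    apply: (@integrableS _ _ _ mu hl `[0%R, n.+1%:R]%classic _ mhl (measurable_itv _) _ inF).
    by move=> t /=; rewrite /half_line/= !in_itv/= andbT => /andP[].
  rewrite -lte_fin /Rintegral EFinB !fineK//.
exists n.+1%:R => // T nT.
have T0 : 0 <= T by apply: le_trans nT.
have sub (A : set R) : measurable A -> A `<=` hl -> mu.-integrable A (EFin \o F).
  by move=> mA As; exact: (@integrableS _ _ _ mu hl A _ mhl mA As iF).
rewrite distrC /prim Rintegral_itvB//.
apply: (le_trans (le_normr_Rintegral _ _)) => //.
  by apply: sub => // t; rewrite /half_line/= !in_itv/= !andbT => /ltW; exact: le_trans.
have -> : \int[mu]_(x in `]T, +oo[) `|F x| = \int[mu]_(x in hl) `|F x| - \int[mu]_(x in `[0, T]) `|F x|.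
  by rewrite Rintegral_itvB.
have : \int[mu]_(t in `[0, n.+1%:R]) `|F t| <= \int[mu]_(x in `[0, T]) `|F x|.
  have lnF : locint (fun t => `|F t|).
    by apply: locint_norm => T1; apply: sub => // t /=; rewrite /half_line/= !in_itv/= andbT => /andP[].
  by apply: (@prim_nd _ (fun t => `|F t|)).
by move=> JK; rewrite lerBlDr -lerBlDl; exact: le_trans (ltW nP) JK.
Qed.

Lemma sq_le_L2 f T : 0 <= T -> sq (fun t => Re (f t)) (fun t => Im (f t)) T <=
  Re (L2dot (L2class f) (L2class f)).
Proof.
move=> T0; rewrite L2dot_Re; apply/ler_addgt0Pr => e e0.
have [T1 T10 /(_ (Num.max T T1)) h] := integrable_tail (iRe f f) e0.
have [sf _ _] := L2fun_locint f.
have := h _; rewrite le_max lexx orbT => /(_ isT); rewrite ler_norml => /andP[_ h1].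
have : sq (fun t => Re (f t)) (fun t => Im (f t)) T <= sq (fun t => Re (f t)) (fun t => Im (f t)) (Num.max T T1).
  by apply: le_sq => //; rewrite le_max lexx.
by move: h1; rewrite /sq; lra.
Qed.

Lemma L2_le_sq f A : (forall T, 0 <= T -> sq (fun t => Re (f t)) (fun t => Im (f t)) T <= A) ->
  Re (L2dot (L2class f) (L2class f)) <= A.
Proof.
move=> fA; rewrite L2dot_Re; apply/ler_addgt0Pr => e e0.
have [T1 T10 /(_ T1 (lexx _))] := integrable_tail (iRe f f) e0.
by rewrite ler_norml => /andP[h1 _]; have := fA T1 T10; rewrite /sq; lra.
Qed.

Lemma lbm_meas_half (F : R -> R) : lbm F -> measurable_fun hl F.
Proof.
move=> lF; rewrite /half_line itv0y_bigcup0S; apply/measurable_fun_bigcup => // n.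
by have [] := lF n.+1%:R.
Qed.

Lemma square_integrable_sq (u1 u2 : R -> R) A : lbm u1 -> lbm u2 ->
  (forall T, 0 <= T -> sq u1 u2 T <= A) ->
  (fun t => u1 t +i* u2 t) \in @square_integrable R.
Proof.
move=> l1 l2 uA; apply/asboolP; split; first by split; exact: lbm_meas_half.
under eq_integral do rewrite normc2E /= !expr2.
rewrite /half_line half_line_integral_sup; last 2 first.
- by move=> t; rewrite -!expr2 addr_ge0 ?sqr_ge0.
- by apply: lbm_meas_half; apply: lbmD; exact: lbmM.
apply: (@le_lt_trans _ _ A%:E); last exact: ltry.
apply: ge_ereal_sup => _ [n _ <-].
have := uA n.+1%:R (ler0n _ _); rewrite -lee_fin /sq /prim /Rintegral fineK//.
apply: integrable_fin_num => //; exact: (sqint_locint (lbm_sqint l1 l2)).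
Qed.

End L2_inner_product.

(** * The maximal graph and its symmetric part *)

Section maximal_graph.
Context {R : realType}.
Local Notation mu := (@lebesgue_measure R).
Local Notation hl := (@half_line R).
Implicit Types (t T : R).
Variables p Q : R -> R.
Hypotheses (cp : {within hl, continuous p}) (cQ : {within hl, continuous Q}).

Let lp : lbm p := lbm_within cp.
Let lQ : lbm Q := lbm_within cQ.

(** The maximal operator with Dirichlet condition at 0: [D0] replaces [D0S], so that
    nothing is required at infinity. *)
Definition Gmax : set (L2 R * L2 R) := [set xy |
  exists f g : L2fun R, [/\ xy = (L2class f, L2class g), D0 p Q f & is_Hop p Q f g]].

Lemma complex_funE (f : R -> R[i]) : (fun t => Re (f t) +i* Im (f t)) = f.
Proof. by apply/funext => t; case: (f t). Qed.

Lemma Gmax_elim x y : Gmax (x, y) -> exists (f g : L2fun R) (w1 w2 : R -> R),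
  [/\ x = L2class f, y = L2class g, Re (f 0) = 0 /\ Im (f 0) = 0,
    qsol p Q (fun t => Re (f t)) w1 (fun t => Re (g t)) &
    qsol p Q (fun t => Im (f t)) w2 (fun t => Im (g t))].
Proof.
move=> [f [g [[-> ->] [_ _ f0 _] fg]]].
have [w1 [w2 [q1 q2]]] := hop_qsol cp cQ fg.
by exists f, g, w1, w2; split=> //; rewrite f0.
Qed.

Lemma D0_intro (f g : L2fun R) w1 w2 : f 0 = 0 ->
  qsol p Q (fun t => Re (f t)) w1 (fun t => Re (g t)) ->
  qsol p Q (fun t => Im (f t)) w2 (fun t => Im (g t)) -> D0 p Q f /\ is_Hop p Q f g.
Proof.
move=> f0 q1 q2; have [h _] := qsol_hop cp cQ q1 q2.
rewrite !complex_funE in h; split=> //; split.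
- by exists g.
- exact: L2fun_valP.
- exact: f0.
- by exists g; split=> //; exact: L2fun_valP.
Qed.

Lemma Gmax_intro (g : L2fun R) u1 w1 u2 w2 A : u1 0 = 0 -> u2 0 = 0 ->
  qsol p Q u1 w1 (fun t => Re (g t)) -> qsol p Q u2 w2 (fun t => Im (g t)) ->
  (forall T, 0 <= T -> sq u1 u2 T <= A) ->
  exists f : L2fun R, [/\ (f : R -> R[i]) = (fun t => u1 t +i* u2 t), D0 p Q f, is_Hop p Q f g &
    Gmax (L2class f, L2class g)].
Proof.
move=> u10 u20 q1 q2 uA; have [l1 _] := qsol_lbm q1; have [l2 _] := qsol_lbm q2.
pose f := L2Fun (square_integrable_sq l1 l2 uA).
have [Df hf] : D0 p Q f /\ is_Hop p Q f g.
  by apply: (@D0_intro f g w1 w2) => //=; rewrite /f/= u10 u20.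
by exists f; split=> //; exists f, g.
Qed.

Lemma Gmax0 : Gmax (0, 0).
Proof.
have z : qsol p Q (fun=> 0) (fun=> 0) (fun=> 0 : R).
  by split; apply: (eq_isprim (isprim_cst 0)) => // t _; ring.
have e0 : 0 = L2class (0 : L2fun R).
  by apply: (addrI (L2class 0)); rewrite addr0 -L2classD addr0.
have h T : 0 <= T -> sq (fun=> 0) (fun=> 0) T <= (0 : R).
  move=> T0; rewrite /sq (@eq_prim _ _ (fun=> 0)); first by rewrite prim_cst// mul0r.
  by move=> s _; ring.
have [f [fE _ _ G]] := @Gmax_intro (0 : L2fun R) _ _ _ _ 0 (erefl _) (erefl _) z z h.
suff fe : L2class f = 0 by move: G; rewrite fe -e0.
by rewrite e0; apply/L2classP; apply: aeW => t _; rewrite fE.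
Qed.

Lemma Gmax_lin (c : R[i]) x1 y1 x2 y2 : Gmax (x1, y1) -> Gmax (x2, y2) ->
  Gmax (c *: x1 + x2, c *: y1 + y2).
Proof.
move=> /Gmax_elim[f1 [g1 [w1 [z1 [-> -> [f10 f10'] q1 r1]]]]].
move=> /Gmax_elim[f2 [g2 [w2 [z2 [-> -> [f20 f20'] q2 r2]]]]].
have -> : c *: L2class f1 + L2class f2 = L2class (c *: f1 + f2) by rewrite L2classD L2classZ.
have -> : c *: L2class g1 + L2class g2 = L2class (c *: g1 + g2) by rewrite L2classD L2classZ.
have E (f g : L2fun R) t : (c *: f + g) t = c * f t + g t by [].
have ReE (f g : L2fun R) t : Re ((c *: f + g) t) = Re c * Re (f t) - Im c * Im (f t) + Re (g t).
  by rewrite E; case: c {E} => a b; case: (f t) => d e; case: (g t).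
have ImE (f g : L2fun R) t : Im ((c *: f + g) t) = Re c * Im (f t) + Im c * Re (f t) + Im (g t).
  by rewrite E; case: c {E ReE} => a b; case: (f t) => d e; case: (g t).
have q := qsolD (qsolB (qsolZ (Re c) q1) (qsolZ (Im c) r1)) q2.
have r := qsolD (qsolD (qsolZ (Re c) r1) (qsolZ (Im c) q1)) r2.
have e0 : (c *: f1 + f2) 0 = 0.
  apply/eqP; rewrite eq_complex /= ReE ImE f10 f10' f20 f20' !mulr0 subr0 !addr0.
  by rewrite eqxx.
have q' : qsol p Q (fun t => Re ((c *: f1 + f2) t)) (fun t => Re c * w1 t - Im c * z1 t + w2 t)
    (fun t => Re ((c *: g1 + g2) t)).
  by apply: (eq_qsol q) => t _ //; rewrite ReE.
have r' : qsol p Q (fun t => Im ((c *: f1 + f2) t)) (fun t => Re c * z1 t + Im c * w1 t + z2 t)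
    (fun t => Im ((c *: g1 + g2) t)).
  by apply: (eq_qsol r) => t _ //; rewrite ImE.
have [D h] := D0_intro e0 q' r'.
by exists (c *: f1 + f2), (c *: g1 + g2).
Qed.

(** Two functions that are right continuous and agree off a null set agree. *)
Lemma cont_deriv_unique (u w w' : R -> R[i]) t : is_cont_deriv u w ->
  is_cont_deriv u w' -> 0 <= t -> w t = w' t.
Proof.
have key (a b : R -> R) (N : set R) s : measurable N -> mu N = 0%E ->
    {within hl, continuous a} -> {within hl, continuous b} ->
    (forall t, 0 <= t -> ~ N t -> a t = b t) -> 0 <= s -> a s = b s.
  move=> mN N0 ca cb ab s0; apply/eqP; rewrite -subr_eq0 -normr_le0.
  apply/ler_addgt0Pr => e e0; rewrite add0r.
  have [d d0 dP] : exists2 d, 0 < d & forall t, s < t -> t < s + d ->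
      `|a t - a s| <= e / 2 /\ `|b t - b s| <= e / 2.
    have loc (f : R -> R) : {within hl, continuous f} -> exists2 d, 0 < d &
        forall t, s < t -> t < s + d -> `|f t - f s| <= e / 2.
      move=> cf; have e20 : 0 < e / 2 by rewrite divr_gt0.
      have : f x @[x --> s^'+] --> f s.
        move: s0; rewrite le_eqVlt => /predU1P[<-|s0].
          by have /continuous_within_itvcyP[] := cf.
        exact: cvg_at_right_filter (within_continuous_at cf s0).
      move=> /cvgrPdist_le/(_ _ e20)[d /= d0 dP]; exists d => // r sr rd.
      rewrite distrC; apply: dP => //=; rewrite distrC ger0_norm ?subr_ge0 ?(ltW sr)//.
      by rewrite ltrBlDl.
    have [d1 d10 h1] := loc _ ca; have [d2 d20 h2] := loc _ cb.
    exists (Num.min d1 d2); first by rewrite lt_min d10.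
    move=> r sr rd; split; [apply: h1|apply: h2] => //; apply: (lt_le_trans rd);
      by rewrite lerD2l ge_min lexx ?orbT.
  have [r [sr rd Nr]] : exists r, [/\ s < r, r < s + d & ~ N r].
    apply: contrapT => h.
    have sub : `]s, s + d[ `<=` N.
      move=> r /=; rewrite in_itv/= => /andP[sr rd]; apply: contrapT => Nr.
      by apply: h; exists r.
    have : (lebesgue_measure `]s, (s + d)%R[%classic <= lebesgue_measure N)%E.
      by apply: le_measure; rewrite ?inE.
    have e1 : lebesgue_measure N = 0%E := N0.
    rewrite e1 lebesgue_measure_itv/= lte_fin ltrDl d0 -EFinB lee_fin.
    by rewrite addrAC subrr add0r leNgt d0.
  have [h1 h2] := dP r sr rd.
  rewrite -(ab r) // in h2; last by rewrite (le_trans s0)// ltW.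
  have -> : a s - b s = (a r - b s) - (a r - a s) by ring.
  by rewrite (le_trans (ler_normB _ _))//; lra.
move=> [cr ci aw] [cr' ci' aw'] t0.
have [N [mN N0 sub]] := negligibleU aw aw'.
have good s : 0 <= s -> ~ N s -> has_cderiv u s (w s) /\ has_cderiv u s (w' s).
  move=> s0 Ns; split; apply: contrapT => h; apply: Ns; apply: sub; [left|right] => /=;
    by move=> /(_ s0).
have h1 : Re (w t) = Re (w' t).
  apply: (key (fun t => Re (w t)) (fun t => Re (w' t)) N) => // s s0 Ns; have [[[_ h] _] [[_ h'] _]] := good s s0 Ns.
  by rewrite -h -h'.
have h2 : Im (w t) = Im (w' t).
  apply: (key (fun t => Im (w t)) (fun t => Im (w' t)) N) => // s s0 Ns; have [[_ [_ h]] [_ [_ h']]] := good s s0 Ns.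
  by rewrite -h -h'.
by move: h1 h2; case: (w t) => a b; case: (w' t) => c d /= -> ->.
Qed.

Lemma cont_derivE (f : R -> R[i]) w1 w2 v1 v2 t :
  qsol p Q (fun t => Re (f t)) w1 v1 -> qsol p Q (fun t => Im (f t)) w2 v2 -> 0 <= t ->
  cont_deriv f t = (w1 t + Q t * Re (f t)) +i* (w2 t + Q t * Im (f t)).
Proof.
move=> q1 q2 t0; have [_ h] := qsol_hop cp cQ q1 q2; rewrite complex_funE in h.
by apply: (cont_deriv_unique _ h t0); rewrite /cont_deriv; apply: xgetPex; exists (fun t => (w1 t + Q t * Re (f t)) +i* (w2 t + Q t * Im (f t))).
Qed.

Definition rwronskian (u w u' w' : R -> R) t : R := u t * w' t - w t * u' t.

Lemma wronskianE (f g : R -> R[i]) w1 w2 v1 v2 z1 z2 y1 y2 t :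
  qsol p Q (fun t => Re (f t)) w1 v1 -> qsol p Q (fun t => Im (f t)) w2 v2 ->
  qsol p Q (fun t => Re (g t)) z1 y1 -> qsol p Q (fun t => Im (g t)) z2 y2 -> 0 <= t ->
  wronskian f g t =
  (rwronskian (fun t => Re (f t)) w1 (fun t => Re (g t)) z1 t -
   rwronskian (fun t => Im (f t)) w2 (fun t => Im (g t)) z2 t) +i*
  (rwronskian (fun t => Re (f t)) w1 (fun t => Im (g t)) z2 t +
   rwronskian (fun t => Im (f t)) w2 (fun t => Re (g t)) z1 t).
Proof.
move=> q1 q2 r1 r2 t0; rewrite /wronskian (cont_derivE q1 q2 t0) (cont_derivE r1 r2 t0).
by rewrite /rwronskian; case: (f t) => a b; case: (g t) => c d /=; congr Complex; ring.
Qed.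

(** Green's formula on the half-line: the boundary term at [T] is within [e] of the
    defect of symmetry [D], for all large [T]. *)
Lemma green (f g a b : L2fun R) w1 w2 z1 z2 (e : R) :
  f 0 = 0 -> a 0 = 0 ->
  qsol p Q (fun t => Re (f t)) w1 (fun t => Re (g t)) ->
  qsol p Q (fun t => Im (f t)) w2 (fun t => Im (g t)) ->
  qsol p Q (fun t => Re (a t)) z1 (fun t => Re (b t)) ->
  qsol p Q (fun t => Im (a t)) z2 (fun t => Im (b t)) -> 0 < e ->
  exists T0, 0 <= T0 /\ forall T, T0 <= T ->
  let D := L2dot (L2class g) (L2class a) - L2dot (L2class f) (L2class b) in
  `|rwronskian (fun t => Re (f t)) w1 (fun t => Re (a t)) z1 T +
    rwronskian (fun t => Im (f t)) w2 (fun t => Im (a t)) z2 T - Re D| <= e /\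
  `|rwronskian (fun t => Im (f t)) w2 (fun t => Re (a t)) z1 T -
    rwronskian (fun t => Re (f t)) w1 (fun t => Im (a t)) z2 T - Im D| <= e.
Proof.
move=> f0 a0 q1 q2 r1 r2 e0.
have [mf1 mf2] := L2fun_msq f; have [mg1 mg2] := L2fun_msq g.
have [ma1 ma2] := L2fun_msq a; have [mb1 mb2] := L2fun_msq b.
have mhl := @measurable_half_line R.
pose F1 t := Re (g t) * Re (a t) + Im (g t) * Im (a t) - (Re (f t) * Re (b t) + Im (f t) * Im (b t)).
pose F2 t := Im (g t) * Re (a t) - Re (g t) * Im (a t) - (Im (f t) * Re (b t) - Re (f t) * Im (b t)).
have iD (F G : R -> R) : mu.-integrable hl (EFin \o F) -> mu.-integrable hl (EFin \o G) ->
    mu.-integrable hl (EFin \o (fun t => F t + G t)).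
  by move=> iF iG; have := @integrableD _ _ _ mu _ mhl _ _ iF iG; exact.
have iB (F G : R -> R) : mu.-integrable hl (EFin \o F) -> mu.-integrable hl (EFin \o G) ->
    mu.-integrable hl (EFin \o (fun t => F t - G t)).
  by move=> iF iG; have := @integrableB _ _ _ mu _ mhl _ _ iF iG; exact.
have i1 := iD _ _ (msq_mul mg1 ma1) (msq_mul mg2 ma2).
have i2 := iD _ _ (msq_mul mf1 mb1) (msq_mul mf2 mb2).
have i3 := iB _ _ (msq_mul mg2 ma1) (msq_mul mg1 ma2).
have i4 := iB _ _ (msq_mul mf2 mb1) (msq_mul mf1 mb2).
have iF1 : mu.-integrable hl (EFin \o F1) := iB _ _ i1 i2.
have iF2 : mu.-integrable hl (EFin \o F2) := iB _ _ i3 i4.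
have [T1 T10 h1] := integrable_tail iF1 e0.
have [T2 T20 h2] := integrable_tail iF2 e0.
exists (Num.max T1 T2); split; first by rewrite le_max T10.
move=> T; rewrite ge_max => /andP[T1T T2T] D.
have T0 := le_trans T10 T1T.
have eF1 : \int[mu]_(t in hl) F1 t = Re D by rewrite /F1 RintegralB// /D !L2dot_fun.
have eF2 : \int[mu]_(t in hl) F2 t = Im D by rewrite /F2 RintegralB// /D !L2dot_fun.
have [l11 e11] := qsol_lagrange q1 r1; have [l22 e22] := qsol_lagrange q2 r2.
have [l21 e21] := qsol_lagrange q2 r1; have [l12 e12] := qsol_lagrange q1 r2.
rewrite -eF1 -eF2 /rwronskian e11// e22// e21// e12// f0 a0 /= !(mul0r, mulr0) !subrr !add0r.
rewrite -primD// -primB//; split.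
- rewrite (@eq_prim _ _ F1); first exact: h1.
  by move=> s _; rewrite /F1; ring.
- rewrite (@eq_prim _ _ F2); first exact: h2.
  by move=> s _; rewrite /F2; ring.
Qed.

(** The bracket [[u, v]] of the definition is bilinear while the inner product is
    sesquilinear; complex conjugation, which commutes with [H], reconciles them. *)
Lemma conj_D0 (g b : L2fun R) w1 w2 : g 0 = 0 ->
  qsol p Q (fun t => Re (g t)) w1 (fun t => Re (b t)) ->
  qsol p Q (fun t => Im (g t)) w2 (fun t => Im (b t)) ->
  exists g' b' : L2fun R, [/\ (g' : R -> R[i]) = (fun t => conjc (g t)), D0 p Q g',
    is_Hop p Q g' b', qsol p Q (fun t => Re (g' t)) w1 (fun t => Re (b' t)) &
    qsol p Q (fun t => Im (g' t)) (fun t => -1 * w2 t) (fun t => Im (b' t))].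
Proof.
move=> g0 q1 q2.
have conjP (f : L2fun R) : (fun t => conjc (f t)) \in @square_integrable R.
  have /asboolP[[m1 m2] fin] := L2fun_valP f.
  apply/asboolP; split.
    split; [rewrite (_ : (fun t => _) = (fun t => Re (f t)))//|
            rewrite (_ : (fun t => _) = (fun t => - Im (f t)))].
    - by apply/funext => t; case: (f t).
    - exact: measurableT_comp.
    - by apply/funext => t; case: (f t).
  have nC (z : R[i]) : normc (conjc z) = normc z by case: z => c d /=; rewrite sqrrN.
  by under eq_integral do rewrite nC.
pose g' := L2Fun (conjP g); pose b' := L2Fun (conjP b).
have R1 (f : L2fun R) t : Re (conjc (f t)) = Re (f t) by case: (f t).
have I1 (f : L2fun R) t : Im (conjc (f t)) = -1 * Im (f t) by case: (f t) => c d /=; ring.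
have q1' : qsol p Q (fun t => Re (g' t)) w1 (fun t => Re (b' t)).
  by apply: (eq_qsol q1) => t _ //; rewrite /g' /b' /= R1.
have q2' : qsol p Q (fun t => Im (g' t)) (fun t => -1 * w2 t) (fun t => Im (b' t)).
  by apply: (eq_qsol (qsolZ (-1) q2)) => t _ //; rewrite /g' /b' /= I1.
have g'0 : g' 0 = 0 by rewrite /g' /= g0; congr Complex; rewrite oppr0.
have [D h] := D0_intro g'0 q1' q2'.
by exists g', b'.
Qed.

End maximal_graph.

Section symmetric_realization.
Context {R : realType}.
Local Notation mu := (@lebesgue_measure R).
Local Notation hl := (@half_line R).
Implicit Types (t T : R).
Variables p Q : R -> R.
Hypotheses (cp : {within hl, continuous p}) (cQ : {within hl, continuous Q}).

Let lp : lbm p := lbm_within cp.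
Let lQ : lbm Q := lbm_within cQ.

Lemma rwronskianNr (u w u' w' : R -> R) (a b : R -> R) t :
  (forall s, a s = -1 * u' s) -> (forall s, b s = -1 * w' s) ->
  rwronskian u w a b t = - rwronskian u w u' w' t.
Proof. by move=> ea eb; rewrite /rwronskian ea eb; ring. Qed.

Lemma complex_eq0_small (D : R[i]) :
  (forall e : R, 0 < e -> `|Re D| <= e /\ `|Im D| <= e) -> D = 0.
Proof.
move=> h; apply: dot_small0 => e e0; have e20 : 0 < e / 2 by rewrite divr_gt0.
by have [h1 h2] := h _ e20; rewrite (le_trans (normc_le _))//; lra.
Qed.

(** The boundary condition at infinity says exactly that Green's formula has no
    boundary term against any element of the maximal domain. *)
Lemma H0S_symmetric_part : H0S p Q = symmetric_part L2dot (Gmax p Q).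
Proof.
apply/seteqP; split=> [_ [f [g [-> [Df Wf] fg]]]|[x y] [Gxy sym]].
  split; first by exists f, g.
  move=> [x y] /(Gmax_elim cp cQ)[a [b [z1 [z2 [-> -> [a1 a2] r1 r2]]]]] /=.
  have [w1 [w2 [q1 q2]]] := hop_qsol cp cQ fg.
  have f0 : f 0 = 0 by case: Df.
  have a0 : a 0 = 0 by apply/eqP; rewrite eq_complex /= a1 a2 eqxx.
  have [a' [b' [a'E Da' _ r1' r2']]] := conj_D0 cp cQ a0 r1 r2.
  apply/eqP; rewrite -subr_eq0; apply/eqP; apply: complex_eq0_small => e e0.
  have e20 : 0 < e / 2 by rewrite divr_gt0.
  have [T0 [T00 TP]] := green f0 a0 q1 q2 r1 r2 e20.
  have /cvgrPdist_le/(_ _ e20)[M [_ MP]] := Wf _ Da'.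
  pose T := Num.max T0 (M + 1).
  have TM : M < T by rewrite lt_max ltrDl ltr01 orbT.
  have TT : 0 <= T by rewrite le_max T00.
  have := TP T; rewrite le_max lexx => /(_ isT)[h1 h2].
  have := MP T TM; rewrite /= sub0r normrN (wronskianE cp cQ q1 q2 r1' r2' TT) => h3.
  have {}h3 : normc ((rwronskian (fun t => Re (f t)) w1 (fun t => Re (a t)) z1 T +
       rwronskian (fun t => Im (f t)) w2 (fun t => Im (a t)) z2 T) +i*
      (rwronskian (fun t => Im (f t)) w2 (fun t => Re (a t)) z1 T -
      rwronskian (fun t => Re (f t)) w1 (fun t => Im (a t)) z2 T)) <= e / 2.
    apply: le_trans h3; apply: le_trans (ler_norm _).
    have Ra s : Re (a' s) = Re (a s) by rewrite a'E; case: (a s).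
    have Ia s : Im (a' s) = -1 * Im (a s) by rewrite a'E; case: (a s) => c d /=; ring.
    have -> : (fun t => Re (a' t)) = (fun t => Re (a t)) by apply/funext.
    rewrite (@rwronskianNr _ _ (fun t => Im (a t)) z2 (fun t => Im (a' t)))//.
    rewrite (@rwronskianNr _ _ (fun t => Im (a t)) z2 (fun t => Im (a' t)))//.
    by rewrite opprK addrC [X in _ +i* X]addrC le_eqVlt; apply/orP; left; apply/eqP; congr normc; congr Complex; rewrite addrC.
  have h4 := le_trans (Re_le_normc _) h3; have h5 := le_trans (Im_le_normc _) h3.
  move: h1 h2 h4 h5 => /=; rewrite !ler_norml.
  move=> /andP[? ?] /andP[? ?] /andP[? ?] /andP[? ?]; split; apply/andP; split; lra.
have [f [g [e Df fg]]] := Gxy; exists f, g; split=> //; split=> // v [_ sv v0 [b [vb sb]]].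
move: e sym => [-> ->] sym.
have [w1 [w2 [q1 q2]]] := hop_qsol cp cQ fg.
have [z1 [z2 [r1 r2]]] := hop_qsol cp cQ vb.
have f0 : f 0 = 0 by case: Df.
have [a' [b' [a'E Da' hb' r1' r2']]] := @conj_D0 _ _ _ cp cQ (L2Fun sv) (L2Fun sb) _ _ v0 r1 r2.
have a'0 : a' 0 = 0 by case: Da'.
have D0 : L2dot (L2class g) (L2class a') - L2dot (L2class f) (L2class b') = 0.
  by have := sym (L2class a', L2class b'); rewrite /= => ->; [rewrite subrr|exists a', b'].
apply/cvgrPdist_le => e e0; have e20 : 0 < e / 2 by rewrite divr_gt0.
have [T0 [T00 TP]] := green f0 a'0 q1 q2 r1' r2' e20.
exists T0; split; first exact: num_real.
move=> T T0T; rewrite sub0r normrN ger0_norm; last by case: (wronskian _ _ _) => ? ?; exact: sqrtr_ge0.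
have [] := TP T (ltW T0T); rewrite D0 /= !subr0.
rewrite (wronskianE cp cQ q1 q2 r1 r2); last exact: le_trans T00 (ltW T0T).
have Ra s : Re (a' s) = Re (v s) by rewrite a'E /=; case: (v s).
have Ia s : Im (a' s) = -1 * Im (v s) by rewrite a'E /=; case: (v s) => c d /=; ring.
have -> : (fun t => Re (a' t)) = (fun t => Re (v t)) by apply/funext.
rewrite (@rwronskianNr _ _ (fun t => Im (v t)) z2 (fun t => Im (a' t)))//.
rewrite (@rwronskianNr _ _ (fun t => Im (v t)) z2 (fun t => Im (a' t)))//.
rewrite opprK => h1 h2; apply: (le_trans (normc_le _)); rewrite /= [X in _ + `|X|]addrC.
by rewrite (_ : e = e / 2 + e / 2); [exact: lerD|field].
Qed.

Section limit_point.
Variables (Qt q : R -> R) (C : R).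
Hypotheses (pQt : isprim Qt q) (C0 : 0 <= C).
Hypothesis confining :
  forall t, 0 <= t -> t / 2 - C <= p t + q t - 2 * (Q t - Qt t) ^+ 2.

Lemma qsol_derivative_bound u w v A B : qsol p Q u w v -> u 0 = 0 ->
  locint (fun t => v t * v t) ->
  (forall t, 0 <= t -> prim (fun t => u t * u t) t <= A) ->
  (forall t, 0 <= t -> prim (fun t => v t * v t) t <= B) ->
  forall T, 0 <= T -> prim (fun t => (w t + Q t * u t) ^+ 2) T <= 16 * ((C + 3) * A + B).
Proof.
move=> qs u0 lvv uA vB T T0; apply: le_trans (qsol_apriori lp lQ pQt C0 confining qs u0 lvv uA vB T0).
have [lu lw] := qsol_lbm qs.
have l1 : lbm (fun t => (w t + Q t * u t) ^+ 2).
  by apply: lbm_sqr; apply: lbmD => //; exact: lbmM.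
apply: le_prim; first exact: lbm_locint.
  exact: lbm_locint (lbmD l1 (lbmM (@lbm_id R) (lbmM lu lu))).
by move=> s /andP[s0 _]; rewrite lerDl mulr_ge0// -expr2 sqr_ge0.
Qed.

(** Replacing the quasi-derivatives by the derivatives does not change the
    Wronskian, and [u], [u'], [a], [a'] are square integrable. *)
Lemma rwronskian_integrable u w v a z b A1 B1 A2 B2 :
  qsol p Q u w v -> u 0 = 0 -> locint (fun t => v t * v t) ->
  (forall t, 0 <= t -> prim (fun t => u t * u t) t <= A1) ->
  (forall t, 0 <= t -> prim (fun t => v t * v t) t <= B1) ->
  qsol p Q a z b -> a 0 = 0 -> locint (fun t => b t * b t) ->
  (forall t, 0 <= t -> prim (fun t => a t * a t) t <= A2) ->
  (forall t, 0 <= t -> prim (fun t => b t * b t) t <= B2) ->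
  lbm (rwronskian u w a z) /\ exists B, forall T, 0 <= T ->
    prim (fun t => `|rwronskian u w a z t|) T <= B.
Proof.
move=> q1 u0 lvv uA vB q2 a0 lbb aA bB.
have [lu lw] := qsol_lbm q1; have [la lz] := qsol_lbm q2.
have lW : lbm (rwronskian u w a z) by apply: lbmB; exact: lbmM.
split=> //; have h1 := qsol_derivative_bound q1 u0 lvv uA vB.
have h2 := qsol_derivative_bound q2 a0 lbb aA bB.
exists (A1 + A2 + (16 * ((C + 3) * A1 + B1) + 16 * ((C + 3) * A2 + B2))) => T T0.
have l1 : locint (fun t => (w t + Q t * u t) ^+ 2).
  by apply: lbm_locint; apply: lbm_sqr; apply: lbmD => //; exact: lbmM.
have l2 : locint (fun t => (z t + Q t * a t) ^+ 2).
  by apply: lbm_locint; apply: lbm_sqr; apply: lbmD => //; exact: lbmM.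
have l3 : locint (fun t => u t * u t) by apply: lbm_locint; exact: lbmM.
have l4 : locint (fun t => a t * a t) by apply: lbm_locint; exact: lbmM.
apply: le_trans (lerD (lerD (uA T T0) (aA T T0)) (lerD (h1 T T0) (h2 T T0))).
rewrite -!primD//; last 2 first.
- exact: locintD.
- exact: locintD.
apply: le_prim; first exact: locint_norm (lbm_locint lW).
  by apply: locintD; exact: locintD.
move=> s _; set U := w s + Q s * u s; set Z := z s + Q s * a s.
have -> : rwronskian u w a z s = u s * Z - U * a s by rewrite /rwronskian /U /Z; ring.
have := sqr_ge0 (u s - Z); have := sqr_ge0 (u s + Z).
have := sqr_ge0 (U - a s); have := sqr_ge0 (U + a s).
have := sqr_ge0 (u s); have := sqr_ge0 Z; have := sqr_ge0 U; have := sqr_ge0 (a s).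
rewrite ler_norml; move: (u s) Z U (a s) => c d e f0.
by move=> *; apply/andP; split; nra.
Qed.

(** Limit point case at infinity: by the a priori bound the Wronskian is integrable;
    by Green's formula it has a limit, the defect of symmetry, which is thus 0. *)
Lemma Gmax_symmetric x y a b : Gmax p Q (x, y) -> Gmax p Q (a, b) ->
  L2dot y a = L2dot x b.
Proof.
move=> /(Gmax_elim cp cQ)[f [g [w1 [w2 [-> -> [f1 f2] q1 q2]]]]].
move=> /(Gmax_elim cp cQ)[{}a [{}b [z1 [z2 [-> -> [a1 a2] r1 r2]]]]].
have f0 : f 0 = 0 by apply/eqP; rewrite eq_complex /= f1 f2 eqxx.
have a0 : a 0 = 0 by apply/eqP; rewrite eq_complex /= a1 a2 eqxx.
set D := L2dot (L2class g) (L2class a) - L2dot (L2class f) (L2class b).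
have bound (h : L2fun R) : [/\ locint (fun t => Re (h t) * Re (h t)), locint (fun t => Im (h t) * Im (h t)),
    forall t, 0 <= t -> prim (fun t => Re (h t) * Re (h t)) t <= Re (L2dot (L2class h) (L2class h)) &
    forall t, 0 <= t -> prim (fun t => Im (h t) * Im (h t)) t <= Re (L2dot (L2class h) (L2class h))].
  have [[l1 l2] _ _] := L2fun_locint h.
  have pos (F : R -> R) t : 0 <= prim (fun t => F t * F t) t.
    by apply: prim_ge0 => s _; rewrite -expr2 sqr_ge0.
  split=> // t t0; apply: le_trans (sq_le_L2 h t0); rewrite sqE//.
    by rewrite lerDl; exact: (pos (fun t => Im (h t))).
  by rewrite lerDr; exact: (pos (fun t => Re (h t))).
have [_ _ bf1 bf2] := bound f; have [lg1 lg2 bg1 bg2] := bound g.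
have [_ _ ba1 ba2] := bound a; have [lb1 lb2 bb1 bb2] := bound b.
have [l11 [B11 h11]] := rwronskian_integrable q1 f1 lg1 bf1 bg1 r1 a1 lb1 ba1 bb1.
have [l22 [B22 h22]] := rwronskian_integrable q2 f2 lg2 bf2 bg2 r2 a2 lb2 ba2 bb2.
have [l21 [B21 h21]] := rwronskian_integrable q2 f2 lg2 bf2 bg2 r1 a1 lb1 ba1 bb1.
have [l12 [B12 h12]] := rwronskian_integrable q1 f1 lg1 bf1 bg1 r2 a2 lb2 ba2 bb2.
have nle (F G : R -> R) B1 B2 : lbm F -> lbm G ->
    (forall T, 0 <= T -> prim (fun t => `|F t|) T <= B1) ->
    (forall T, 0 <= T -> prim (fun t => `|G t|) T <= B2) ->
    (forall T, 0 <= T -> prim (fun t => `|F t + G t|) T <= B1 + B2) /\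
    (forall T, 0 <= T -> prim (fun t => `|F t - G t|) T <= B1 + B2).
  move=> lF lG hF hG.
  have nF := lbm_locint (lbm_norm lF); have nG := lbm_locint (lbm_norm lG).
  split=> T T0; apply: le_trans (lerD (hF T T0) (hG T T0)); rewrite -primD//; apply: le_prim.
  - exact: lbm_locint (lbm_norm (lbmD lF lG)).
  - exact: locintD.
  - by move=> s _; exact: ler_normD.
  - exact: lbm_locint (lbm_norm (lbmB lF lG)).
  - exact: locintD.
  - by move=> s _; exact: ler_normB.
have ReD : Re D = 0.
  apply: (integrable_limit0 (lbm_locint (lbmD l11 l22)) (nle _ _ _ _ l11 l22 h11 h22).1).
  by move=> e e0; have [T0 [_ TP]] := green f0 a0 q1 q2 r1 r2 e0; exists T0 => t /TP[].
have ImD : Im D = 0.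
  apply: (integrable_limit0 (lbm_locint (lbmB l21 l12)) (nle _ _ _ _ l21 l12 h21 h12).2).
  by move=> e e0; have [T0 [_ TP]] := green f0 a0 q1 q2 r1 r2 e0; exists T0 => t /TP[].
apply/eqP; rewrite -subr_eq0 -/D; move: ReD ImD; case: D => c d /= -> ->.
by [].
Qed.

Lemma H0S_Gmax : H0S p Q = Gmax p Q.
Proof.
rewrite H0S_symmetric_part; apply/seteqP; split=> [x []//|[x y] Gxy]; split=> //.
by move=> [a b] Gab /=; exact: Gmax_symmetric.
Qed.

End limit_point.

End symmetric_realization.

(** * Closedness of the maximal graph *)

Section closedness.
Context {R : realType}.
Local Notation mu := (@lebesgue_measure R).
Local Notation hl := (@half_line R).
Implicit Types (t T : R).
Variables p Q : R -> R.
Hypotheses (cp : {within hl, continuous p}) (cQ : {within hl, continuous Q}).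

Let lp : lbm p := lbm_within cp.
Let lQ : lbm Q := lbm_within cQ.

Lemma L2fun_sqint_sub (f : L2fun R) u1 u2 : lbm u1 -> lbm u2 ->
  sqint (fun t => Re (f t) - u1 t) (fun t => Im (f t) - u2 t).
Proof.
move=> l1 l2; have [[s1 s2] m1 m2] := L2fun_locint f.
split.
  by have := locint_sqrD (lbmN l1) m1 s1; congr locint; apply/funext => t; ring.
by have := locint_sqrD (lbmN l2) m2 s2; congr locint; apply/funext => t; ring.
Qed.

Lemma L2fun_subE (f g : L2fun R) t :
  Re ((f - g) t) = Re (f t) - Re (g t) /\ Im ((f - g) t) = Im (f t) - Im (g t).
Proof.
have -> : (f - g) t = f t - g t by [].
by case: (f t); case: (g t).
Qed.

Lemma L2class_sub (f g : L2fun R) : L2class f - L2class g = L2class (f - g).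
Proof.
rewrite -[- L2class g]scaleN1r.
have -> : -1 *: L2class g = L2class (-1 *: g) by rewrite L2classZ.
by rewrite -L2classD scaleN1r.
Qed.

Lemma sq_dist (f g : L2fun R) T : 0 <= T ->
  sq (fun t => Re (f t) - Re (g t)) (fun t => Im (f t) - Im (g t)) T <=
  dot_norm L2dot (L2class f - L2class g) ^+ 2.
Proof.
move=> T0; rewrite (dot_normE (@L2dot_ge0 R)) L2class_sub.
apply: le_trans (sq_le_L2 (f - g) T0); rewrite le_eqVlt; apply/orP; left; apply/eqP.
by apply: eq_prim => s _; have [-> ->] := L2fun_subE f g s.
Qed.

Lemma L2class_eq (f g : L2fun R) :
  (forall T, 0 <= T -> sq (fun t => Re (f t) - Re (g t)) (fun t => Im (f t) - Im (g t)) T <= 0) ->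
  L2class f = L2class g.
Proof.
move=> h; apply/eqP; rewrite -subr_eq0 L2class_sub; apply/eqP.
apply: L2dot_eq0; apply/eqP; rewrite eq_le L2dot_ge0 andbT.
apply: L2_le_sq => T T0; apply: le_trans (h T T0); rewrite le_eqVlt; apply/orP; left; apply/eqP.
by apply: eq_prim => s _; have [-> ->] := L2fun_subE f g s.
Qed.

(** Let [s] solve [H s = g] with vanishing initial data.  Elements [(a, b)] of the
    graph close to [(f, g)] are close to [s] plus a multiple of [phi] on bounded
    intervals; the multiples form a Cauchy sequence since [phi] has positive mass
    on [[0, 1]], and so [f = s + l phi] for their limit [l]. *)
Lemma Gmax_closed : closed_operator L2dot (Gmax p Q).
Proof.
move=> x y h; have [f xf] := L2class_surj x; have [g yg] := L2class_surj y.
rewrite {}xf {}yg in h *.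
have z0 : locint (fun=> 0 : R) := locint_cst 0.
have [ph1 [ze1 [ph2 [ze2 [phP ph10 ph20 ze10 ze20]]]]] := zsol_exists lp lQ 0 0 1 0 z0 z0.
have [sg lg1 lg2] := L2fun_locint g; have [sf lf1 lf2] := L2fun_locint f.
have [s1 [z1 [s2 [z2 [sP s10 s20 z10 z20]]]]] := zsol_exists lp lQ 0 0 0 0 lg1 lg2.
have [lph1 lph2] : lbm ph1 /\ lbm ph2 by have [/qsol_lbm[? _] /qsol_lbm[? _]] := phP.
have [ls1 ls2] : lbm s1 /\ lbm s2 by have [/qsol_lbm[? _] /qsol_lbm[? _]] := sP.
pose c1 a1 a2 t := s1 t + (a1 * ph1 t - a2 * ph2 t).
pose c2 a1 a2 t := s2 t + (a1 * ph2 t + a2 * ph1 t).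
have cl a1 a2 : lbm (c1 a1 a2) /\ lbm (c2 a1 a2).
  split; apply: lbmD => //; [apply: lbmB|apply: lbmD]; apply: lbmM => //; exact: lbm_cst.
pose d a1 a2 T := sq (fun t => Re (f t) - c1 a1 a2 t) (fun t => Im (f t) - c2 a1 a2 t) T.
have sd a1 a2 : sqint (fun t => Re (f t) - c1 a1 a2 t) (fun t => Im (f t) - c2 a1 a2 t).
  by have [? ?] := cl a1 a2; exact: L2fun_sqint_sub.
pose e (n : nat) : R := 2^-1 ^+ n.
have e0 n : 0 < e n by rewrite exprn_gt0// invr_gt0.
have approx n : exists a : R * R, forall T C, 0 <= T -> 0 <= C ->
   (forall u1 w1 u2 w2 g1 g2, zsol p Q 0 0 u1 w1 u2 w2 g1 g2 ->
     u1 0 = 0 -> u2 0 = 0 -> sqint g1 g2 ->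
     sq (fun t => u1 t - (w1 0 * ph1 t - w2 0 * ph2 t))
        (fun t => u2 t - (w1 0 * ph2 t + w2 0 * ph1 t)) T <= C * sq g1 g2 T) ->
   d a.1 a.2 T <= 2 * (1 + C) * e n ^+ 2.
  have [A [B [GAB fA gB]]] := h _ (e0 n).
  have [a [b [w1 [w2 [aA bB [a10 a20] q1 q2]]]]] := Gmax_elim cp cQ GAB.
  rewrite {}aA {}bB in fA gB GAB.
  exists (w1 0, w2 0) => T C T0 C0 CP /=.
  have [la1 _] := qsol_lbm q1; have [la2 _] := qsol_lbm q2.
  have zP : zsol p Q 0 0 (fun t => Re (a t) - s1 t) (fun t => w1 t - z1 t)
     (fun t => Im (a t) - s2 t) (fun t => w2 t - z2 t)
     (fun t => Re (b t) - Re (g t)) (fun t => Im (b t) - Im (g t)).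
    have [qs1 qs2] := sP; split.
      by apply: (eq_qsol (qsolB q1 qs1)) => // t _; ring.
    by apply: (eq_qsol (qsolB q2 qs2)) => // t _; ring.
  have sbg : sqint (fun t => Re (b t) - Re (g t)) (fun t => Im (b t) - Im (g t)).
    have [[m1 m2] _ _] := L2fun_locint (b - g).
    split; [move: m1|move: m2]; congr locint; apply/funext => t; by have [e1 e2] := L2fun_subE b g t; rewrite ?e1 ?e2.
  have := CP _ _ _ _ _ _ zP; rewrite z10 z20 !subr0 s10 a10 s20 a20 !subr0.
  move=> /(_ erefl erefl sbg) E.
  have gT : sq (fun t => Re (b t) - Re (g t)) (fun t => Im (b t) - Im (g t)) T <= e n ^+ 2.
    rewrite sq_sym; apply: (le_trans (sq_dist g b T0)).
    by rewrite lerXn2r ?nnegrE ?dot_norm_ge0// ltW.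
  have fT : sq (fun t => Re (f t) - Re (a t)) (fun t => Im (f t) - Im (a t)) T <= e n ^+ 2.
    apply: (le_trans (sq_dist f a T0)).
    by rewrite lerXn2r ?nnegrE ?dot_norm_ge0// ltW.
  have sfa : sqint (fun t => Re (f t) - Re (a t)) (fun t => Im (f t) - Im (a t)).
    exact: L2fun_sqint_sub.
  have sx : sqint (fun t => Re (f t) - c1 (w1 0) (w2 0) t - (Re (f t) - Re (a t)))
     (fun t => Im (f t) - c2 (w1 0) (w2 0) t - (Im (f t) - Im (a t))).
    have := lbm_sqint (lbmB la1 (cl (w1 0) (w2 0)).1) (lbmB la2 (cl (w1 0) (w2 0)).2).
    by congr sqint; apply/funext => t; ring.
  apply: (le_trans (sq_split T (sd (w1 0) (w2 0)) sfa sx)).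
  have -> : sq (fun t => Re (f t) - c1 (w1 0) (w2 0) t - (Re (f t) - Re (a t)))
     (fun t => Im (f t) - c2 (w1 0) (w2 0) t - (Im (f t) - Im (a t))) T =
     sq (fun t => Re (a t) - s1 t - (w1 0 * ph1 t - w2 0 * ph2 t))
        (fun t => Im (a t) - s2 t - (w1 0 * ph2 t + w2 0 * ph1 t)) T.
    by apply: eq_prim => t _; rewrite /c1 /c2; ring.
  have : C * sq (fun t => Re (b t) - Re (g t)) (fun t => Im (b t) - Im (g t)) T <= C * e n ^+ 2.
    by rewrite ler_wpM2l.
  rewrite (_ : 2 * (1 + C) * e n ^+ 2 = 2 * e n ^+ 2 + 2 * (C * e n ^+ 2)); last by ring.
  move: (C * e n ^+ 2) (e n ^+ 2) E fT => c0 e' E fT h1; lra.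
have [a aP] := choice approx.
have bnd T : 0 <= T -> exists2 K, 0 <= K & forall n, d (a n).1 (a n).2 T <= K * e n ^+ 2.
  move=> T0; have [C C0 CP] := zsol_decomp lp lQ phP ph10 ph20 ze10 ze20 T0.
  by exists (2 * (1 + C)) => [|n]; [rewrite mulr_ge0// addr_ge0|exact: aP].
have sph := lbm_sqint lph1 lph2.
have diff a1 a2 b1 b2 T : ((a1 - b1) ^+ 2 + (a2 - b2) ^+ 2) * sq ph1 ph2 T <=
    2 * d a1 a2 T + 2 * d b1 b2 T.
  have sd1 := sd a1 a2; have sd2 := sd b1 b2.
  rewrite -sqZ// /d /sq -!primZ; [|exact: sqint_locint..].
  rewrite -primD; [|apply: locintZ; exact: sqint_locint|apply: locintZ; exact: sqint_locint].
  apply: le_prim.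
  - apply: sqint_locint; apply: lbm_sqint; [apply: lbmB|apply: lbmD]; apply: lbmM => //; exact: lbm_cst.
  - by apply: locintD; apply: locintZ; exact: sqint_locint.
  move=> s _; rewrite -subr_ge0; set X := (X in 0 <= X).
  have -> : X = ((Re (f s) - c1 a1 a2 s) + (Re (f s) - c1 b1 b2 s)) ^+ 2 +
     ((Im (f s) - c2 a1 a2 s) + (Im (f s) - c2 b1 b2 s)) ^+ 2.
    by rewrite /X /c1 /c2; ring.
  by rewrite addr_ge0 ?sqr_ge0.
have S0 := sq_phi_gt0 lQ phP ph10 ze10 ltr01.
have [K1 K10 K1P] := bnd 1 ler01.
pose L := Num.sqrt (4 * K1 / sq ph1 ph2 1).
have L0 : 0 <= 4 * K1 / sq ph1 ph2 1 by rewrite divr_ge0// ?mulr_ge0// ltW.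
have en n : 0 <= e n ^+ 2 by rewrite exprn_ge0// ltW.
have e_le n m : (n <= m)%N -> e m ^+ 2 <= e n ^+ 2.
  move=> nm; rewrite lerXn2r ?nnegrE ?(ltW (e0 _))// /e.
  by rewrite ler_iXn2l ?invr_gt0// invf_lt1// ltr1n.
have cau n m : (n <= m)%N -> ((a n).1 - (a m).1) ^+ 2 + ((a n).2 - (a m).2) ^+ 2 <= (L * e n) ^+ 2.
  move=> nm; rewrite exprMn sqr_sqrtr// mulrAC ler_pdivlMr//; apply: (le_trans (diff _ _ _ _ _)).
  have h1 := K1P n; have h2 := K1P m.
  have h3 : K1 * e m ^+ 2 <= K1 * e n ^+ 2 by rewrite ler_wpM2l// e_le.
  by rewrite (_ : 4 * K1 * e n ^+ 2 = 4 * (K1 * e n ^+ 2)); [lra|ring].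
have Le0 n : 0 <= L * e n by rewrite mulr_ge0 ?sqrtr_ge0// ltW.
have sqr_le (r s E : R) : 0 <= E -> r ^+ 2 + s ^+ 2 <= E ^+ 2 -> `|r| <= E.
  move=> E0 hE; rewrite -(ger0_norm E0) -ler_sqr ?nnegrE//.
  by rewrite !real_normK ?num_real//; have := sqr_ge0 s; lra.
have [l1 l1P] : exists l, forall n, `|(a n).1 - l| <= L * e n.
  by apply: bounded_limit => n m /cau; exact: sqr_le.
have [l2 l2P] : exists l, forall n, `|(a n).2 - l| <= L * e n.
  by apply: bounded_limit => n m /cau; rewrite addrC; exact: sqr_le.
have dl T : 0 <= T -> d l1 l2 T <= 0.
  move=> T0; have [K K0 KP] := bnd T T0.
  apply: (@le_half _ _ _ (2 * K + 4 * L ^+ 2 * sq ph1 ph2 T)) => n; rewrite add0r.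
  have sx : sqint (fun t => Re (f t) - c1 l1 l2 t - (Re (f t) - c1 (a n).1 (a n).2 t))
     (fun t => Im (f t) - c2 l1 l2 t - (Im (f t) - c2 (a n).1 (a n).2 t)).
    have [? ?] := cl l1 l2; have [? ?] := cl (a n).1 (a n).2.
    have := lbm_sqint (lbmB (cl (a n).1 (a n).2).1 (cl l1 l2).1) (lbmB (cl (a n).1 (a n).2).2 (cl l1 l2).2).
    by congr sqint; apply/funext => t; ring.
  apply: (le_trans (sq_split T (sd l1 l2) (sd (a n).1 (a n).2) sx)).
  have -> : sq (fun t => Re (f t) - c1 l1 l2 t - (Re (f t) - c1 (a n).1 (a n).2 t))
     (fun t => Im (f t) - c2 l1 l2 t - (Im (f t) - c2 (a n).1 (a n).2 t)) T =
     (((a n).1 - l1) ^+ 2 + ((a n).2 - l2) ^+ 2) * sq ph1 ph2 T.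
    by rewrite -sqZ//; apply: eq_prim => s _; rewrite /c1 /c2; ring.
  have sq_le (r E : R) : `|r| <= E -> r ^+ 2 <= E ^+ 2.
    by move=> rE; rewrite -[r ^+ 2]real_normK ?num_real// lerXn2r// nnegrE// (le_trans _ rE).
  have h1 := sq_le _ _ (l1P n); have h2 := sq_le _ _ (l2P n).
  have S_0 := sq_ge0 ph1 ph2 T.
  have h3 : (((a n).1 - l1) ^+ 2 + ((a n).2 - l2) ^+ 2) * sq ph1 ph2 T <=
      (2 * L ^+ 2 * e n ^+ 2) * sq ph1 ph2 T.
    by rewrite ler_wpM2r//; move: h1 h2; rewrite !exprMn; lra.
  have h4 := KP n; rewrite -/(d _ _ _).
  have h5 : e n ^+ 2 <= e n.
    by rewrite expr2 ler_piMl// ?(ltW (e0 _))// /e exprn_ile1// ?invr_ge0// invf_le1// ler1n.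
  have h6 : (2 * K + 4 * L ^+ 2 * sq ph1 ph2 T) * e n ^+ 2 <= (2 * K + 4 * L ^+ 2 * sq ph1 ph2 T) * e n.
    rewrite ler_wpM2l //; apply: addr_ge0; apply: mulr_ge0 => //; apply: mulr_ge0 => //; exact: sqr_ge0.
  apply: le_trans h6.
  have -> : (2 * K + 4 * L ^+ 2 * sq ph1 ph2 T) * e n ^+ 2 =
    2 * (K * e n ^+ 2) + 2 * ((2 * L ^+ 2 * e n ^+ 2) * sq ph1 ph2 T) by ring.
  by apply: lerD; rewrite ler_pM2l.
have zP := zsol_axpy (- l1) (- l2) sP phP.
have q1 : qsol p Q (c1 l1 l2) (fun t => z1 t - (- l1 * ze1 t - - l2 * ze2 t)) (fun t => Re (g t)).
  by have [qq _] := zP; apply: (eq_qsol qq) => // t _; rewrite /c1; ring.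
have q2 : qsol p Q (c2 l1 l2) (fun t => z2 t - (- l1 * ze2 t + - l2 * ze1 t)) (fun t => Im (g t)).
  by have [_ qq] := zP; apply: (eq_qsol qq) => // t _; rewrite /c2; ring.
have c10 : c1 l1 l2 0 = 0 by rewrite /c1 s10 ph10 ph20; ring.
have c20 : c2 l1 l2 0 = 0 by rewrite /c2 s20 ph10 ph20; ring.
have uA T : 0 <= T -> sq (c1 l1 l2) (c2 l1 l2) T <= 2 * Re (L2dot (L2class f) (L2class f)).
  move=> T0; have [k1 k2] := cl l1 l2.
  have sx : sqint (fun t => c1 l1 l2 t - Re (f t)) (fun t => c2 l1 l2 t - Im (f t)).
    have [m1 m2] := sd l1 l2.
    by split; [move: m1|move: m2]; congr locint; apply/funext => t; ring.
  have sf' : sqint (fun t => Re (f t)) (fun t => Im (f t)) by [].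
  apply: (le_trans (sq_split T (lbm_sqint k1 k2) sf' sx)).
  rewrite sq_sym -/(d _ _ _); have := dl T T0; have := sq_le_L2 f T0.
  by move: (sq _ _ _) (Re _) (d _ _ _) => *; lra.
have [u [uE _ _ Gu]] := Gmax_intro cp cQ c10 c20 q1 q2 uA.
suff -> : L2class f = L2class u by [].
by apply: L2class_eq => T T0; rewrite uE; exact: dl.
Qed.

End closedness.

(** * Density of the domain *)

Section averages.
Context {R : realType}.
Local Notation mu := (@lebesgue_measure R).
Implicit Types (F G : R -> R) (t T M d : R).

Definition supported (a b : R) F : Prop := forall t, (t < a) || (b < t) -> F t = 0.

(** The mean of [F] over [[t, t + d]]; unlike convolutions it needs no kernel, and
    looking forward keeps it defined on [[0, oo)]. *)
Definition avg d F t : R := d^-1 * (prim F (t + d) - prim F t).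

Lemma supported_right F a b t : supported a b F -> b < t -> F t = 0.
Proof. by move=> sF bt; rewrite sF// bt orbT. Qed.

Lemma prim_supp F b t : (forall s, b < s -> F s = 0) -> locint F -> 0 <= b -> b <= t ->
  prim F t = prim F b.
Proof.
move=> sF lF b0 bt; apply/eqP; rewrite -subr_eq0 prim_itv//.
rewrite (@eq_Rintegral _ _ _ _ _ (fun=> 0)); first by rewrite Rintegral_cst//= mul0r.
by move=> s; rewrite inE/= in_itv/= => /andP[bs _]; rewrite sF.
Qed.

Lemma prim_supp0 F a b t : supported a b F -> t < a -> prim F t = 0.
Proof.
move=> sF ta; have [t0|t0] := ltP t 0; first exact: prim_lt0.
rewrite (@eq_prim _ _ (fun=> 0)); first by rewrite prim_cst// mul0r.
by move=> s /andP[_ st]; rewrite sF// (le_lt_trans st ta).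
Qed.

Lemma avg_supp F a b d : 0 < d -> supported a b F -> locint F -> 0 <= b ->
  supported (a - d) b (avg d F).
Proof.
move=> d0 sF lF b0 t /orP[ta|bt]; rewrite /avg.
  rewrite !(prim_supp0 sF) ?subrr ?mulr0// -?ltrBrDr//.
  by apply: (lt_trans ta); rewrite ltrBlDr ltrDl.
rewrite [prim F (t + d)](prim_supp (fun s => supported_right sF))//; last by rewrite ltW// (lt_trans bt)// ltrDl.
by rewrite (prim_supp (fun s => supported_right sF)) ?subrr ?mulr0// ltW.
Qed.

Lemma prim_continuous F : lbm F -> continuous (prim F).
Proof.
move=> lbF t; have lF := lbm_locint lbF; have [t0|t0|t0] := ltgtP t 0.
- rewrite /continuous_at prim_lt0//; apply: cvg_near_cst; near=> s.
  rewrite prim_lt0//; near: s; exact: lt_nbhsl.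
- exact: (isprim_continuous_at (isprim_prim lF) t0).
rewrite t0 /continuous_at prim0; have [M M0 HM] := prim_lip 1 lbF.
apply/cvgrPdist_lt => e e0; near=> s; rewrite sub0r normrN.
have [s0|s0] := ltP s 0; first by rewrite prim_lt0// normr0.
have s1 : `|s| < Num.min 1 (e / (M + 1)).
  near: s; exists (Num.min 1 (e / (M + 1))) => [/=|x /=]; last by rewrite sub0r normrN.
  by rewrite lt_min ltr01 divr_gt0// ltr_wpDl.
rewrite lt_min ger0_norm// in s1; have /andP[s2 s3] := s1.
have := HM 0 s (lexx _) s0 (ltW s2); rewrite prim0 !subr0 => /le_lt_trans; apply.
rewrite ltr_pdivlMr ?ltr_wpDl// in s3; apply: le_lt_trans s3.
by rewrite mulrC ler_wpM2l// lerDl.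
Unshelve. all: by end_near. Qed.

Lemma shift_continuous F d : continuous F -> continuous (fun t => F (t + d)).
Proof.
move=> cF t; apply: (@continuous_comp _ _ _ (fun t => t + d) F); last exact: cF.
by apply: cvgD; [exact: cvg_id|exact: cvg_cst].
Qed.

Lemma difference_continuous F d : continuous F -> continuous (fun t => d^-1 * (F (t + d) - F t)).
Proof.
move=> cF t; apply: cvgM; first exact: cvg_cst.
by apply: cvgB; [exact: shift_continuous|exact: cF].
Qed.

Lemma difference_is_derive F f d t : is_derive (t + d) 1 F (f (t + d)) -> is_derive t 1 F (f t) ->
  is_derive t 1 (fun t => d^-1 * (F (t + d) - F t)) (d^-1 * (f (t + d) - f t)).
Proof.
move=> d1 d2.
have ds : is_derive t 1 (fun t => t + d) 1.
  by apply: is_derive_eq; rewrite addr0.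
have := @is_derive1_comp R F (fun t => t + d) t _ _ d1 ds; rewrite mulr1 => d3.
by have := is_deriveZ d^-1 (is_deriveB d3 d2).
Qed.

Lemma avg_is_derive F d t : continuous F -> 0 < d -> 0 < t ->
  is_derive t 1 (avg d F) (d^-1 * (F (t + d) - F t)).
Proof.
move=> cF d0 t0; have lF : locint F by apply/lbm_locint/lbm_continuous.
apply: difference_is_derive; apply: prim_is_derive => //; [by rewrite addr_gt0|exact: cF..].
Qed.

(** Lebesgue differentiation gives convergence almost everywhere, and dominated
    convergence makes it convergence in square norm.  The bound [d < k] lets the
    support stay inside the open half-line. *)
Lemma avg_approx F a b k (e : R) : 0 < a -> 0 < b -> supported a b F -> lbm F -> 0 < k -> 0 < e ->
  exists d, [/\ 0 < d, d < k & forall T, 0 <= T ->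
    prim (fun t => (F t - avg d F t) ^+ 2) T <= e].
Proof.
move=> a0 b0 sF lbF k0 e0; have lF := lbm_locint lbF.
pose d n : R := n.+1%:R^-1.
have d0 n : 0 < d n by rewrite invr_gt0.
pose f n t := (F t - avg (d n) F t) ^+ 2.
have lav n : lbm (avg (d n) F).
  have sav := avg_supp (d0 n) sF lF (ltW b0).
  apply: lbm_continuous; apply: difference_continuous; exact: prim_continuous.
have lf n : lbm (f n).
  have := lbmM (lbmB lbF (lav n)) (lbmB lbF (lav n)).
  by apply: eq_lbm => t _; rewrite /f expr2.
have [_ [M0 HM0]] := lbF b; pose M := `|M0|.
have HM t : `|F t| <= M.
  have [tb|tb] := boolP ((t < a) || (b < t)); first by rewrite sF// normr0 normr_ge0.
  move: tb; rewrite negb_or -!leNgt => /andP[at_ tb]; apply: (@le_trans _ _ M0); last exact: ler_norm.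
  by rewrite HM0// tb (le_trans (ltW a0) at_).
have avM n t : 0 <= t -> `|avg (d n) F t| <= M.
  move=> t0; rewrite /avg normrM [`|(d n)^-1|]gtr0_norm ?invr_gt0// [leLHS]mulrC ler_pdivrMr//.
  rewrite [leRHS]mulrC.
  have td : t <= t + d n by rewrite lerDl ltW.
  have -> : d n * M = M * (t + d n - t) by rewrite addrAC subrr add0r mulrC.
  exact: prim_increment_le.
have fM n t : 0 <= t -> f n t <= (2 * M) ^+ 2.
  move=> t0; rewrite /f -[leLHS]real_normK ?num_real// lerXn2r ?nnegrE ?normr_ge0//.
    by apply: mulr_ge0 => //; exact: normr_ge0.
  by apply: (le_trans (ler_normB _ _)); rewrite mulr_natl mulr2n lerD ?avM.
have mb : measurable (`[0, b]%classic : set R) by exact: measurable_itv.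
have lcF : locally_integrable [set: R] F.
  have := @integrable_locally_restrict R F `[0, b]%classic mb (lF b).
  rewrite (_ : F \_ _ = F)//; apply/funext => t; rewrite patchE; case: ifPn => //.
  rewrite notin_setE/= in_itv/= => /negP; rewrite negb_and -!ltNge => /orP h.
  by rewrite sF//; apply/orP; case: h => h; [left; exact: lt_trans h a0|right].
have ae0 : {ae mu, forall t, `[0, b]%classic t -> (fun n => (f n t)%:E) @ \oo --> 0%:E}.
  have := @FTC1 R F (BLeft 0) (fun y => lF y) lcF.
  apply: filterS; first exact: (ae_filter_ringOfSetsType mu).
  move=> t + /=; rewrite in_itv/= => + /andP[t0 _].
  move: t0; rewrite le_eqVlt => /predU1P[<- _|t0].
    have dn0 : \forall n \near \oo, d n < a by exact: (near_infty_natSinv_lt (PosNum a0)).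
    apply: cvg_near_cst; near=> n; rewrite /f /avg add0r prim0 (prim_supp0 sF); last by near: n.
    by rewrite sF ?a0// !subrr mulr0 subrr expr0n.
  rewrite lte_fin => /(_ t0)[dt et].
  have dP : is_derive t 1 (prim F) (F t).
    rewrite derive1E in et; exact: (DeriveDef dt et).
  have := is_derive_seq dP => c1.
  suff c3 : (fun n => f n t) @ \oo --> (F t - F t) * (F t - F t).
    rewrite subrr mul0r in c3; apply: cvg_EFin => //; by near=> n.
  have c2 : (fun n => F t - avg (d n) F t) @ \oo --> F t - F t.
    have c4 : (fun n => avg (d n) F t) @ \oo --> F t.
      by apply: cvg_trans c1; apply: near_eq_cvg; near=> n; rewrite /avg /d invrK.
    exact: cvgB (cvg_cst (F t)) c4.
  have -> : (fun n => f n t) = (fun n => (F t - avg (d n) F t) * (F t - avg (d n) F t)).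
    by apply/funext => n; rewrite /f expr2.
  exact: (cvgM c2 c2).
have [|||||] := @dominated_convergence _ _ _ mu `[0, b]%classic mb (fun n t => (f n t)%:E) (fun=> 0%:E)
   (fun t => ((2 * M) ^+ 2)%:E).
- by move=> n; apply/measurable_EFinP; have [] := lf n b.
- exact: measurable_cst.
- exact: ae0.
- exact: (locint_cst ((2 * M) ^+ 2) b).
- apply: aeW => t n /=; rewrite in_itv/= => /andP[t0 _].
  by rewrite lee_fin ger0_norm ?sqr_ge0//; exact: fM.
move=> _ _; rewrite integral0 => /fine_cvgP[_ /cvgrPdist_lt/(_ _ e0)[N1 _ HN1]].
have [N2 HN2] : exists N, N.+1%:R^-1 < k.
  exists (Num.truncn k^-1); rewrite invf_plt ?posrE// truncnS_gt//.
pose n := maxn N1 N2; exists (d n); split=> //.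
  apply: le_lt_trans HN2; rewrite /d lef_pV2 ?posrE ?ltr0n//.
  by rewrite ler_nat ltnS leq_maxr.
move=> T T0; have := HN1 n (leq_maxl _ _); rewrite /= sub0r normrN => h.
have -> : (fun t => (F t - avg (d n) F t) ^+ 2) = f n by [].
have sf : supported (a - d n) b (f n).
  move=> t h'; rewrite /f (avg_supp (d0 n) sF lF (ltW b0) h') sF ?subrr ?expr0n//.
  by case/orP: h' => h'; apply/orP; [left|right] => //; apply: (lt_trans h'); rewrite ltrBlDr ltrDl.
have fb : prim (f n) b <= e by apply: ltW; apply: le_lt_trans h; exact: ler_norm.
have lif := lbm_locint (lf n).
have [Tb|bT] := leP T b; last by rewrite (prim_supp (fun s => supported_right sf) lif (ltW b0) (ltW bT)).
by apply: le_trans fb; apply: prim_nd => // x _; exact: sqr_ge0.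
Unshelve. all: by end_near. Qed.

End averages.

Section density.
Context {R : realType}.
Local Notation mu := (@lebesgue_measure R).
Local Notation hl := (@half_line R).
Implicit Types (F G : R -> R) (t T M d : R).

(** The exponential of the primitive of [Q], with its reciprocal. *)
Lemma isprim_expR_prim (Q : R -> R) : {within hl, continuous Q} ->
  exists E E' : R -> R, [/\ isprim E (fun t => Q t * E t), lbm E', forall t, E t * E' t = 1 & 
    forall t, 0 < E t].
Proof.
move=> /within_max0_continuous cQ; set Q0 := (fun t => _) in cQ.
have lQ := lbm_continuous cQ; have cP := prim_continuous lQ.
have cE : continuous (fun t => expR (prim Q0 t)).
  by move=> x; apply: (continuous_comp (cP x)); exact: continuous_expR.
exists (fun t => expR (prim Q0 t)), (fun t => expR (- prim Q0 t)); split.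
- apply: (@eq_isprim _ (fun t => expR (prim Q0 t)) _ (fun t => Q0 t * expR (prim Q0 t))) => //; last first.
    by move=> t t0; rewrite /Q0 max_l.
  apply: isprim_derive => //.
    by move=> x; apply: cvgM; [exact: cQ|exact: cE].
  move=> t t0; have dP := prim_is_derive (lbm_locint lQ) t0 (cQ t).
  by have := is_derive1_comp (is_derive_expR (prim Q0 t)) dP; rewrite mulrC.
- apply: lbm_continuous => x; apply: (continuous_comp (cvgN (cP x))); exact: continuous_expR.
- by move=> t; rewrite -expRD subrr expR0.
- by move=> t; exact: expR_gt0.
Qed.

(** Truncation to [1/(n+1) <= t <= n + 1] and [|F| <= n + 1]. *)
Lemma msq_truncate F (e : R) : msq F -> 0 < e -> exists a b G,
  [/\ 0 < a, 0 < b, supported a b G, lbm G &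
   locint (fun t => (F t - G t) ^+ 2) /\
   forall T, 0 <= T -> prim (fun t => (F t - G t) ^+ 2) T <= e].
Proof.
move=> [mF iF] e0; have mhl : measurable hl := measurable_half_line.
pose A n : set R := (hl `&` F @^-1` `[- n.+1%:R, n.+1%:R]) `&` `[n.+1%:R^-1, n.+1%:R].
have mA n : measurable (A n).
  by apply: measurableI => //; apply: mF => //; exact: measurable_itv.
pose G n := F \_ (A n).
have GE n t : G n t = F t \/ G n t = 0.
  by rewrite /G patchE; case: ifP => _; [left|right].
have mG n : measurable_fun setT (G n).
  by apply/(measurable_restrictT _ (mA n)); apply: measurable_funS mF => // t [[]].
have GM n t : `|G n t| <= n.+1%:R.
  rewrite /G patchE; case: ifPn => [|_]; last by rewrite normr0.
  by rewrite inE => -[[_ /=]]; rewrite in_itv/= ler_norml.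
have lG n : lbm (G n).
  by move=> T; split; [exact: measurable_funTS|exists n.+1%:R => t _; exact: GM].
have sG n : supported n.+1%:R^-1 n.+1%:R (G n).
  move=> t; rewrite /G patchE => h; case: ifPn => //; rewrite inE => -[_ /=].
  by rewrite in_itv/= => /andP[h1 h2]; case/orP: h; rewrite ltNge ?h1 ?h2.
pose f n t := (F t - G n t) ^+ 2.
have fF n t : f n t <= F t * F t.
  by rewrite /f; case: (GE n t) => ->; rewrite ?subr0 ?expr2// subrr mul0r -expr2 sqr_ge0.
have mf n : measurable_fun hl (f n).
  by apply: measurable_funX; apply: measurable_funB => //; exact: measurable_funTS.
have [|||||] := @dominated_convergence _ _ _ mu hl mhl (fun n t => (f n t)%:E) (fun=> 0%:E)
   (fun t => (F t * F t)%:E).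
- by move=> n; apply/measurable_EFinP; exact: mf.
- exact: measurable_cst.
- exists [set 0]; split; [exact: measurable_set1|exact: lebesgue_measure_set1|].
  move=> t; apply: contra_notP => /= t0n; rewrite /half_line/= in_itv/= andbT => t0.
  have {t0n}t0 : 0 < t by rewrite lt_neqAle t0 andbT eq_sym; apply/eqP.
  have nbig (r : R) : \forall n \near \oo, r <= n.+1%:R.
    exists (Num.truncn r) => // n /= rn; apply: ltW; apply: (lt_le_trans (truncnS_gt r)).
    by rewrite ler_nat ltnS.
  apply: cvg_near_cst; near=> n; rewrite /f /G patchE ifT ?subrr ?expr0n//.
  rewrite inE; split; first split; rewrite /= ?/half_line/= ?in_itv/= ?(ltW t0)//.
    rewrite -ler_norml; near: n; exact: nbig.
  apply/andP; split; last by near: n; exact: nbig.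
  by apply: ltW; near: n; exact: (near_infty_natSinv_lt (PosNum t0)).
- exact: iF.
- by apply: aeW => t n _; rewrite gee0_abs ?lee_fin ?sqr_ge0.
move=> _ _; rewrite integral0 => /fine_cvgP[_ /cvgrPdist_lt/(_ _ e0)[n _ Hn]].
have ifn : mu.-integrable hl (EFin \o f n).
  apply: (@le_integrable _ _ _ mu hl mhl _ _ _ _ iF); first by apply/measurable_EFinP; exact: mf.
  move=> t _; rewrite /= lee_fin ger0_norm ?sqr_ge0// ger0_norm ?fF//.
  exact: le_trans (sqr_ge0 _) (fF n t).
have sub T : `[0, T] `<=` hl by move=> t /=; rewrite /half_line/= !in_itv/= andbT => /andP[].
have lf : locint (f n).
  by move=> T; exact: (@integrableS _ _ _ mu hl `[0%R, T]%classic _ mhl (measurable_itv _) (sub T) ifn).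
exists n.+1%:R^-1, n.+1%:R, (G n); split=> //; split=> // T T0.
have := Hn n (leqnn n); rewrite /= sub0r normrN => h.
apply: ltW; apply: le_lt_trans h; apply: le_trans (ler_norm _).

apply/ler_addgt0Pr => e' e'0; have [T2 T20 HT2] := integrable_tail ifn e'0.
have := HT2 (Num.max T T2); rewrite le_max lexx orbT => /(_ isT).
rewrite ler_distl => /andP[_ h]; apply: le_trans h; apply: prim_nd => //.
  by move=> x _; exact: sqr_ge0.
by rewrite le_max lexx.
Unshelve. all: by end_near. Qed.

End density.

Section smooth_density.
Context {R : realType}.
Local Notation mu := (@lebesgue_measure R).
Local Notation hl := (@half_line R).
Implicit Types (F G : R -> R) (t T M d : R).

Lemma avg_continuous d F : lbm F -> continuous (avg d F).
Proof. move=> lF. exact: (difference_continuous (d := d) (prim_continuous lF)). Qed.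

(** The first average is continuous and each further one gains a derivative. *)
Lemma avg3_approx H a b (e : R) : 0 < a -> 0 < b -> supported a b H -> lbm H -> 0 < e ->
  exists y k m : R -> R, [/\ isprim y k, isprim k m, lbm m, y 0 = 0 &
    [/\ forall t, b < t -> [/\ y t = 0, k t = 0 & m t = 0], continuous y &
      forall T, 0 <= T -> prim (fun t => (H t - y t) ^+ 2) T <= 9 * e]].
Proof.
move=> a0 b0 sH lH e0; have b0' := ltW b0.
have sum_le (r1 r2 r3 : R) : r1 <= e -> r2 <= e -> r3 <= e -> 3 * (r1 + (r2 + r3)) <= 9 * e.
  by clear; lra.
have a40 : 0 < a / 4 by rewrite divr_gt0.
have liH := lbm_locint lH.
have [d1 [d10 d1a app1]] := avg_approx a0 b0 sH lH a40 e0.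
set y1 := avg d1 H in app1.
have s1 : supported (a - d1) b y1 by exact: avg_supp.
have c1 : continuous y1 := avg_continuous (d:=d1) lH.
have a1 : 0 < a - d1 by lra.
have [d2 [d20 d2a app2]] := avg_approx a1 b0 s1 (lbm_continuous c1) a40 e0.
set y2 := avg d2 y1 in app2.
have s2 : supported (a - d1 - d2) b y2 by apply: avg_supp => //; exact/lbm_locint/lbm_continuous.
have c2 : continuous y2 := avg_continuous (d:=d2) (lbm_continuous c1).
have a2 : 0 < a - d1 - d2 by lra.
have [d3 [d30 d3a app3]] := avg_approx a2 b0 s2 (lbm_continuous c2) a40 e0.
set y3 := avg d3 y2 in app3.
have s3 : supported (a - d1 - d2 - d3) b y3 by apply: avg_supp => //; exact/lbm_locint/lbm_continuous.
have c3 : continuous y3 := avg_continuous (d:=d3) (lbm_continuous c2).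
pose k2 t := d2^-1 * (y1 (t + d2) - y1 t).
have ck2 : continuous k2 by exact: difference_continuous.
pose k3 t := d3^-1 * (y2 (t + d3) - y2 t).
have ck3 : continuous k3 by exact: difference_continuous.
pose m t := d3^-1 * (k2 (t + d3) - k2 t).
have cm : continuous m by exact: difference_continuous.
have zr d G : 0 < d -> (forall t, b < t -> G t = 0) -> forall t, b < t -> d^-1 * (G (t + d) - G t) = 0.
  by move=> d0 G0 t bt; rewrite !G0 ?subrr ?mulr0// (lt_trans bt)// ltrDl.
have z1 t : b < t -> y1 t = 0 by move=> bt; rewrite s1// bt orbT.
have z2 t : b < t -> y2 t = 0 by move=> bt; rewrite s2// bt orbT.
exists y3, k3, m; split.
- have D (s : R) (s0 : 0 < s) : is_derive s 1 y3 (k3 s) := avg_is_derive c2 d30 s0.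
  exact: (isprim_derive ck3 c3 D).
- apply: (isprim_derive cm ck3) => t t0.
  have D (s : R) (s0 : 0 < s) : is_derive s 1 y2 (k2 s) := avg_is_derive c1 d20 s0.
  exact: (difference_is_derive (D _ (addr_gt0 t0 d30)) (D _ t0)).
- exact: lbm_continuous.
- by rewrite s3//; apply/orP; left; lra.
split => // [t bt|T T0].
  split; first by rewrite s3// bt orbT.
    exact: (zr _ y2).
  by apply: (zr _ k2) => // s bs; exact: (zr _ y1).
have lb1 := lbm_continuous c1; have lb2 := lbm_continuous c2; have lb3 := lbm_continuous c3.
clear - lH lb1 lb2 lb3 app1 app2 app3 sum_le T0; clearbody y3 y2 y1.
have sqlb f g : lbm f -> lbm g -> locint (fun t => (f t - g t) ^+ 2).
  move=> lf lg; apply: lbm_locint; have := lbmM (lbmB lf lg) (lbmB lf lg).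
  by apply: eq_lbm => t _; rewrite expr2.
apply: (@le_trans _ _ (3 * (prim (fun t => (H t - y1 t) ^+ 2) T + 
   (prim (fun t => (y1 t - y2 t) ^+ 2) T + prim (fun t => (y2 t - y3 t) ^+ 2) T)))); last first.
  exact: sum_le (app1 T T0) (app2 T T0) (app3 T T0).
have i1 := sqlb _ _ lH lb1; have i2 := sqlb _ _ lb1 lb2; have i3 := sqlb _ _ lb2 lb3.
have i23 := locintD i2 i3; have i123 := locintD i1 i23.
rewrite -(primD _ i2 i3) -(primD _ i1 i23) -(primZ _ _ i123).
apply: (le_prim (sqlb _ _ lH lb3) (locintZ 3 i123)) => s _; rewrite -subr_ge0; set X := (X in 0 <= X).
have -> : X = (H s - y1 s - (y1 s - y2 s)) ^+ 2 + (y1 s - y2 s - (y2 s - y3 s)) ^+ 2 +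
   (H s - y1 s - (y2 s - y3 s)) ^+ 2 by rewrite /X; ring.
by rewrite !addr_ge0 ?sqr_ge0.
Qed.

Variables p Q : R -> R.
Hypotheses (cp : {within hl, continuous p}) (cQ : {within hl, continuous Q}).

Let lp : lbm p := lbm_within cp.
Let lQ : lbm Q := lbm_within cQ.

(** For [u = E y] with [E' = Q E] the quasi-derivative is [w = E y'], in which [Q]
    is not differentiated, so [H u] is a function for every [y] of class C^2.
    Hence [F / E] is smoothed instead of [F]. *)
Lemma msq_qsol_approx F (e : R) : msq F -> 0 < e -> exists u w v b,
  [/\ qsol p Q u w v, u 0 = 0, lbm v, forall t, b < t -> [/\ u t = 0, w t = 0 & v t = 0] &
    [/\ 0 < b, locint (fun t => (F t - u t) ^+ 2) &
      forall T, 0 <= T -> prim (fun t => (F t - u t) ^+ 2) T <= e]].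
Proof.
move=> mF e0; have e4 : 0 < e / 4 by rewrite divr_gt0.
have [a [b [G [a0 b0 sG lG [iFG FG]]]]] := msq_truncate mF e4.
have [E [E' [pE lE' EE' E0]]] := isprim_expR_prim cQ; have lE := isprim_lbm pE.
have [_ [M HM]] := lE b; pose K := M ^+ 2 + 1.
have K0 : 0 < K by rewrite ltr_wpDl// sqr_ge0.
have bound (r1 r2 : R) : r1 <= e / 4 -> r2 <= 9 * (e / (36 * K)) -> 2 * r1 + 2 * K * r2 <= e.
  move=> h1 h2; have h4 : 2 * K * (9 * (e / (36 * K))) = e / 2 by field; rewrite gt_eqF.
  have h3 : 2 * K * r2 <= e / 2 by rewrite -h4 ler_wpM2l// mulr_ge0// ltW.
  by move: h1 h3; clear; lra.
pose H t := G t * E' t.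
have lH : lbm H by exact: lbmM.
have sH : supported a b H by move=> t h; rewrite /H sG// mul0r.
have e36 : 0 < e / (36 * K) by rewrite divr_gt0// mulr_gt0.
have [y [k [m [py pk lm y0 [z cy app]]]]] := avg3_approx a0 b0 sH lH e36.
have ly := isprim_lbm py; have lk := isprim_lbm pk.
exists (fun t => E t * y t), (fun t => E t * k t),
  (fun t => (p t - Q t * Q t) * (E t * y t) - 2 * Q t * (E t * k t) - E t * m t), b.
have lv : lbm (fun t => (p t - Q t * Q t) * (E t * y t) - 2 * Q t * (E t * k t) - E t * m t).
  apply: lbmB; last exact: lbmM.
  apply: lbmB; apply: lbmM; try exact: lbmM; last by apply: lbmM => //; exact: lbm_cst.
  by apply: lbmB => //; exact: lbmM.
have lEy : lbm (fun t => E t * y t) by exact: lbmM.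
have iHy : locint (fun t => (H t - y t) ^+ 2).
  apply: lbm_locint; have := lbmM (lbmB lH ly) (lbmB lH ly).
  by apply: eq_lbm => t _; rewrite expr2.
have pt t : 0 <= t -> (F t - E t * y t) ^+ 2 <= 2 * (F t - G t) ^+ 2 + 2 * K * (H t - y t) ^+ 2.
  move=> t0; have h : (G t - E t * y t) ^+ 2 <= K * (H t - y t) ^+ 2.
    have [tb|bt] := leP t b; last first.
      have [yt _ _] := z _ bt; rewrite yt sG ?bt ?orbT// mulr0 subr0 expr0n/=.
      by rewrite mulr_ge0 ?sqr_ge0// ltW.
    have -> : G t - E t * y t = E t * (H t - y t).
      by rewrite mulrBr /H mulrCA EE' mulr1.
    rewrite exprMn ler_wpM2r ?sqr_ge0// /K; have := HM t; rewrite t0 tb => /(_ isT) h.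
    have := ler_norm (E t); have := E0 t => ? ?; nra.
  rewrite (_ : 2 * K * (H t - y t) ^+ 2 = 2 * (K * (H t - y t) ^+ 2)); last by rewrite mulrA.
  apply: (@le_trans _ _ (2 * (F t - G t) ^+ 2 + 2 * (G t - E t * y t) ^+ 2)); last first.
    by rewrite lerD2l ler_pM2l.
  rewrite -subr_ge0; set X := (X in 0 <= X).
  have -> : X = (F t - G t - (G t - E t * y t)) ^+ 2 by rewrite /X; ring.
  exact: sqr_ge0.
have iFy : locint (fun t => (F t - E t * y t) ^+ 2).
  have [iFF iF] := msq_locint mF.
  have i1 := locint_mul lEy iF; have i2 := lbm_locint (lbmM lEy lEy).
  have := locintD (locintB iFF (locintZ 2 i1)) i2.
  by congr locint; apply/funext => t; ring.
split=> //.
- split.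
    by apply: (eq_isprim (isprimM pE py)) => // t _; ring.
  by apply: (eq_isprim (isprimM pE pk)) => // t _; ring.
- by rewrite y0 mulr0.
- by move=> t /z[-> -> ->]; rewrite !mulr0 !subr0; split.
split=> // T T0.
apply: (@le_trans _ _ (prim (fun t => 2 * (F t - G t) ^+ 2 + 2 * K * (H t - y t) ^+ 2) T)).
  apply: le_prim => //; first by apply: locintD; exact: locintZ.
  by move=> s /andP[s0 _]; exact: pt.
rewrite primD; [|exact: locintZ|exact: locintZ]; rewrite !primZ//.
exact: (bound _ _ (FG T T0) (app T T0)).
Qed.

End smooth_density.

Section dense_domain.
Context {R : realType}.
Local Notation mu := (@lebesgue_measure R).
Local Notation hl := (@half_line R).
Variables p Q : R -> R.
Hypotheses (cp : {within hl, continuous p}) (cQ : {within hl, continuous Q}).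

Let lp : lbm p := lbm_within cp.
Let lQ : lbm Q := lbm_within cQ.

Lemma sq_supp (u1 u2 : R -> R) b T : lbm u1 -> lbm u2 -> 0 <= b ->
  (forall t, b < t -> u1 t = 0 /\ u2 t = 0) -> 0 <= T -> sq u1 u2 T <= sq u1 u2 b.
Proof.
move=> l1 l2 b0 z T0; have li := sqint_locint (lbm_sqint l1 l2).
have [Tb|bT] := leP T b.
  by apply: prim_nd => // x _; rewrite addr_ge0// -expr2 sqr_ge0.
rewrite /sq (@prim_supp _ _ b T) ?(ltW bT)// => t bt.
by have [-> ->] := z t bt; rewrite mulr0 addr0.
Qed.

(** The approximants vanish for large [t], and so do their Wronskians. *)
Lemma H0S_dense : densely_defined L2dot (H0S p Q).
Proof.
move=> x e e0; have [f ->] := L2class_surj x; have [m1 m2] := L2fun_msq f.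
have e40 : 0 < e ^+ 2 / 4 by rewrite divr_gt0// exprn_gt0.
have [u1 [w1 [v1 [b1 [q1 u10 lv1 z1 [b10 i1 A1]]]]]] := msq_qsol_approx cp cQ m1 e40.
have [u2 [w2 [v2 [b2 [q2 u20 lv2 z2 [b20 i2 A2]]]]]] := msq_qsol_approx cp cQ m2 e40.
have [lu1 _] := qsol_lbm q1; have [lu2 _] := qsol_lbm q2.
pose b := Num.max b1 b2.
have b0 : 0 <= b by rewrite le_max (ltW b10).
have bb t : b < t -> b1 < t /\ b2 < t by rewrite gt_max => /andP.
have su T : 0 <= T -> sq u1 u2 T <= sq u1 u2 b.
  by apply: sq_supp => // t /bb[/z1[-> _ _] /z2[-> _ _]].
have sv T : 0 <= T -> sq v1 v2 T <= sq v1 v2 b.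
  by apply: sq_supp => // t /bb[/z1[_ _ ->] /z2[_ _ ->]].
pose g := L2Fun (square_integrable_sq lv1 lv2 sv).
have [a [aE Da ag _]] := @Gmax_intro R p Q cp cQ g u1 w1 u2 w2 _ u10 u20 q1 q2 su.
exists (L2class a); last first.
  rewrite -ltr_sqr ?nnegrE ?dot_norm_ge0// ?(ltW e0)//.
  rewrite (dot_normE (@L2dot_ge0 R)) L2class_sub.
  apply: (@le_lt_trans _ _ (e ^+ 2 / 4 + e ^+ 2 / 4)).
    apply: L2_le_sq => T T0.
    apply: le_trans (lerD (A1 T T0) (A2 T T0)); rewrite -primD// le_eqVlt; apply/orP; left; apply/eqP.
    by apply: eq_prim => s _; have [-> ->] := L2fun_subE f a s; rewrite aE/= !expr2.
  by rewrite -mulrDr gtr_pMr ?exprn_gt0//; lra.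
exists (L2class g), a, g; split=> //; split=> // v [[v' vP] _ _ _].
have [y1 [y2 [r1 r2]]] := hop_qsol cp cQ vP.
have q1' : qsol p Q (fun t => Re (a t)) w1 v1 by rewrite aE; exact: q1.
have q2' : qsol p Q (fun t => Im (a t)) w2 v2 by rewrite aE; exact: q2.
apply: cvg_near_cst; near=> t.
have bt : b < t by near: t; apply: nbhs_pinfty_gt; exact: num_real.
have [/z1[zu1 zw1 _] /z2[zu2 zw2 _]] := bb t bt.
rewrite (wronskianE cp cQ q1' q2' r1 r2) ?(le_trans b0 (ltW bt))//.
rewrite /rwronskian aE/= zu1 zu2 zw1 zw2 !mul0r !subr0 addr0.
by rewrite /normc expr0n addr0 sqrtr0.
Unshelve. all: by end_near. Qed.

End dense_domain.

(** * Self-adjointness and discreteness of the spectrum *)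

Section operator_facts.
Context {R : realType}.
Local Notation mu := (@lebesgue_measure R).
Local Notation hl := (@half_line R).
Variables p Q : R -> R.
Hypotheses (cp : {within hl, continuous p}) (cQ : {within hl, continuous Q}).

Lemma H0S_basic : [/\ linear_operator (H0S p Q), densely_defined L2dot (H0S p Q),
  closed_operator L2dot (H0S p Q) & symmetric_operator L2dot (H0S p Q)].
Proof.
have dense := H0S_dense cp cQ; rewrite (H0S_symmetric_part cp cQ) in dense *; split => //.
- exact: (symmetric_part_linear (@L2dotDl R) (@L2dotC R) (@L2dot_ge0 R) (@L2dot_eq0 R)
    (Gmax0 cp cQ) (Gmax_lin cp cQ) dense).
- exact: (symmetric_part_closed (@L2dotDl R) (@L2dotC R) (@L2dot_ge0 R) (Gmax_closed cp cQ)).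
- exact: symmetric_part_symmetric.
Qed.

Let lp : lbm p := lbm_within cp.
Let lQ : lbm Q := lbm_within cQ.

Lemma Gmax_zsol z x y : Gmax p Q (x, y + z *: x) -> exists (f g : L2fun R) (w1 w2 : R -> R),
  [/\ x = L2class f, y = L2class g,
    zsol p Q (Re z) (Im z) (fun t => Re (f t)) w1 (fun t => Im (f t)) w2
      (fun t => Re (g t)) (fun t => Im (g t)) & Re (f 0) = 0 /\ Im (f 0) = 0].
Proof.
move=> /(Gmax_elim cp cQ)[f [h [w1 [w2 [-> yh [f1 f2] q1 q2]]]]].
exists f, (h - z *: f), w1, w2; split=> //.
  by rewrite -L2class_sub L2classZ -yh addrK.
have E t : (h - z *: f) t = h t - z * f t by [].
by split; [apply: (eq_qsol q1)|apply: (eq_qsol q2)] => // t _; rewrite E;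
  case: z {yh E} => a b; case: (h t) => ? ?; case: (f t) => ? ? /=; ring.
Qed.

Lemma zsol_Gmax z (g : L2fun R) u1 w1 u2 w2 A :
  zsol p Q (Re z) (Im z) u1 w1 u2 w2 (fun t => Re (g t)) (fun t => Im (g t)) ->
  u1 0 = 0 -> u2 0 = 0 -> (forall T, 0 <= T -> sq u1 u2 T <= A) ->
  exists f : L2fun R, (f : R -> R[i]) = (fun t => u1 t +i* u2 t) /\
    Gmax p Q (L2class f, L2class g + z *: L2class f).
Proof.
move=> [q1 q2] u10 u20 uA; have [l1 _] := qsol_lbm q1; have [l2 _] := qsol_lbm q2.
pose f := L2Fun (square_integrable_sq l1 l2 uA).
have E t : (g + z *: f) t = g t + z * f t by [].
have q1' : qsol p Q u1 w1 (fun t => Re ((g + z *: f) t)).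
  by apply: (eq_qsol q1) => // t _; rewrite E /=; case: z {q1 q2 f E} => a b; case: (g t) => ? ? /=; ring.
have q2' : qsol p Q u2 w2 (fun t => Im ((g + z *: f) t)).
  by apply: (eq_qsol q2) => // t _; rewrite E /=; case: z {q1 q2 f E q1'} => a b; case: (g t) => ? ? /=; ring.
have [f' [f'E _ _ G]] := Gmax_intro cp cQ u10 u20 q1' q2' uA.
have ff' : f' = f by apply: val_inj; rewrite /= f'E.
by exists f; split=> //; rewrite ff' L2classD L2classZ in G.
Qed.

End operator_facts.

Lemma le_half0 (R : realType) (X : R) : 0 <= X -> X <= X / 2 -> X = 0.
Proof. lra. Qed.

Section discrete_spectrum.
Context {R : realType}.
Local Notation mu := (@lebesgue_measure R).
Local Notation hl := (@half_line R).
Variables p Q : R -> R.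
Hypotheses (cp : {within hl, continuous p}) (cQ : {within hl, continuous Q}).
Variables (Qt q : R -> R) (C : R).
Hypotheses (pQt : isprim Qt q) (C0 : 0 <= C).
Hypothesis confining :
  forall t, 0 <= t -> t / 2 - C <= p t + q t - 2 * (Q t - Qt t) ^+ 2.

Let lp : lbm p := lbm_within cp.
Let lQ : lbm Q := lbm_within cQ.
Let G := Gmax p Q.
Implicit Types (z : R[i]) (x y : L2 R).

Local Notation nsq x := (Re (L2dot x x)).

Let nsqZ (c : R[i]) x : nsq (c *: x) = (Re c ^+ 2 + Im c ^+ 2) * nsq x.
Proof.
rewrite (dotZl (@L2dotDl R)) (dotZr (@L2dotDl R) (@L2dotC R)).
have := dot_Im (@L2dotC R) x; case: (L2dot x x) => r s /= ->.
by case: c => a b /=; ring.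
Qed.

Definition nonL2 (u1 u2 : R -> R) : Prop := forall A, exists2 T, 0 <= T & A <= sq u1 u2 T.

(** The solution [f1 + i f2] of [H u = z u] with [u 0 = 0] and quasi-derivative 1
    at 0; every solution vanishing at 0 is a multiple of it. *)
Definition phi z (f1 h1 f2 h2 : R -> R) : Prop :=
  [/\ zsol p Q (Re z) (Im z) f1 h1 f2 h2 (fun=> 0) (fun=> 0),
    f1 0 = 0, f2 0 = 0, h1 0 = 1 & h2 0 = 0].

Lemma phi_exists z : exists f1 h1 f2 h2, phi z f1 h1 f2 h2.
Proof.
have z0 : locint (fun=> 0 : R) := locint_cst 0.
by have [f1 [h1 [f2 [h2 [? ? ? ? ?]]]]] := zsol_exists lp lQ (Re z) (Im z) 1 0 z0 z0;
  exists f1, h1, f2, h2.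
Qed.

Lemma nonL2_dec (u1 u2 : R -> R) :
  nonL2 u1 u2 \/ exists A, forall T, 0 <= T -> sq u1 u2 T <= A.
Proof.
have [h|/existsNP[A hA]] := pselect (nonL2 u1 u2); [by left|right].
by exists A => T T0; apply: ltW; rewrite ltNge; apply/negP => AT; apply: hA; exists T.
Qed.

Lemma kernel_phi z f1 h1 f2 h2 x : phi z f1 h1 f2 h2 -> G (x, z *: x) ->
  exists (f : L2fun R) (a1 a2 : R), x = L2class f /\ forall T, 0 <= T ->
    sq (fun t => Re (f t) - (a1 * f1 t - a2 * f2 t))
       (fun t => Im (f t) - (a1 * f2 t + a2 * f1 t)) T <= 0.
Proof.
move=> [phP f10 f20 h10 h20] Gx; have Gx' : Gmax p Q (x, 0 + z *: x) by rewrite add0r.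
have [f [g [w1 [w2 [-> g0 zP [u10 u20]]]]]] := Gmax_zsol cp cQ Gx'.
exists f, (w1 0), (w2 0); split=> // T T0.
have [sg _ _] := L2fun_locint g.
have [K K0 /(_ _ _ _ _ _ _ zP u10 u20 sg) h] := zsol_decomp lp lQ phP f10 f20 h10 h20 T0.
apply: (le_trans h); rewrite mulr_ge0_le0//.
have := sq_le_L2 g T0; rewrite -g0 (dot0l (@L2dotDl R)); exact.
Qed.

Lemma phi_lbm z f1 h1 f2 h2 : phi z f1 h1 f2 h2 -> lbm f1 /\ lbm f2.
Proof. by move=> [[/qsol_lbm[? _] /qsol_lbm[? _]] _ _ _ _]. Qed.

(** An element of the kernel is a multiple of [phi], which is not square integrable
    unless the multiple is 0. *)
Lemma nonL2_kernel z f1 h1 f2 h2 x : phi z f1 h1 f2 h2 -> nonL2 f1 f2 -> G (x, z *: x) -> x = 0.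
Proof.
move=> ph nL Gx; have [f [a1 [a2 [-> fP]]]] := kernel_phi ph Gx.
have [l1 l2] := phi_lbm ph; have sf := lbm_sqint l1 l2.
have [sF lF1 lF2] := L2fun_locint f.
pose c1 t := a1 * f1 t - a2 * f2 t; pose c2 t := a1 * f2 t + a2 * f1 t.
have [k1 k2] : lbm c1 /\ lbm c2.
  by split; [apply: lbmB|apply: lbmD]; apply: lbmM => //; exact: lbm_cst.
have sc := lbm_sqint k1 k2.
have sd := L2fun_sqint_sub f k1 k2.
have sd' : sqint (fun t => c1 t - Re (f t)) (fun t => c2 t - Im (f t)).
  by case: sd => m1 m2; split; [move: m1|move: m2]; congr locint; apply/funext => t; ring.
have bnd T : 0 <= T -> (a1 ^+ 2 + a2 ^+ 2) * sq f1 f2 T <= 2 * nsq (L2class f).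
  move=> T0; rewrite -sqZ//; apply: (le_trans (sq_split T sc sF sd')); rewrite sq_sym.
  have := fP T T0; have := sq_le_L2 f T0; rewrite -/c1 -/c2.
  by move: (sq _ _ _) (Re _) (sq _ _ _) => a b c; lra.
have a0 : a1 ^+ 2 + a2 ^+ 2 = 0.
  apply/eqP; rewrite eq_le addr_ge0 ?sqr_ge0// andbT leNgt; apply/negP => apos.
  have [T T0] := nL ((2 * nsq (L2class f) + 1) / (a1 ^+ 2 + a2 ^+ 2)).
  rewrite ler_pdivrMr// => h; have := bnd T T0; rewrite mulrC => /(le_trans h).
  by rewrite gerDl ler10.
have [a10 a20] : a1 = 0 /\ a2 = 0.
  move/eqP: a0; rewrite paddr_eq0 ?sqr_ge0// !sqrf_eq0 => /andP[/eqP ? /eqP ?]; by split.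
apply: L2dot_eq0; apply/eqP; rewrite eq_le L2dot_ge0 andbT.
apply: L2_le_sq => T T0; apply: le_trans (fP T T0); rewrite le_eqVlt; apply/orP; left; apply/eqP.
by apply: eq_prim => s _; rewrite a10 a20; ring.
Qed.

(** Existence is Weyl's construction.  For the bounded inverse, suppose
    [|y|^2 < m |x|^2]; then the energy bound and the right-hand side are small
    relative to [M = |x|^2], and coercivity gives [|x|^2 <= |x|^2 / 2]. *)
Lemma nonL2_resolvent z f1 h1 f2 h2 : phi z f1 h1 f2 h2 -> nonL2 f1 f2 ->
  resolvent_set L2dot G z.
Proof.
move=> ph nL; have [phP f10 f20 h10 h20] := ph; split.
  move=> y; have [g ->] := L2class_surj y; have [sg lg1 lg2] := L2fun_locint g.
  have [u1 [w1 [u2 [w2 [zP u10 u20 [A uA]]]]]] :=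
    solvable_nonL2 lp lQ pQt C0 confining phP f10 f20 h10 h20 nL lg1 lg2 sg (fun T => @sq_le_L2 R g T).
  have [f [_ Gf]] := zsol_Gmax cp cQ zP u10 u20 uA.
  exists (L2class f); split=> // x' Gx'.
  have : G (-1 *: x' + L2class f, z *: (-1 *: x' + L2class f)).
    have := Gmax_lin cp cQ (-1) Gx' Gf; congr (G (_, _)).
    rewrite !scaleN1r scalerDr scalerN opprD addrACA addNr add0r.
    by [].
  move=> /(nonL2_kernel ph nL)/eqP; rewrite scaleN1r addrC subr_eq0 => /eqP ->.
  by [].
have W0 := weight_cst_ge0 C0 (Re z) (Im z).
have c0 : 0 <= 4 * weight_cst C (Re z) (Im z) by rewrite mulr_ge0.
have [d d0 [B B0 coer]] := coercive_nonL2 lp lQ phP f10 f20 h10 h20 c0 nL.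
pose m := Num.min d 1; have m0 : 0 < m by rewrite lt_min d0 ltr01.
exists (Num.sqrt m^-1) => x y Gxy.
suff key : m * nsq x <= nsq y.
  rewrite /dot_norm -sqrtrM ?invr_ge0 ?(ltW m0)// ler_wsqrtr//.
  by rewrite ler_pdivlMl.
have [f [g [w1 [w2 [-> -> zP [u10 u20]]]]]] := Gmax_zsol cp cQ Gxy.
have [sg _ _] := L2fun_locint g.
set X := nsq (L2class f); set Y := nsq (L2class g).
have X0 : 0 <= X := L2dot_ge0 _; have Y0 : 0 <= Y := L2dot_ge0 _.
rewrite leNgt; apply/negP => YX.
have YX1 : Y <= X by apply: (le_trans (ltW YX)); rewrite ler_piMl// /m ge_min lexx orbT.
have YXd : Y <= d * X by apply: (le_trans (ltW YX)); rewrite ler_wpM2r// /m ge_min lexx.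
have half T : 0 <= T -> sq (fun t => Re (f t)) (fun t => Im (f t)) T <= X / 2.
  move=> T0; pose b := Num.max T B.
  have b0 : 0 <= b by rewrite le_max T0.
  have wb := zsol_global_weight lp lQ pQt C0 confining zP sg u10 u20
    (fun T => @sq_le_L2 R f T) (fun T => @sq_le_L2 R g T) b0.
  apply: (@le_trans _ _ (sq (fun t => Re (f t)) (fun t => Im (f t)) b)).
    have [sf _ _] := L2fun_locint f; apply: prim_nd; [exact: sqint_locint| |exact: T0|by rewrite le_max lexx].
    by move=> s _; rewrite -!expr2 addr_ge0 ?sqr_ge0.
  apply: (coer b _ _ _ _ _ _ _ X zP u10 u20 sg X0).
  - by rewrite le_max lexx orbT.
  - exact: sq_le_L2.
  - apply: (le_trans wb); rewrite -/X -/Y.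
    have -> : 4 * weight_cst C (Re z) (Im z) * X = 2 * weight_cst C (Re z) (Im z) * (X + X) by ring.
    by rewrite ler_wpM2l ?mulr_ge0// lerD2l.
  - exact: le_trans (sq_le_L2 g b0) YXd.
have := L2_le_sq half; rewrite -/X => X2.
have X00 : X = 0 := le_half0 X0 X2.
by move: YX; rewrite X00 mulr0 ltNge Y0.
Qed.

Lemma L2_eigenvector z f1 h1 f2 h2 A : phi z f1 h1 f2 h2 ->
  (forall T, 0 <= T -> sq f1 f2 T <= A) -> exists f : L2fun R,
  [/\ (f : R -> R[i]) = (fun t => f1 t +i* f2 t), L2class f != 0 & G (L2class f, z *: L2class f)].
Proof.
move=> ph fA; have [phP f10 f20 h10 h20] := ph.
have zP : zsol p Q (Re z) (Im z) f1 h1 f2 h2 (fun t => Re ((0 : L2fun R) t)) (fun t => Im ((0 : L2fun R) t)).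
  by [].
have [f [fE Gf]] := zsol_Gmax cp cQ zP f10 f20 fA.
exists f; split=> //.
  apply/negP => /eqP f0; have := sq_le_L2 f (ler01 : 0 <= 1 :> R).
  rewrite f0 (dot0l (@L2dotDl R)) fE leNgt.
  by rewrite (sq_phi_gt0 lQ phP f10 h10 ltr01).
have c0 : L2class (0 : L2fun R) = 0 by apply: (addrI (L2class 0)); rewrite -L2classD !addr0.
by rewrite c0 add0r in Gf.
Qed.

Lemma eigenvalue_real z x : x != 0 -> G (x, z *: x) -> Im z = 0.
Proof.
move=> x0 Gx; have := Gmax_symmetric cp cQ pQt C0 confining Gx Gx.
rewrite (dotZl (@L2dotDl R)) (dotZr (@L2dotDl R) (@L2dotC R)).
have xx : 0 < nsq x.
  rewrite lt_neqAle L2dot_ge0 andbT eq_sym; apply: contraNneq x0 => h; apply/eqP.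
  exact: L2dot_eq0.
move: xx (dot_Im (@L2dotC R) x); case: (L2dot x x) => r s /= r0 ->.
case: z {Gx} => a b /= [] _; rewrite !mulr0 !add0r => /eqP; rewrite mulNr -subr_eq0 opprK.
rewrite -mulrDl mulf_eq0 (gt_eqF r0) orbF -mulr2n mulrn_eq0/= => /eqP.
by [].
Qed.

Lemma eigenvalue_orthogonal z w x y : x != 0 -> y != 0 -> G (x, z *: x) -> G (y, w *: y) ->
  w != z -> L2dot y x = 0.
Proof.
move=> x0 y0 Gx Gy wz; have z0 := eigenvalue_real x0 Gx.
have := Gmax_symmetric cp cQ pQt C0 confining Gy Gx.
rewrite (dotZl (@L2dotDl R)) (dotZr (@L2dotDl R) (@L2dotC R)).
have -> : conjc z = z by case: z {Gx wz} z0 => a b /= ->; rewrite oppr0.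
move/eqP; rewrite -subr_eq0 -mulrBl mulf_eq0 subr_eq0 (negbTE wz)/= => /eqP.
by [].
Qed.

(** An eigenvector [y] for another eigenvalue [w] is orthogonal to [phi] and solves
    [(H - z) y = (w - z) y]; when [|w - z|] is small, coercivity on the orthogonal
    complement of [phi] gives [|y|^2 <= |y|^2 / 2]. *)
Lemma eigenvalue_isolated z f1 h1 f2 h2 A : phi z f1 h1 f2 h2 ->
  (forall T, 0 <= T -> sq f1 f2 T <= A) ->
  exists2 e : R, 0 < e & forall w y, y != 0 -> G (y, w *: y) -> normc (w - z) < e -> w = z.
Proof.
move=> ph fA; have [phP f10 f20 h10 h20] := ph.
have [f [fE f0 Gf]] := L2_eigenvector ph fA.
have W0 := weight_cst_ge0 C0 (Re z) (Im z).
have c0 : 0 <= 4 * weight_cst C (Re z) (Im z) by rewrite mulr_ge0.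
have [d d0 coer] := coercive_orthogonal lp lQ phP f10 f20 h10 h20 c0 fA.
exists (Num.min d 1) => [|w y y0 Gy]; first by rewrite lt_min d0 ltr01.
rewrite lt_min => /andP[wd w1]; apply/eqP; apply/negP => /negP wz.
have orth := eigenvalue_orthogonal f0 y0 Gf Gy wz.
have Gy' : Gmax p Q (y, (w - z) *: y + z *: y) by rewrite -scalerDl subrK.
have [u [g [w1' [w2' [yE gE zP [u10 u20]]]]]] := Gmax_zsol cp cQ Gy'.
have [sg _ _] := L2fun_locint g.
set X := nsq y; have X0 : 0 <= X := L2dot_ge0 _.
have n0 : 0 <= normc (w - z) by case: (w - z) => ? ?; exact: sqrtr_ge0.
have n2 : normc (w - z) ^+ 2 <= normc (w - z) by rewrite expr2 ler_piMl// ltW.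
have Yn : nsq (L2class g) = normc (w - z) ^+ 2 * X by rewrite -gE nsqZ normc2E.
have Y1 : nsq (L2class g) <= X.
  by rewrite Yn ler_piMl// (le_trans n2)// ltW.
have Yd : nsq (L2class g) <= d * X.
  by rewrite Yn ler_wpM2r// (le_trans n2)// ltW.
have uX T : 0 <= T -> sq (fun t => Re (u t)) (fun t => Im (u t)) T <= X.
  by rewrite /X yE; exact: sq_le_L2.
have half : forall T, 0 <= T -> sq (fun t => Re (u t)) (fun t => Im (u t)) T <= X / 2.
  apply: (coer _ _ _ _ _ _ X zP u10 u20 sg X0 uX).
  - move=> T T0; apply: (le_trans (zsol_global_weight lp lQ pQt C0 confining zP sg u10 u20 uX
      (fun T => @sq_le_L2 R g T) T0)).
    have -> : 4 * weight_cst C (Re z) (Im z) * X = 2 * weight_cst C (Re z) (Im z) * (X + X) by ring.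
    by rewrite ler_wpM2l ?mulr_ge0// lerD2l.
  - by move=> T T0; exact: le_trans (sq_le_L2 g T0) Yd.
  move=> a1 a2 B uB T T0; apply: (le_trans (uX T T0)).
  pose a := a1 +i* a2.
  have hB : nsq (y - a *: L2class f) <= B.
    have aE : a *: L2class f = L2class (a *: f) by rewrite L2classZ.
    rewrite yE aE L2class_sub; apply: L2_le_sq => S S0.
    apply: le_trans (uB S S0); rewrite le_eqVlt; apply/orP; left; apply/eqP.
    apply: eq_prim => s _.
    have [-> ->] := L2fun_subE u (a *: f) s.
    have -> : (a *: f) s = a * f s by [].
    by rewrite fE /a/= ; congr (_ * _ + _ * _); ring.
  apply: le_trans hB.
  have := nsqZ (- a) (L2class f).
  rewrite -scaleNr (dotDl' (@L2dotDl R)) !(dotDr (@L2dotDl R) (@L2dotC R)).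
  rewrite [L2dot y (- a *: _)](dotZr (@L2dotDl R) (@L2dotC R)) orth mulr0 addr0.
  rewrite [L2dot (- a *: _) y](dotZl (@L2dotDl R)) [L2dot (L2class f) y]L2dotC orth.
  have -> : - a * conjc 0 = 0 :> R[i] by rewrite /= oppr0 mulr0.
  rewrite add0r => e1.
  have reD (c1 c2 : R[i]) : Re (c1 + c2) = Re c1 + Re c2 by case: c1; case: c2.
  rewrite reD e1 lerDl mulr_ge0 ?L2dot_ge0//.
  by rewrite addr_ge0 ?sqr_ge0.
have := L2_le_sq half; rewrite -yE -/X => X2.
have X00 : X = 0 := le_half0 X0 X2.
by move: y0; rewrite (L2dot_eq0 X00) eqxx.
Qed.

Lemma spectrum_phi z f1 h1 f2 h2 : phi z f1 h1 f2 h2 -> spectrum L2dot G z ->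
  exists A, forall T, 0 <= T -> sq f1 f2 T <= A.
Proof.
by move=> ph sz; case: (nonL2_dec f1 f2) => // /(nonL2_resolvent ph).
Qed.

Lemma Gmax_discrete : purely_discrete_spectrum L2dot G.
Proof.
move=> z sz; have [f1 [h1 [f2 [h2 ph]]]] := phi_exists z.
have [A fA] := spectrum_phi ph sz; have [f [fE f0 Gf]] := L2_eigenvector ph fA.
split; last first.
- exists 1%N, (fun=> L2class f) => x Gx.
  have [u [a1 [a2 [xE uP]]]] := kernel_phi ph Gx; exists (fun=> a1 +i* a2).
  have -> : \sum_(i < 1) (a1 +i* a2) *: L2class f = L2class ((a1 +i* a2) *: f).
    by rewrite big_ord1 L2classZ.
  rewrite xE; apply: L2class_eq => T T0.
  apply: le_trans (uP T T0); rewrite le_eqVlt; apply/orP; left; apply/eqP.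
  apply: eq_prim => s _.
  have -> : ((a1 +i* a2) *: f) s = (a1 +i* a2) * f s by [].
  by rewrite fE /=; congr (_ * _ + _ * _); ring.
- by exists (L2class f).
have [e e0 eP] := eigenvalue_isolated ph fA; exists e => // w sw.
have [g1 [k1 [g2 [k2 pw]]]] := phi_exists w.
have [B gB] := spectrum_phi pw sw; have [g [_ g0 Gg]] := L2_eigenvector pw gB.
exact: eP Gg.
Qed.

(** Either 0 is in the resolvent set, or it is an isolated eigenvalue and a nearby
    real point is. *)
Lemma real_resolvent_point : exists l : R, resolvent_set L2dot G l%:C.
Proof.
have [f1 [h1 [f2 [h2 ph]]]] := phi_exists 0.
have [/(nonL2_resolvent ph)|[A fA]] := nonL2_dec f1 f2; first by exists 0.
have [e e0 eP] := eigenvalue_isolated ph fA; exists (e / 2).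
have [g1 [k1 [g2 [k2 pw]]]] := phi_exists (e / 2)%:C.
have [/(nonL2_resolvent pw)//|[B gB]] := nonL2_dec g1 g2.
have [g [_ g0 Gg]] := L2_eigenvector pw gB.
have e2 : 0 < e / 2 by rewrite divr_gt0.
have /(congr1 (@complex.Re R))/= e20 : (e / 2)%:C = 0 :> R[i].
  apply: (eP _ _ g0 Gg); rewrite subr0 /normc/= expr0n addr0 sqrtr_sqr gtr0_norm//.
  by rewrite ltr_pdivrMr// ltr_pMr// ltr1n.
by rewrite e20 ltxx in e2.
Qed.

Lemma H0S_self_adjoint_discrete : self_adjoint L2dot (H0S p Q) /\
  purely_discrete_spectrum L2dot (H0S p Q).
Proof.
have [lin dense _ sym] := H0S_basic cp cQ.
have E : H0S p Q = G := H0S_Gmax cp cQ pQt C0 confining.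
split; last by rewrite E; exact: Gmax_discrete.
have [l [onto _]] := real_resolvent_point.
apply: (symmetric_onto_self_adjoint (@L2dotDl R) (@L2dotC R) (@L2dot_eq0 R) (l := l)) => // y.
by have [x [Gx _]] := onto y; exists x; rewrite E.
Qed.

End discrete_spectrum.

(** * Gaussian tails *)

Section normal_tail.
Context {R : realType}.
Local Notation mu := (@lebesgue_measure R).

Lemma expRN_le (y : R) : 0 < y -> expR (- y) <= 2 / y ^+ 2.
Proof.
move=> y0; have := expR_ge1Dxn 1 (ltW y0); rewrite (_ : 2`! = 2)%N// => h.
rewrite expRN -[leRHS]invrK lef_pV2 ?posrE ?expR_gt0 ?invr_gt0 ?divr_gt0 ?exprn_gt0//.
by rewrite invf_div; apply: le_trans h; rewrite lerDr.
Qed.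

(** Half of the Gaussian exponent is turned into the density of a normal law of
    twice the variance, whose integral is 1; the other half is at most
    [32 * (s / a) ^ 4] by [expRN_le]. *)
Lemma normal_tail (s a : R) : 0 < s -> 0 < a ->
  (normal_prob 0 s [set x | a < `|x|]%R <= (64 * (s / a) ^+ 4)%:E)%E.
Proof.
move=> s0 a0; pose s' := s * Num.sqrt 2.
have s20 : 0 < Num.sqrt 2 :> R by rewrite sqrtr_gt0.
have s'0 : 0 < s' by rewrite mulr_gt0.
have s'2 : s' ^+ 2 = 2 * s ^+ 2 by rewrite exprMn sqr_sqrtr// mulrC.
pose V : set R := [set x | a < `|x|]%R.
have mV : measurable V.
  rewrite (_ : V = (fun x : R => `|x|) @^-1` `]a, +oo[).
    by rewrite -[X in measurable X]setTI; apply: normr_measurable => //; exact: measurable_itv.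
  by apply/seteqP; split=> x /=; rewrite in_itv/= andbT.
pose K : R := 64 * (s / a) ^+ 4.
have K0 : 0 <= K by rewrite mulr_ge0// exprn_ge0// divr_ge0 ?ltW.
have pw x : V x -> normal_pdf 0 s x <= K * normal_pdf 0 s' x.
  move=> Vx; rewrite !normal_pdfE ?gt_eqF//.
  have -> : normal_fun 0 s x = normal_fun 0 s' x * expR (- (x ^+ 2 / (4 * s ^+ 2))).
    rewrite /normal_fun -expRD s'2 !subr0; congr expR.
    rewrite -[s ^+ 2 *+ 2]mulr_natr -[(2 * s ^+ 2) *+ 2]mulr_natr; field.
    by rewrite gt_eqF.
  have -> : normal_peak s = Num.sqrt 2 * normal_peak s'.
    have E : 2 * s ^+ 2 * pi *+ 2 = 2 * (s ^+ 2 * pi *+ 2) :> R by rewrite [RHS]mulrnAr mulrA.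
    rewrite /normal_peak s'2 E [Num.sqrt (2 * _)]sqrtrM//.
    move: (Num.sqrt (s ^+ 2 * pi *+ 2)) => w.
    by rewrite invfM mulrA mulfV ?mul1r// gt_eqF.
  have x20 : 0 < x ^+ 2 by rewrite -[x ^+ 2]real_normK ?num_real// exprn_gt0// (lt_trans a0).
  have s2 : 0 < 4 * s ^+ 2 by rewrite mulr_gt0// exprn_gt0.
  have E1 : expR (- (x ^+ 2 / (4 * s ^+ 2))) <= 32 * (s / a) ^+ 4.
    apply: (le_trans (expRN_le (divr_gt0 x20 s2))).
    have -> : 32 * (s / a) ^+ 4 = 2 / (a ^+ 2 / (4 * s ^+ 2)) ^+ 2.
      by field; rewrite !gt_eqF.
    have ax : a ^+ 2 / (4 * s ^+ 2) <= x ^+ 2 / (4 * s ^+ 2).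
      rewrite ler_pM2r ?invr_gt0// -[leRHS]real_normK ?num_real//.
      by rewrite lerXn2r// ?nnegrE ltW.
    have a1 : 0 < a ^+ 2 / (4 * s ^+ 2) by rewrite divr_gt0 ?exprn_gt0.
    have x1 := lt_le_trans a1 ax.
    rewrite ler_pM2l// lef_pV2 ?posrE ?exprn_gt0//.
    by apply: lerXn2r; rewrite ?nnegrE ?(ltW a1) ?(ltW x1).
  have sq2 : Num.sqrt 2 <= 2 :> R.
    by rewrite -[leRHS]ger0_norm// -sqrtr_sqr ler_wsqrtr// expr2 ler_peMr// ler1n.
  have pf0 : 0 <= normal_peak s' * normal_fun 0 s' x.
    by rewrite mulr_ge0 ?normal_peak_ge0 ?normal_fun_ge0.
  have -> : Num.sqrt 2 * normal_peak s' * (normal_fun 0 s' x * expR (- (x ^+ 2 / (4 * s ^+ 2)))) =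
    (Num.sqrt 2 * expR (- (x ^+ 2 / (4 * s ^+ 2)))) * (normal_peak s' * normal_fun 0 s' x) by ring.
  rewrite ler_wpM2r// /K (_ : 64 * _ = 2 * (32 * (s / a) ^+ 4)); last by ring.
  by rewrite ler_pM ?sqrtr_ge0 ?expR_ge0.
rewrite /normal_prob -/V.
have mp t : measurable_fun setT (EFin \o (normal_pdf 0 t : R -> R)).
  by apply/measurable_EFinP; exact: measurable_normal_pdf.
apply: (@le_trans _ _ (\int[mu]_(x in V) (K%:E * (normal_pdf 0 s' x)%:E))%E).
  apply: ge0_le_integral => //.
  - by move=> x _; rewrite lee_fin normal_pdf_ge0.
  - exact: measurable_funTS (mp s).
  - by apply: measurable_funeM; exact: measurable_funTS (mp s').
rewrite ge0_integralZl_EFin//; last 2 first.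
- by move=> x _; rewrite lee_fin normal_pdf_ge0.
- exact: measurable_funTS (mp s').
rewrite -[leRHS]mule1 lee_wpmul2l ?lee_fin//.
rewrite -(@integral_normal_pdf R 0 s').
apply: ge0_subset_integral => //; first exact: (mp s').
by move=> x _; rewrite lee_fin normal_pdf_ge0.
Qed.

End normal_tail.

(** * Oscillation of Brownian paths *)

Section chaining.
Context {R : realType}.
Local Notation mu := (@lebesgue_measure R).
Local Notation hl := (@half_line R).

Definition dyadic (n k j : nat) : R := n%:R + j%:R / 2 ^+ k.

(** The points of level [k] are the even points of level [k.+1]. *)
Lemma dyadicS n k j : dyadic n k.+1 j.*2 = dyadic n k j.
Proof.
rewrite /dyadic -muln2 natrM exprS; congr (_ + _).
by rewrite invfM mulrA mulfK// pnatr_eq0.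
Qed.

(** Increments of at most [lam / 8 * (7/8) ^ k] at level [k] add up to at most [lam],
    since [sum (7/8) ^ k = 8]; an odd point of level [k.+1] is one step away from an
    even one. *)
Lemma dyadic_chain (f : R -> R) n (lam : R) : 0 <= lam ->
  (forall k j, (j < 2 ^ k)%N ->
    `|f (dyadic n k j.+1) - f (dyadic n k j)| <= lam / 8 * (7 / 8) ^+ k) ->
  forall k j, (j <= 2 ^ k)%N -> `|f (dyadic n k j) - f n%:R| <= lam * (1 - (7 / 8) ^+ k.+1).
Proof.
move=> l0 inc; elim=> [|k IH] j.
  have d0 : dyadic n 0 0 = n%:R by rewrite /dyadic mul0r addr0.
  have lE : lam * (1 - (7 / 8) ^+ 1) = lam / 8 * (7 / 8) ^+ 0 by rewrite expr1 expr0; field.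
  rewrite expn0; case: j => [_|[_|//]].
    by rewrite d0 subrr normr0 lE mulr_ge0// ?expr0// divr_ge0.
  by have := inc 0%N 0%N isT; rewrite d0 lE.
have t0 : 0 <= (7 / 8 : R) ^+ k.+1 by rewrite exprn_ge0// divr_ge0.
have tS : (7 / 8 : R) ^+ k.+2 = 7 / 8 * (7 / 8) ^+ k.+1 by rewrite exprS.
have lt0 : 0 <= lam * (7 / 8) ^+ k.+1 by rewrite mulr_ge0.
have ev m : (m <= 2 ^ k)%N -> `|f (dyadic n k.+1 m.*2) - f n%:R| <= lam * (1 - (7 / 8) ^+ k.+1).
  by move=> mk; rewrite dyadicS; exact: IH.
rewrite -(odd_double_half j); set m := (j./2); case: (odd j) => /= jk.
  have mk : (m < 2 ^ k)%N.
    by move: jk; rewrite add1n expnS mul2n ltn_double.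
  have h1 := ev m (ltnW mk); have h2 := inc k.+1 m.*2 _.
  apply: (le_trans (ler_distD (f (dyadic n k.+1 m.*2)) _ _)).
  apply: (le_trans (lerD (h2 _) h1)); first by rewrite expnS mul2n ltn_double.
  rewrite tS le_eqVlt; apply/orP; left; apply/eqP; by field.
rewrite ?add0n; apply: (le_trans (ev m _)).
  by move: jk; rewrite expnS mul2n leq_double.
by rewrite tS ler_wpM2l// lerD2l lerN2 ler_piMl// ler_pdivrMr// mul1r ler_nat.
Qed.

(** Dyadic points are dense and [f] is continuous. *)
Lemma chain_bound (f : R -> R) n (lam : R) : {within hl, continuous f} -> 0 <= lam ->
  (forall k j, (j < 2 ^ k)%N ->
    `|f (dyadic n k j.+1) - f (dyadic n k j)| <= lam / 8 * (7 / 8) ^+ k) ->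
  forall t, n%:R <= t <= n%:R + 1 -> `|f t - f n%:R| <= lam.
Proof.
move=> /within_max0_continuous cf l0 inc t /andP[nt tn].
have t0 : 0 <= t := le_trans (ler0n _ _) nt.
apply/ler_addgt0Pr => e e0.
have /cvgrPdist_lt/(_ _ e0)[d /= d0 dP] := cf t.
have [k kd] : exists k, (2 ^+ k)^-1 < d.
  exists (Num.truncn d^-1).+1; rewrite invf_plt ?posrE ?exprn_gt0//.
  apply: (lt_le_trans (truncnS_gt _)); rewrite -natrX ler_nat.
  exact: ltnW (ltn_expl _ _).
have k0 : 0 < 2 ^+ k :> R by rewrite exprn_gt0.
have x0 : 0 <= 2 ^+ k * (t - n%:R) by rewrite mulr_ge0 ?subr_ge0// ltW.
pose j := Num.truncn (2 ^+ k * (t - n%:R)).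
have /andP[j1 j2] := truncn_itv x0; rewrite -/j in j1 j2.
have jk : (j <= 2 ^ k)%N.
  rewrite -(ler_nat R) natrX; apply: (le_trans j1).
  by rewrite ger_pMr// lerBlDl.
have dt : dyadic n k j <= t.
  by rewrite /dyadic -lerBrDl ler_pdivrMr// mulrC.
have td : t - dyadic n k j < (2 ^+ k)^-1.
  have : t - n%:R < j.+1%:R / 2 ^+ k by rewrite ltr_pdivlMr// mulrC.
  rewrite -natr1 mulrDl mul1r /dyadic => h; by rewrite opprD addrA ltrBlDr [X in _ < X]addrC.
have s0 : 0 <= dyadic n k j by rewrite /dyadic addr_ge0// divr_ge0// ltW.
have := dP (dyadic n k j); rewrite /= !max_l// => /(_ _)/ltW h.
have h1 := dyadic_chain l0 inc jk.
have h2 : lam * (1 - (7 / 8) ^+ k.+1) <= lam.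
  by rewrite ler_piMr// gerBl exprn_ge0// divr_ge0.
apply: (le_trans (ler_distD (f (dyadic n k j)) _ _)).
rewrite addrC lerD ?(le_trans h1)// h// ger0_norm ?subr_ge0//.
exact: lt_trans td kd.
Qed.

Lemma nneseries_le_partial (u : nat -> \bar R) (M : R) : (forall n, (0 <= u n)%E) ->
  (forall n, (\sum_(0 <= i < n) u i <= M%:E)%E) -> (\sum_(0 <= i <oo) u i <= M%:E)%E.
Proof.
move=> u0 uM; apply: lime_le; first by apply: is_cvg_nneseries => n _ _; exact: u0.
exact: nearW.
Qed.

Lemma geometric_sum_bound (r : R) n : 0 <= r -> 7 * r <= 6 -> \sum_(0 <= k < n) r ^+ k <= 7.
Proof.
move=> r0 r7; suff : \sum_(0 <= k < n) r ^+ k <= 7 - 7 * r ^+ n.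
  by move/le_trans; apply; rewrite gerBl mulr_ge0// exprn_ge0.
elim: n => [|n IH]; first by rewrite big_nil expr0 mulr1 subrr.
rewrite big_nat_recr//= exprS mulrA.
have : 7 * r * r ^+ n <= 6 * r ^+ n by rewrite ler_wpM2r// exprn_ge0.
by move: (\sum_(0 <= i < n) _) (r ^+ n) (7 * r * _) IH => S x y; lra.
Qed.

(** The ratio of the tail bounds at consecutive levels: twice as many increments,
    each with a quarter of the squared variance, against a threshold whose fourth
    power shrinks by [(7/8) ^ 4].  It is less than 1 because [7/8] exceeds
    [2 ^ (-1/4)]. *)
Definition level_ratio : R := (8 / 7) ^+ 4 / 2.

Lemma level_ratio_ge0 : 0 <= level_ratio.
Proof. by rewrite divr_ge0// exprn_ge0// divr_ge0. Qed.

Lemma level_ratio_le : 7 * level_ratio <= 6.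
Proof. by rewrite /level_ratio !exprS expr0; lra. Qed.

(** Comparison with the telescoping series of [2 / (n (n + 1))]. *)
Lemma inverse_square_sum_bound n : \sum_(0 <= k < n) (k.+1%:R ^+ 2)^-1 <= 2 :> R.
Proof.
suff : \sum_(0 <= k < n) (k.+1%:R ^+ 2)^-1 <= 2 - 2 / n.+1%:R :> R.
  by move/le_trans; apply; rewrite gerBl divr_ge0.
elim: n => [|n IH]; first by rewrite big_nil divr1 subrr.
rewrite big_nat_recr//=; apply: (le_trans (lerD IH (lexx _))).
have m0 : 0 < n.+1%:R :> R by rewrite ltr0n.
have m1 : 1 <= n.+1%:R :> R by rewrite ler1n.
rewrite -[n.+2%:R]natr1; move: (n.+1%:R) m0 m1 => m m0 m1.
have m10 : 0 < m + 1 by lra.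
rewrite -subr_ge0; set X := (X in 0 <= X).
have -> : X = (m - 1) / (m ^+ 2 * (m + 1)).
  by rewrite /X; field; rewrite !gt_eqF.
by rewrite divr_ge0 ?subr_ge0// mulr_ge0 ?sqr_ge0// ltW.
Qed.

End chaining.

Section oscillation.
Context {R : realType} {dO : measure_display} {Omega : measurableType dO}
  {P : probability Omega R} {B : R -> Omega -> R}.
Hypothesis BM : standard_brownian_motion P B.

Definition increment_exceeds (s t a : R) : set Omega :=
  [set omega | a < `|B t omega - B s omega|].

Lemma measurable_increment (s t a : R) : 0 <= s -> 0 <= t ->
  measurable (increment_exceeds s t a).
Proof.
move=> s0 t0; have [mB _ _ _ _] := BM.
have mf : measurable_fun setT (fun omega => `|B t omega - B s omega|).
  by apply: measurableT_comp => //; apply: measurable_funB; exact: mB.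
rewrite (_ : increment_exceeds s t a = setT `&` (fun omega => `|B t omega - B s omega|) @^-1` `]a, +oo[).
  by apply: mf => //; exact: measurable_itv.
by rewrite setTI; apply/seteqP; split=> x /=; rewrite in_itv/= andbT.
Qed.

(** The increment is normal with standard deviation [sqrt (t - s)]. *)
Lemma increment_tail (s t a : R) : 0 <= s -> s < t -> 0 < a ->
  (P (increment_exceeds s t a) <= (64 * ((t - s) ^+ 2 / a ^+ 4))%:E)%E.
Proof.
move=> s0 st a0; have [_ _ _ incr _] := BM.
have mV : measurable [set x : R | a < `|x|].
  rewrite (_ : [set _ | _] = (fun x : R => `|x|) @^-1` `]a, +oo[).
    by rewrite -[X in measurable X]setTI; apply: normr_measurable => //; exact: measurable_itv.
  by apply/seteqP; split=> x /=; rewrite in_itv/= andbT.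
have ts : 0 < t - s by rewrite subr_gt0.
have := incr s t s0 st _ mV => /= E.
have -> : increment_exceeds s t a =
  (fun omega => B t omega - B s omega) @^-1` [set x : R | a < `|x|] by [].
rewrite E; have := @normal_tail R (Num.sqrt (t - s)) a _ a0; rewrite sqrtr_gt0 => /(_ ts).
rewrite expr_div_n (_ : Num.sqrt (t - s) ^+ 4 = (t - s) ^+ 2)//.
by rewrite (exprM _ 2 2) sqr_sqrtr// ltW.
Qed.

Variable c : R.
Hypothesis c0 : 0 < c.

Let lam (n : nat) : R := c * Num.sqrt n.+1%:R.
Let thr n k : R := lam n / 8 * (7 / 8) ^+ k.
Let K : R := 64 * 8 ^+ 4 / c ^+ 4.

Definition level_exceeds n k : set Omega := \big[setU/set0]_(j < 2 ^ k)
  increment_exceeds (dyadic n k j) (dyadic n k j.+1) (thr n k).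

Let lam0 n : 0 < lam n.
Proof. by rewrite mulr_gt0// sqrtr_gt0. Qed.

Let thr0 n k : 0 < thr n k.
Proof. by rewrite !mulr_gt0 ?exprn_gt0 ?divr_gt0. Qed.

Let dyadic0 n k j : 0 <= dyadic n k j :> R.
Proof. by rewrite /dyadic addr_ge0// divr_ge0// exprn_ge0. Qed.

Lemma measurable_level n k : measurable (level_exceeds n k).
Proof. by apply: bigsetU_measurable => j _; exact: measurable_increment. Qed.

Lemma level_tail n k : (P (level_exceeds n k) <=
  (K * (n.+1%:R ^+ 2)^-1 * level_ratio ^+ k)%:E)%E.
Proof.
pose A j := increment_exceeds (dyadic n k j) (dyadic n k j.+1) (thr n k).
have mA j : measurable (A j) by exact: measurable_increment.
apply: (le_trans (@Boole_inequality _ _ _ P A (2 ^ k) (fun i _ => mA i))).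
have k0 : 0 < 2 ^+ k :> R by rewrite exprn_gt0.
pose b : R := K * (n.+1%:R ^+ 2)^-1 * (level_ratio / 2) ^+ k.
have Ab j : (P (A j) <= b%:E)%E.
  have dd : dyadic n k j < dyadic n k j.+1 :> R.
    by rewrite /dyadic ltrD2l ltr_pM2r ?invr_gt0// ltr_nat.
  apply: (le_trans (increment_tail (dyadic0 n k j) dd (thr0 n k))).
  rewrite lee_fin le_eqVlt; apply/orP; left; apply/eqP.
  have -> : dyadic n k j.+1 - dyadic n k j = (2 ^+ k)^-1 :> R.
    by rewrite /dyadic -natr1; field; rewrite gt_eqF.
  have -> : thr n k ^+ 4 = c ^+ 4 * n.+1%:R ^+ 2 / 8 ^+ 4 * ((7 / 8) ^+ 4) ^+ k.
    rewrite /thr /lam exprMn -exprM mulnC exprM; congr (_ * _).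
    rewrite expr_div_n exprMn; congr (_ * _ / _).
    by rewrite (exprM _ 2 2) sqr_sqrtr.
  rewrite /b /K.
  have -> : (2 ^+ k)^-1 ^+ 2 = ((4 : R)^-1) ^+ k.
    rewrite exprVn -exprM mulnC exprM exprVn; congr (_ ^- _).
    by rewrite expr2 -natrM.
  have e78 : (7 / 8 : R) ^+ 4 != 0 by apply: expf_neq0; rewrite gt_eqF// divr_gt0.
  have -> : (level_ratio / 2 : R) ^+ k = (4^-1) ^+ k / ((7 / 8) ^+ 4) ^+ k.
    rewrite -expr_div_n; congr (_ ^+ _); rewrite /level_ratio -[8 / 7]invf_div exprVn.
    move: ((7 / 8) ^+ 4) e78 => T T0; field.
    by rewrite T0.
  have t0 : ((7 / 8 : R) ^+ 4) ^+ k != 0 := expf_neq0 _ e78.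
  move: (((7 / 8) ^+ 4) ^+ k) t0 => T T0; field.
  by rewrite T0 !gt_eqF// ltr0n.
apply: (@le_trans _ _ (\sum_(i < 2 ^ k) b%:E)%E); first by apply: lee_sum => i _; exact: Ab.
rewrite sumEFin lee_fin sumr_const card_ord -[b *+ _]mulr_natr natrX /b -[leLHS]mulrA.
rewrite ler_wpM2l//.
  by rewrite divr_ge0 ?sqr_ge0// /K divr_ge0 ?exprn_ge0// ltW.
by rewrite -exprMn divfK.
Qed.

Definition exceeds n : set Omega := \bigcup_k level_exceeds n k.

Lemma measurable_exceeds n : measurable (exceeds n).
Proof. by apply: bigcup_measurable => k _; exact: measurable_level. Qed.

Lemma exceeds_tail n : (P (exceeds n) <= (7 * K * (n.+1%:R ^+ 2)^-1)%:E)%E.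
Proof.
have K0 : 0 <= K by rewrite /K divr_ge0 ?exprn_ge0// ltW.
apply: (le_trans (generalized_Boole_inequality P (measurable_level n) (measurable_exceeds n))).
apply: nneseries_le_partial => // N.
apply: (@le_trans _ _ (\sum_(0 <= k < N) (K * (n.+1%:R ^+ 2)^-1 * level_ratio ^+ k)%:E)%E).
  by apply: lee_sum => k _; exact: level_tail.
rewrite sumEFin lee_fin -mulr_sumr -mulrA mulrC.
by rewrite ler_wpM2r ?geometric_sum_bound ?level_ratio_ge0 ?level_ratio_le// divr_ge0 ?sqr_ge0.
Qed.

(** The threshold [c * sqrt (n + 1)] makes the probabilities of [exceeds n]
    summable, being of order [(n + 1) ^ (-2)] for the fourth-power tail, while its
    square grows only linearly and can be kept below the potential [t]. *)
Lemma brownian_oscillation : {ae P, forall omega, exists N, forall n, (N <= n)%N ->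
  forall t, n%:R <= t <= n%:R + 1 -> `|B t omega - B n%:R omega| <= c * Num.sqrt n.+1%:R}.
Proof.
have K0 : 0 <= K by rewrite /K divr_ge0 ?exprn_ge0// ltW.
have fin : (\sum_(0 <= n <oo) P (exceeds n) < +oo)%E.
  apply: (@le_lt_trans _ _ (14 * K)%:E); last exact: ltry.
  apply: nneseries_le_partial => // N.
  apply: (@le_trans _ _ (\sum_(0 <= n < N) (7 * K * (n.+1%:R ^+ 2)^-1)%:E)%E).
    by apply: lee_sum => k _; exact: exceeds_tail.
  rewrite sumEFin lee_fin -mulr_sumr (_ : 14 * K = 7 * K * 2); last by ring.
  by apply: ler_wpM2l; [rewrite mulr_ge0|exact: inverse_square_sum_bound].
have null := lim_sup_set_cvg0 measurable_exceeds fin.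
exists (lim_sup_set exceeds); split=> //.
  apply: bigcap_measurable => [|n _]; first by exists 0%N.
  apply: bigcup_measurable => k _; exact: measurable_exceeds.
move=> omega; apply: contra_notP => /= small.
have {small}[N HN] : exists N, forall j, (N <= j)%N -> ~ exceeds j omega.
  apply: contrapT => /forallNP h; apply: small => N _.
  by have /existsNP[j /not_implyP[Nj /contrapT jo]] := h N; exists j.
exists N => n Nn; have [_ _ cB _ _] := BM.
apply: (@chain_bound R (fun t => B t omega) n (lam n) (cB omega) (ltW (lam0 n))) => k j jk.
rewrite leNgt; apply/negP => ex; apply: (HN n Nn); exists k => //.
rewrite /level_exceeds -(bigcup_mkord _ (fun j =>
  increment_exceeds (dyadic n k j) (dyadic n k j.+1) (thr n k))).
by exists j.
Qed.

End oscillation.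

(** * Confinement along almost every path *)

Section confinement.
Context {R : realType}.
Local Notation mu := (@lebesgue_measure R).
Local Notation hl := (@half_line R).

(** With [D = 3/10 * sqrt (n + 2)] for [n <= t < n + 1], both [|q t|] and [|Q t - Qt t|]
    are at most [D], since [[t, t + 1]] meets only [[n, n + 1]] and [[n + 1, n + 2]].
    Moreover [2 * D ^ 2 = 18/100 * (n + 2)] and [D <= 15/100 * (n + 3)], which leaves
    more than [t / 2 - 1].  On the remaining compact interval everything is
    bounded. *)
Lemma confining_of_oscillation (Q : R -> R) : {within hl, continuous Q} ->
  (exists N : nat, forall n, (N <= n)%N -> forall t, n%:R <= t <= n%:R + 1 ->
    `|Q t - Q n%:R| <= 10^-1 * Num.sqrt n.+1%:R) ->
  exists Qt q C, [/\ isprim Qt q, 0 <= C & forall t, 0 <= t ->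
    t / 2 - C <= t + q t - 2 * (Q t - Qt t) ^+ 2].
Proof.
(* [b] is [1/10 * sqrt (r + 2)] with [r] the integer part of [t], so [b ^ 2] is
   [(r + 2) / 100]. *)
have arith (m x y b r t : R) : 0 <= m -> 0 <= t -> r <= t -> 2 * b <= 1 / 10 + 10 * ((r + 2) / 100) ->
    - (3 * b) <= x -> y <= 9 * ((r + 2) / 100) -> t / 2 - (m + 1) <= t + x - 2 * y.
  by lra.
move=> cQ [N osc]; have cQ0 := within_max0_continuous cQ; set Q0 := (fun t => _) in cQ0.
have QE t : 0 <= t -> Q0 t = Q t by move=> t0; rewrite /Q0 max_l.
have lQ0 := lbm_continuous cQ0.
pose Qt := avg 1 Q0; pose q t := 1^-1 * (Q0 (t + 1) - Q0 t).
have D t (t0 : 0 < t) : is_derive (t : R) 1 Qt (q t) := avg_is_derive cQ0 ltr01 t0.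
have cq : continuous q := @difference_continuous R Q0 1 cQ0.
have cQt : continuous Qt := avg_continuous (d := 1) lQ0.
have pQt : isprim Qt q := isprim_derive cq cQt D.
have lh : lbm (fun t => q t - 2 * ((Q0 t - Qt t) * (Q0 t - Qt t))).
  have l1 := lbmB lQ0 (lbm_continuous cQt).
  apply: lbmB; first exact: lbm_continuous.
  by apply: lbmM; [exact: lbm_cst|exact: lbmM].
have [_ [M HM]] := lh N%:R.
exists Qt, q, (`|M| + 1); split => // t t0; have [tN|Nt] := leP t N%:R.
  have := HM t; rewrite t0 tN => /(_ isT) h; rewrite -QE// expr2.
  have := le_trans h (ler_norm M); rewrite ler_norml => /andP[+ _].
  move: (`|M|) (normr_ge0 M) (q t) (2 * _) => m m0 a b; clear -t0 m0; lra.
have /andP[nt tn] := truncn_itv t0; set n := Num.truncn t in nt tn.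
have Nn : (N <= n)%N by rewrite -ltnS -(ltr_nat R); exact: lt_trans Nt tn.
pose b : R := 10^-1 * Num.sqrt n.+2%:R.
have ab : 10^-1 * Num.sqrt n.+1%:R <= b by rewrite ler_wpM2l// ?invr_ge0// ler_wsqrtr// ler_nat.
have tn1 : t <= n%:R + 1 by rewrite natr1 ltW.
have on s : n%:R <= s <= n%:R + 1 -> `|Q s - Q n%:R| <= b.
  by move=> h; apply: le_trans ab; exact: osc.
have on1 s : n.+1%:R <= s <= n.+1%:R + 1 -> `|Q s - Q n.+1%:R| <= b.
  by move=> h; apply: osc => //; exact: leqW.
have close s : t <= s <= t + 1 -> `|Q0 s - Q0 t| <= 3 * b.
  move=> /andP[ts st]; rewrite !QE ?(le_trans t0 ts)//.
  have h1 := on t; rewrite nt tn1 in h1; have {}h1 := h1 isT.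
  have b0 : 0 <= b by rewrite mulr_ge0 ?invr_ge0 ?sqrtr_ge0.
  have tri (x y z w : R) : `|x - y| <= b -> `|y - z| <= b -> `|z - w| <= b -> `|x - w| <= 3 * b.
    by rewrite !ler_norml => /andP[? ?] /andP[? ?] /andP[? ?]; apply/andP; split; lra.
  have [sn|ns] := leP s (n%:R + 1).
    apply: (tri _ (Q n%:R) (Q n%:R)); last by rewrite distrC.
      by apply: on; rewrite sn (le_trans nt ts).
    by rewrite subrr normr0.
  apply: (tri _ (Q n.+1%:R) (Q n%:R)); last by rewrite distrC.
    apply: on1; rewrite -natr1 (ltW ns) (le_trans st)//.
    by rewrite lerD2r.
  by apply: on; rewrite natr1 lexx ler_nat leqnSn.
have hq : `|q t| <= 3 * b.
  by rewrite /q invr1 mul1r; apply: close; rewrite lexx lerDl ler01.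
have hQt : `|Qt t - Q0 t| <= 3 * b.
  have -> : Qt t - Q0 t = prim (fun s => Q0 s - Q0 t) (t + 1) - prim (fun s => Q0 s - Q0 t) t.
    have lc := locint_cst (Q0 t); have lQi := lbm_locint lQ0.
    rewrite !primB// !prim_cst ?addr_ge0// /Qt /avg invr1 mul1r; ring.
  have -> : 3 * b = 3 * b * (t + 1 - t) by rewrite addrAC subrr add0r mulr1.
  apply: prim_increment_le => //; last by move=> x /andP[/ltW ? ?]; apply: close; apply/andP.
    by apply: locintB; [exact: lbm_locint|exact: locint_cst].
  by rewrite lerDl.
have b2 : b ^+ 2 = (n%:R + 2) / 100.
  rewrite exprMn sqr_sqrtr// -[n.+2]addn2 natrD; by field.
rewrite -(QE t t0); have d2 : (Q0 t - Qt t) ^+ 2 <= 9 * ((n%:R + 2) / 100).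
  rewrite -b2 (_ : 9 * b ^+ 2 = (3 * b) ^+ 2); last by ring.
  rewrite -[leLHS]real_normK ?num_real// distrC lerXn2r ?nnegrE//.
  exact: le_trans hQt.
have b1 : 2 * b <= 1 / 10 + 10 * b ^+ 2.
  have := sqr_ge0 (10 * b - 1); set X := (X in 0 <= X) => X0.
  rewrite -subr_ge0; set Y := (Y in 0 <= Y).
  have -> : Y = X / 10 by rewrite /Y /X; field.
  by rewrite divr_ge0.
rewrite b2 in b1; move: hq; rewrite ler_norml => /andP[hq _].
exact: arith (normr_ge0 M) t0 nt b1 hq d2.
Qed.

End confinement.

Theorem theorem1 (R : realType) (d : measure_display) (Omega : measurableType d)
    (P : probability Omega R) (B : R -> Omega -> R) (beta : R)
    (beta_gt0 : 0 < beta) (BM : standard_brownian_motion P B) :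
  let H (omega : Omega) : set (L2 R * L2 R) :=
    H0S (fun t => t) (fun t => 2 / Num.sqrt beta * B t omega) in
  (forall omega,
    [/\ linear_operator (H omega),
        densely_defined L2dot (H omega),
        closed_operator L2dot (H omega) &
        symmetric_operator L2dot (H omega)]) /\
  {ae P, forall omega,
    self_adjoint L2dot (H omega) /\
    purely_discrete_spectrum L2dot (H omega)}.
Proof.
move=> H; have [_ _ cB _ _] := BM.
have cid : {within half_line, continuous (fun t : R => t)}.
  by apply: continuous_subspaceT => x; exact: cvg_id.
have cQ omega : {within half_line, continuous (fun t => 2 / Num.sqrt beta * B t omega)}.
  by move=> x; apply: cvgM; [exact: cvg_cst|exact: cB].
split=> [omega|]; first exact: H0S_basic.
have sb : 0 < Num.sqrt beta by rewrite sqrtr_gt0.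
have c0 : 0 < Num.sqrt beta / 20 by rewrite divr_gt0.
apply: filterS (brownian_oscillation BM c0) => omega [N osc].
have [|Qt [q [C [pQt C0 conf]]]] := confining_of_oscillation (cQ omega).
  exists N => n Nn t tn.
  have a0 : 0 < 2 / Num.sqrt beta by rewrite divr_gt0.
  rewrite -mulrBr normrM gtr0_norm//.
  apply: (@le_trans _ _ (2 / Num.sqrt beta * (Num.sqrt beta / 20 * Num.sqrt n.+1%:R))).
    by rewrite ler_pM2l//; exact: osc.
  rewrite le_eqVlt; apply/orP; left; apply/eqP; field.
  by rewrite gt_eqF.
exact: (H0S_self_adjoint_discrete cid (cQ omega) pQt C0 conf).
Qed.
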